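(* (1) There is a $2$-to-$1$ covering map $p:E\to B$ with $TC(E)>TC(B)$. (2) There is a finite complex $X$ with $TC(X)<TC(\tilde X)$, where $\tilde X$ is the universal covering of $X$.
   Context: For a space $X$, $PX=X^{[0,1]}$ is the space of all paths in $X$ and $\pi:PX\to X\times X$ is the fibration $\pi(f)=(f(0),f(1))$. $TC(X)$ is the minimal number $k$ such that $X\times X$ admits an open cover $U_1,\dots,U_k$ such that over each $U_i$ there is a continuous section $s_i:U_i\to PX$ of $\pi$. The spaces $X$ for which $TC$ is considered are ENRs (Euclidean neighborhood retracts). *)

(* Defs.v *)
From HB Require Import structures.
From mathcomp Require Import all_boot all_order all_algebra.
From mathcomp Require Import all_classical all_reals all_analysis.

Set Implicit Arguments.
Unset Strict Implicit.
Unset Printing Implicit Defensive.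

Import Order.TTheory GRing.Theory Num.Theory.
Import numFieldNormedType.Exports.

Local Open Scope classical_set_scope.
Local Open Scope ring_scope.
Local Open Scope card_scope.

(* Throughout, a set [A : set T] used as a type is the subtype [set_type A]
   with the subspace topology. *)

Section Homeomorphism.
Context {T U : topologicalType}.

Definition is_homeomorphism (f : T -> U) : Prop :=
  continuous f /\ exists g : U -> T, [/\ continuous g, cancel f g & cancel g f].

End Homeomorphism.

Definition homeomorphic (T U : topologicalType) : Prop :=
  exists f : T -> U, is_homeomorphism f.

Section PathSpace.
Variables (R : realType) (X : topologicalType).

Definition unit_interval : topologicalType :=
  set_type (`[0%R, 1%R]%classic : set R).

Lemma unit_interval_subproof0 : (0 : R) \in `[0%R, 1%R]%classic.
Proof. by rewrite inE /= in_itv /= lexx ler01. Qed.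

Lemma unit_interval_subproof1 : (1 : R) \in `[0%R, 1%R]%classic.
Proof. by rewrite inE /= in_itv /= lexx ler01. Qed.

Definition ui0 : unit_interval := exist _ (0 : R) unit_interval_subproof0.
Definition ui1 : unit_interval := exist _ (1 : R) unit_interval_subproof1.

Definition path_space : Type := continuousType unit_interval X.

Definition path_space_fun (f : path_space) :
  {compact-open, unit_interval -> X} := f : continuousType _ _.

HB.instance Definition _ := Choice.on path_space.
HB.instance Definition _ :=
  Topological.copy path_space (initial_topology path_space_fun).

Definition path_ends (f : path_space) : X * X :=
  (path_space_fun f ui0, path_space_fun f ui1).

End PathSpace.

Section TopologicalComplexity.
Variables (R : realType) (X : topologicalType).

Definition has_motion_planner (U : set (X * X)) : Prop :=
  exists s : U -> path_space R X,
    continuous s /\ forall z : U, path_ends (s z) = set_val z.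

Definition motion_planning_cover (k : nat) : Prop :=
  exists U : 'I_k -> set (X * X),
    [/\ forall i, open (U i), \bigcup_i U i = setT
      & forall i, has_motion_planner (U i)].

(* A relation rather than a function: no [k] satisfies it when no finite cover
   exists, so [is_TC k] asserts in particular that TC(X) is finite. *)
Definition is_TC (k : nat) : Prop :=
  motion_planning_cover k /\
  forall j : nat, motion_planning_cover j -> (k <= j)%N.

End TopologicalComplexity.

Definition is_ENR (R : realType) (X : topologicalType) : Prop :=
  exists (n : nat) (A O : set 'rV[R]_n),
    [/\ homeomorphic X A, open O, A `<=` O
      & exists r : O -> A, continuous r /\
          forall x : O, A (set_val x) -> set_val (r x) = set_val x].

Section Covering.
Context {E B : topologicalType}.

Definition evenly_covered (p : E -> B) (U : set B) : Prop :=
  exists (I : Type) (V : I -> set E),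
    [/\ forall i, open (V i), trivIset setT V, p @^-1` U = \bigcup_i V i
      & forall i, exists f : V i -> U,
          is_homeomorphism f /\ forall e : V i, set_val (f e) = p (set_val e)].

Definition is_covering_map (p : E -> B) : Prop :=
  [/\ continuous p, set_surj setT setT p
    & forall b : B, exists U : set B, [/\ open U, U b & evenly_covered p U]].

Definition two_to_one (p : E -> B) : Prop :=
  forall b : B, p @^-1` [set b] #= `I_2.

End Covering.

Section SimplyConnected.
Variables (R : realType) (X : topologicalType).

Definition path_connected : Prop :=
  [set: X] !=set0 /\
  forall x y : X, exists f : path_space R X, path_ends f = (x, y).

Definition null_homotopic_loop (x : X) (f : path_space R X) : Prop :=
  exists H : unit_interval R * unit_interval R -> X,
    [/\ continuous H,
        forall t, H (t, ui0 R) = path_space_fun f t,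
        forall t, H (t, ui1 R) = x
      & forall s, H (ui0 R, s) = x /\ H (ui1 R, s) = x].

Definition simply_connected : Prop :=
  path_connected /\
  forall (x : X) (f : path_space R X),
    path_ends f = (x, x) -> null_homotopic_loop x f.

End SimplyConnected.

Definition is_universal_covering (R : realType) (E B : topologicalType)
    (p : E -> B) : Prop :=
  is_covering_map p /\ simply_connected R E.

Section FiniteComplex.
Variable R : realType.

(* The Euclidean ball; the library norm on ['rV[R]_n] is the sup norm. *)
Definition disk (n : nat) : set 'rV[R]_n :=
  [set v | \sum_(i < n) v ord0 i ^+ 2 <= 1].

Definition open_disk (n : nat) : set 'rV[R]_n :=
  [set v | \sum_(i < n) v ord0 i ^+ 2 < 1].

Arguments disk : clear implicits.
Arguments open_disk : clear implicits.

(* Finite CW complexes, presented by cells [Phi i @` open_disk (d i)] with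
   characteristic maps [Phi i], of which only the values on [disk (d i)]
   matter.  As there are finitely many cells and [X] is Hausdorff, closure
   finiteness and the weak topology condition hold automatically, and each
   [Phi i] restricts to a homeomorphism from the open disk onto its cell. *)
Definition is_finite_complex (X : topologicalType) : Prop :=
  hausdorff_space X /\
  exists (N : nat) (d : 'I_N -> nat) (Phi : forall i : 'I_N, 'rV[R]_(d i) -> X),
    let cell i := Phi i @` open_disk (d i) in
    [/\ forall i, {within disk (d i), continuous (Phi i)},
        forall i, set_inj (open_disk (d i)) (Phi i),
        trivIset setT cell,
        \bigcup_i cell i = setT
      & forall i, Phi i @` (disk (d i) `\` open_disk (d i)) `<=`
          \bigcup_(j in [set j | (d j < d i)%N]) cell j].

End FiniteComplex.

(* Main.v *)
Require Import Defs.
From HB Require Import structures.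
From mathcomp Require Import all_boot all_order all_algebra all_fingroup.
From mathcomp Require Import all_classical all_reals all_analysis.
From mathcomp Require Import ring lra zify.

(** Let Y be the product of five 3-spheres, B the wedge of the projective plane and
    Y, and E the universal cover of B, that is, a 2-sphere with one copy of Y attached
    at each of its poles.  The covering E -> B has two sheets, and it witnesses both
    parts because TC(B) <= 10 < 11 <= TC(E).  The intuition is that a motion in B has to
    move through one copy of Y, and a motion between the two poles in E through two of
    them.

    Upper bound ([base_space_TC_upper]).  A motion in the wedge retracts the start in the
    projective plane to the wedge point, moves in Y, and expands in the projective plane
    to the end.  In a 3-sphere there is a canonical motion between points that are not
    antipodal, and another one between points that are nearly antipodal, along a tangent
    field; a line is retracted by using a coordinate that does not vanish on it, one of
    three.  Which motions are used is decided by 5 + 2 + 2 real functions, and the domains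
    where the same number of them is small are disjoint ([merged_planners]), so ten open
    sets are enough.

    Lower bound ([cover_space_TC_lower]).  Restrict planners to pairs with one point in
    either copy of Y.  Retracting a motion to the two copies contracts all ten sphere
    coordinates of the pair.  If there were ten planners, the i-th coordinate of the
    product of ten 3-spheres could be contracted over the i-th member of an open cover,
    and cutoff functions would deform the identity of the product to a map that always
    has some coordinate at the pole.  This contradicts the fact that the identity has
    degree one ([unit_rows_no_contractible_cover]).  The degree is computed modulo 2, as
    a count of labelled simplices in a triangulated cube ([kuhn_sperner]).

    The rest verifies that the spaces qualify.  The double cover E is a union of finitely many
    open pieces that contract in E to a point ([cover_space_TC_finite]), so both values of
    TC exist; [E -> B] is the quotient by a free involution of a compact
    space ([free_involution_covering]); both spaces are retracts of neighbourhoods, the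
    retraction to the projective plane being the nearest projector of rank one
    ([wedge_ENR], [proj_plane_retraction]); B is a subcomplex of a product of cell
    complexes ([base_set_cells]); and E is simply connected because a loop in a sphere
    can be pushed off a point and then contracted, without moving its passages through
    the pole ([sphere_loop_contraction], [cover_space_loops]). *)

Set Implicit Arguments.
Unset Strict Implicit.
Unset Printing Implicit Defensive.

Import Order.TTheory GRing.Theory Num.Theory.
Import numFieldNormedType.Exports.

Local Open Scope classical_set_scope.
Local Open Scope ring_scope.

(** * Continuity at a point *)

(** A named predicate rather than the limit it unfolds to, so that the closure
    rules below can be selected by the shape of the function alone. *)
Definition contat (T U : topologicalType) (f : T -> U) (x : T) :=
  f y @[y --> x] --> f x.

Lemma contP (T U : topologicalType) (f : T -> U) :
  (forall x, contat f x) -> continuous f.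
Proof. by []. Qed.

Lemma contE (T U : topologicalType) (f : T -> U) (x : T) :
  continuous f -> contat f x.
Proof. by move=> cf; apply: cf. Qed.

Lemma contat_id (T : topologicalType) (x : T) : contat (fun y => y) x.
Proof. exact: cvg_id. Qed.

Lemma contat_cst (T U : topologicalType) (c : U) (x : T) :
  contat (fun=> c) x.
Proof. exact: cvg_cst. Qed.

Lemma contat_comp (T U V : topologicalType) (g : U -> V) (f : T -> U) (x : T) :
  contat g (f x) -> contat f x -> contat (fun y => g (f y)) x.
Proof. by move=> cg cf; apply: cvg_comp cf cg. Qed.

Lemma contat_near (T U : topologicalType) (g f : T -> U) (x : T) :
  (\forall y \near x, f y = g y) -> contat g x -> contat f x.
Proof.
move=> fg cg; rewrite /contat; have -> : f x = g x := nbhs_singleton fg.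
apply: cvg_trans cg; apply: near_eq_cvg.
by apply: filterS fg => y ->.
Qed.

Lemma contat_pair (T U V : topologicalType) (f : T -> U) (g : T -> V) (x : T) :
  contat f x -> contat g x -> contat (fun y => (f y, g y)) x.
Proof. by move=> cf cg; apply: cvg_pair. Qed.

Lemma contat_fst (T U V : topologicalType) (f : T -> U * V) (x : T) :
  contat f x -> contat (fun y => (f y).1) x.
Proof. by move=> cf; apply: cvg_comp cf _; apply: cvg_fst. Qed.

Lemma contat_snd (T U V : topologicalType) (f : T -> U * V) (x : T) :
  contat f x -> contat (fun y => (f y).2) x.
Proof. by move=> cf; apply: cvg_comp cf _; apply: cvg_snd. Qed.

Lemma contat_val (T V : topologicalType) (A : set V) (f : T -> A) (x : T) :
  contat f x -> contat (fun y => set_val (f y)) x.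
Proof. by move=> cf; apply: cvg_comp cf _; apply: initial_continuous. Qed.

Lemma contat_sub (T V : topologicalType) (A : set V) (f : T -> A) (x : T) :
  contat (fun y => set_val (f y)) x -> contat f x.
Proof.
move=> cf U [_ [[P oP <-] /= Px PU]].
have : nbhs x ((fun y => set_val (f y)) @^-1` P).
  by apply: cf; apply: open_nbhs_nbhs.
by rewrite nbhs_simpl /=; apply: filterS => y /= Py; apply: PU.
Qed.

(** Continuity of a map given only on an open subspace passes to any extension of
    it, at the points of that subspace. *)
Lemma contat_extend (T Z : topologicalType) (U : set T) (g : U -> Z)
    (f : T -> Z) (x : U) :
  open U -> (forall u : U, f (set_val u) = g u) -> contat g x ->
  contat f (set_val x).
Proof.
move=> oU fg cg O; rewrite fg => /cg /= [_ [[P oP <-] /= Px PU]].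
have : nbhs (set_val x) (P `&` U).
  apply: open_nbhs_nbhs; split; first exact: openI.
  by split => //; apply: set_valP.
rewrite nbhs_simpl /=; apply: filterS => y [Py Uy].
have := PU (exist _ y (mem_set Uy)) Py.
by rewrite /= -(fg (exist _ y (mem_set Uy))).
Qed.

Section RealContinuity.
Variables (R : realType) (T : topologicalType).
Implicit Types (f g : T -> R) (x : T).

Lemma contatD f g x : contat f x -> contat g x -> contat (fun y => f y + g y) x.
Proof. exact: cvgD. Qed.

Lemma contatN f x : contat f x -> contat (fun y => - f y) x.
Proof. exact: cvgN. Qed.

Lemma contatM f g x : contat f x -> contat g x -> contat (fun y => f y * g y) x.
Proof. exact: cvgM. Qed.

Lemma contatV f x : f x != 0 -> contat f x -> contat (fun y => (f y)^-1) x.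
Proof. exact: cvgV. Qed.

Lemma contatX f x n : contat f x -> contat (fun y => f y ^+ n) x.
Proof.
move=> cf; elim: n => [|n IH]; first exact: contat_cst.
under [fun y => _]eq_fun do rewrite exprS.
exact: contatM.
Qed.

Lemma contat_sqrt f x : contat f x -> contat (fun y => Num.sqrt (f y)) x.
Proof. by move=> cf; apply: (contat_comp (g := Num.sqrt)) => //; apply: sqrt_continuous. Qed.

Lemma contat_norm f x : contat f x -> contat (fun y => `|f y|) x.
Proof. exact: cvg_norm. Qed.

Lemma contat_max f g x :
  contat f x -> contat g x -> contat (fun y => Num.max (f y) (g y)) x.
Proof.
move=> cf cg; have e y : Num.max (f y) (g y) = (f y + g y + `|f y - g y|) / 2.
  by rewrite maxr_absE.
under [fun y => _]eq_fun do rewrite e.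
apply: contatM; last exact: contat_cst.
by apply: contatD; [apply: contatD|apply/contat_norm/contatD => //; apply: contatN].
Qed.

Lemma contat_min f g x :
  contat f x -> contat g x -> contat (fun y => Num.min (f y) (g y)) x.
Proof.
move=> cf cg; have e y : Num.min (f y) (g y) = (f y + g y - `|f y - g y|) / 2.
  by rewrite minr_absE.
under [fun y => _]eq_fun do rewrite e.
apply: contatM; last exact: contat_cst.
by apply: contatD; [apply: contatD|apply/contatN/contat_norm/contatD => //; apply: contatN].
Qed.

Lemma contat_sum (I : Type) (r : seq I) (P : pred I) (F : I -> T -> R) x :
  (forall i, P i -> contat (F i) x) ->
  contat (fun y => \sum_(i <- r | P i) F i y) x.
Proof.
move=> cF; elim: r => [|i r IH].
  by under [fun y => _]eq_fun do rewrite big_nil; exact: contat_cst.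
under [fun y => _]eq_fun do rewrite big_cons.
by case: ifP => // Pi; apply: contatD => //; apply: cF.
Qed.

Lemma contat_prod (I : Type) (r : seq I) (P : pred I) (F : I -> T -> R) x :
  (forall i, P i -> contat (F i) x) ->
  contat (fun y => \prod_(i <- r | P i) F i y) x.
Proof.
move=> cF; elim: r => [|i r IH].
  by under [fun y => _]eq_fun do rewrite big_nil; exact: contat_cst.
under [fun y => _]eq_fun do rewrite big_cons.
by case: ifP => // Pi; apply: contatM => //; apply: cF.
Qed.

Lemma contat_coord m n (f : T -> 'M[R]_(m, n)) i j x :
  contat f x -> contat (fun y => f y i j) x.
Proof.
move=> cf; apply: (contat_comp (g := fun M : 'M[R]_(m, n) => M i j)) => //.
exact: coord_continuous.
Qed.

Lemma contat_mx m n (f : T -> 'M[R]_(m, n)) x :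
  (forall i j, contat (fun y => f y i j) x) -> contat f x.
Proof.
move=> cf U [P Pf PU].
have : \forall y \near x, forall i j, P i j (f y i j).
  by apply: filter_forall => i; apply: filter_forall => j; apply: cf; apply: Pf.
by rewrite nbhs_simpl /=; apply: filterS => y Py; apply: PU.
Qed.

Lemma open_lt f g : continuous f -> continuous g -> open [set x | f x < g x].
Proof.
move=> cf cg.
have -> : [set x | f x < g x] = (fun x => g x - f x) @^-1` [set y | 0 < y].
  by apply/seteqP; split => x /=; rewrite subr_gt0.
apply: open_comp; last exact: open_gt.
by move=> x _; apply: (@cvgB _ R^o) ; [apply: cg|apply: cf].
Qed.

Lemma near_lt f g x : contat f x -> contat g x -> f x < g x ->
  \forall y \near x, f y < g y.
Proof.
move=> cf cg; rewrite -subr_gt0 => fg.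
have : contat (fun y => g y - f y) x by apply: contatD => //; apply: contatN.
move=> /(_ [set z | 0 < z]) /=; rewrite nbhs_simpl /=.
have H : nbhs (g x - f x) [set z : R | 0 < z].
  by apply: open_nbhs_nbhs; split => //; apply: open_gt.
by move=> /(_ H); apply: filterS => y /=; rewrite subr_gt0.
Qed.

End RealContinuity.

Ltac cont_step :=
  first [ exact: contat_id | exact: contat_cst | assumption
        | apply: contatD | apply: contatN | apply: contatM | apply: contatX
        | apply: contat_max | apply: contat_min | apply: contat_sqrt
        | apply: contat_coord | apply: contat_pair
        | apply: contat_fst | apply: contat_snd | apply: contat_val
        | (apply: contat_sum => ? _) | (apply: contat_prod => ? _) ].

Ltac cont := repeat cont_step.

(** * Subspaces, paths and motion planners as homotopies *)

Lemma set_type_compact (T : topologicalType) (A : set T) :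
  compact A -> compact [set: A].
Proof.
move=> cA F PF _.
pose G := (set_val : A -> T) @ F.
have GA : G A by rewrite /G /=; apply: (@filterS _ F _ setT) => [y _|]; [apply: set_valP|apply: filterT].
have [p [Ap clp]] := cA G _ GA.
exists (exist _ p (mem_set Ap)); split => // B C FB [_ [[P oP <-] /= Pp PC]].
have [] := clp (set_val @` B) P.
- by rewrite /G /=; apply: filterS FB => y By; exists y.
- by apply: open_nbhs_nbhs.
- by move=> _ [[y By <-] Py]; exists y; split => //; apply: PC.
Qed.

Lemma set_type_hausdorff (T : topologicalType) (A : set T) :
  hausdorff_space T -> hausdorff_space A.
Proof.
move=> hT x y clxy; apply: val_inj; rewrite -!set_valE; apply: hT => B C Bx Cy.
have [] := clxy (set_val @^-1` B) (set_val @^-1` C).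
- by apply: (@initial_continuous A T set_val).
- by apply: (@initial_continuous A T set_val).
- by move=> z [/= Bz Cz]; exists (set_val z).
Qed.

Section Paths.
Variable R : realType.
Local Notation I := (unit_interval R).

(** Retracts the line onto the unit interval; homotopies below are functions of a
    real time and are read through [clamp]. *)
Definition clamp (t : R) : R := Num.max 0 (Num.min 1 t).

Lemma clamp_itv t : 0 <= clamp t <= 1.
Proof. by rewrite /clamp le_max lexx /= ge_max ler01 ge_min lexx. Qed.

Lemma clamp_id t : 0 <= t <= 1 -> clamp t = t.
Proof. by move=> /andP[t0 t1]; rewrite /clamp min_r // max_r. Qed.

Lemma clamp0 : clamp 0 = 0. Proof. by rewrite clamp_id // lexx ler01. Qed.
Lemma clamp1 : clamp 1 = 1. Proof. by rewrite clamp_id // lexx ler01. Qed.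

Lemma clamp_ge1 t : 1 <= t -> clamp t = 1.
Proof. by move=> t1; rewrite /clamp min_l // max_r // ler01. Qed.

Lemma clamp_le0 t : t <= 0 -> clamp t = 0.
Proof. by move=> t0; rewrite /clamp max_l // ge_min t0 orbT. Qed.

Lemma contat_clamp (T : topologicalType) (f : T -> R) x :
  contat f x -> contat (fun y => clamp (f y)) x.
Proof. by move=> cf; rewrite /clamp; cont. Qed.

Lemma clampI_subproof t : clamp t \in `[0%R, 1%R]%classic.
Proof. by rewrite inE /= in_itv /= clamp_itv. Qed.

Definition clampI (t : R) : I := exist _ (clamp t) (clampI_subproof t).

Lemma contat_clampI (T : topologicalType) (f : T -> R) x :
  contat f x -> contat (fun y => clampI (f y)) x.
Proof. by move=> cf; apply: contat_sub; apply: contat_clamp. Qed.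

Lemma clampI_val (t : I) : clampI (set_val t) = t.
Proof.
apply: val_inj; rewrite /= clamp_id //.
by have := set_valP t; rewrite /= in_itv.
Qed.

Lemma clampI0 : clampI 0 = ui0 R. Proof. by apply: val_inj; apply: clamp0. Qed.
Lemma clampI1 : clampI 1 = ui1 R. Proof. by apply: val_inj; apply: clamp1. Qed.

Lemma unit_interval_compact : compact [set: I].
Proof. by apply: set_type_compact; apply: segment_compact. Qed.

Lemma unit_interval_hausdorff : hausdorff_space I.
Proof. by apply: set_type_hausdorff; apply: Rhausdorff. Qed.

Lemma path_space_eval (X : topologicalType) (f : path_space R X) :
  continuous (path_space_fun f).
Proof. by apply: (@cts_fun _ _ (f : continuousType I X)). Qed.

Definition mk_path (X : topologicalType) (f : I -> X) (cf : continuous f) :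
  path_space R X := (mkcts cf : continuousType I X).

(** By the exponential law for the compact-open topology a homotopy, jointly continuous in
    the pair and the time, is a continuous family of paths. *)
Lemma planner_of_homotopy (X : topologicalType) (U : set (X * X))
    (H : X * X -> R -> X) :
  (forall z t, U z -> contat (uncurry H) (z, t)) ->
  (forall z, U z -> H z 0 = z.1 /\ H z 1 = z.2) -> has_motion_planner R U.
Proof.
move=> cH HE.
pose h (p : U * I) : X := H (set_val p.1) (set_val p.2).
have ch : continuous h.
  move=> p; apply: (contat_comp (g := uncurry H) (f := fun q : U * I => (set_val q.1, set_val q.2))).
    by apply: cH; apply: set_valP.
  by cont.
have [c1 c2] := continuous_curry ch.
exists (fun u => mk_path (c2 u)); split.
  move=> u W [_ [[P oP <-] /= Pu PW]].
  have /c1 : nbhs (curry h u : {compact-open, I -> X}) P by apply: open_nbhs_nbhs.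
  by rewrite !nbhs_simpl /=; apply: filterS => v Pv; apply: PW.
move=> z; rewrite /path_ends /path_space_fun /mk_path /mkcts /= /curry /h /=.
have [H0 H1] := HE (set_val z) (set_valP z).
rewrite [LHS](_ : _ = (H (set_val z) 0, H (set_val z) 1)) //.
by rewrite H0 H1; case: (set_val z).
Qed.

(** The converse exponential law: evaluation of paths is jointly continuous because
    the unit interval is compact Hausdorff.  The values off [U] are junk, and [U]
    being open keeps them from disturbing continuity on [U]. *)
Lemma homotopy_of_planner (X : topologicalType) (U : set (X * X)) :
  open U -> has_motion_planner R U ->
  exists H : X * X -> R -> X,
    (forall z t, U z -> contat (uncurry H) (z, t)) /\
    (forall z, U z -> H z 0 = z.1 /\ H z 1 = z.2).
Proof.
move=> oU [s [cs sE]].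
pose H (z : X * X) (t : R) : X := match pselect (U z) with
  | left Uz => path_space_fun (s (exist _ z (mem_set Uz))) (clampI t)
  | right _ => z.1 end.
have HE z (Uz : U z) t : H z t = path_space_fun (s (exist _ z (mem_set Uz))) (clampI t).
  rewrite /H; case: pselect => // Uz'; congr (path_space_fun (s _) _).
  exact: val_inj.
exists H; split; last first.
  move=> z Uz; rewrite !(HE _ Uz) clampI0 clampI1.
  by have := sE (exist _ z (mem_set Uz)); rewrite /path_ends; case: z Uz => a b Uz /= [-> ->].
pose g (u : U) : {compact-open, I -> X} := path_space_fun (s u).
have cg : continuous g.
  move=> u; apply: (contat_comp (g := @path_space_fun R X) (f := s)); last exact: cs.
  exact: initial_continuous.
have cgu : continuous (uncurry (g : U -> I -> X)).
  apply: continuous_uncurry => //.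
  - move=> x _; rewrite withinET; exists setT; first exact: filterT.
    by split; [exact: unit_interval_compact|exact: closedT].
  - exact: unit_interval_hausdorff.
  - by move=> u; apply: path_space_eval.
move=> z t Uz.
pose U' : set (X * X * R) := [set p | U p.1].
have oU' : open U' by apply: open_comp => // p _; apply: cvg_fst.
pose toU (p : U') : U := exist _ (set_val p).1 (mem_set (set_valP p : U (set_val p).1)).
pose G (p : U') : X := uncurry (g : U -> I -> X) (toU p, clampI (set_val p).2).
have HU' : U' (z, t) by [].
apply: (@contat_extend _ _ U' G (uncurry H) (exist _ (z, t) (mem_set HU'))) => //.
  move=> p; rewrite /G /= /uncurry.
  have := set_valP p; rewrite /U' /=; case: p => -[y r] yr /= Uy.
  by rewrite (HE y Uy); congr (path_space_fun (s _) _); apply: val_inj.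
apply: (contat_comp (g := uncurry (g : U -> I -> X))); first exact: cgu.
apply: contat_pair; last by apply: contat_clampI; cont.
by apply: contat_sub; rewrite /toU /=; cont.
Qed.

End Paths.

(** * Sperner's lemma modulo 2 on the Kuhn triangulation of a cube *)

Section KuhnSperner.
Variable d' : nat.
Local Notation d := d'.+1.
Implicit Types (w : {ffun 'I_d -> nat}) (s : 'S_d).

(** The simplex attached to a grid point and a permutation: the walk from [w] to the
    opposite corner of its unit cube, one coordinate at a time in the order given by
    [s]. *)
Definition kuhn_vertex w s (k : nat) : {ffun 'I_d -> nat} :=
  [ffun i => w i + (s i < k)]%N.

Definition bump_coord w (i : 'I_d) : {ffun 'I_d -> nat} :=
  [ffun j => w j + (j == i)]%N.

Definition last_coord s : 'I_d := (s^-1)%g ord_max.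

Variable lab : {ffun 'I_d -> nat} -> 'I_d.+1.

(** Counts facets carrying all labels except the last one.  If the labels of [p]
    are pairwise distinct and avoid the last one this is the determinant of a
    permutation matrix, which is 1 modulo 2, and it vanishes otherwise. *)
Definition facet_det (p : 'I_d -> {ffun 'I_d -> nat}) : 'F_2 :=
  \det (\matrix_(j < d, l < d) (nat_of_ord (lab (p j)) == l)%:R).

Definition chain_det w s : 'F_2 := facet_det (fun j => kuhn_vertex w s j).

Lemma eq_facet_det p q : p =1 q -> facet_det p = facet_det q.
Proof. by move=> pq; congr (\det _); apply/matrixP => j l; rewrite !mxE pq. Qed.

Lemma facet_det_dup (p : 'I_d -> {ffun 'I_d -> nat}) (j1 j2 : 'I_d) :
  j1 != j2 -> lab (p j1) = lab (p j2) -> facet_det p = 0.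
Proof.
move=> j12 e; apply: (determinant_alternate j12) => l.
by rewrite !mxE e.
Qed.

Lemma facet_det_out (p : 'I_d -> {ffun 'I_d -> nat}) (j : 'I_d) :
  lab (p j) = ord_max -> facet_det p = 0.
Proof.
move=> e; rewrite /facet_det (expand_det_row _ j) big1 // => l _.
by rewrite mxE e /= gtn_eqF // mul0r.
Qed.

(** Border the matrix of labels by a column of ones.  Two equal rows kill its
    determinant, and its expansion along that column is the sum over the facets. *)
Lemma facet_sum w s :
  ~ injective (fun k : 'I_d.+1 => lab (kuhn_vertex w s k)) ->
  \sum_(k < d.+1) facet_det (fun j => kuhn_vertex w s (lift k j)) = 0.
Proof.
move=> ninj.
pose B : 'M['F_2]_d.+1 := \matrix_(k, l) if unlift ord0 l is Some l' then
   (nat_of_ord (lab (kuhn_vertex w s k)) == l')%:R else 1.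
have [k1 [k2 [k12 e12]]] : exists k1 k2 : 'I_d.+1, k1 != k2 /\
    lab (kuhn_vertex w s k1) = lab (kuhn_vertex w s k2).
  apply: contrapT => H; apply: ninj => k1 k2 e.
  by apply/eqP; apply: contrapT => /negP ne; apply: H; exists k1, k2.
have : \det B = 0.
  by apply: (determinant_alternate k12) => l; rewrite !mxE e12.
move=> det0; rewrite -[RHS]det0 (expand_det_col _ ord0); apply: eq_bigr => k _.
rewrite mxE unlift_none mul1r /cofactor.
have -> : (-1 : 'F_2) = 1 by apply/val_inj.
rewrite expr1n mul1r; congr (\det _); apply/matrixP => j l.
by rewrite !mxE liftK.
Qed.

(** Exchanging two consecutive steps of the walk changes only the vertex between
    them, so these facets cancel in pairs. *)
Lemma interior_facets w (k : 'I_d.+1) : (0 < k)%N -> (k < d)%N ->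
  \sum_s facet_det (fun j => kuhn_vertex w s (lift k j)) = 0.
Proof.
move=> k0 kd; pose F s := facet_det (fun j => kuhn_vertex w s (lift k j)).
have k1d : (k.-1 < d)%N by apply: leq_ltn_trans (leq_pred _) kd.
pose a : 'I_d := Ordinal k1d; pose b : 'I_d := Ordinal kd.
have ab : a != b by rewrite -val_eqE /= neq_ltn prednK // leqnn.
pose t := tperm a b.
have Ft s : F (s * t)%g = F s.
  apply: eq_facet_det => j; apply/ffunP => i; rewrite !ffunE permM; congr (_ + nat_of_bool _)%N.
  have kj : lift k j != k :> nat by rewrite eq_sym neq_bump.
  rewrite /t; case: tpermP => [->|->|//] /=; move: kj; rewrite /= /bump; lia.
rewrite -[LHS]/(\sum_s F s) (bigID (fun s : 'S_d => odd_perm s)) /=.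
rewrite [X in X + _](reindex_inj (mulIg t)) /=.
rewrite [X in X + _](eq_bigl (fun s : 'S_d => ~~ odd_perm s)); last first.
  by move=> s; rewrite odd_permM odd_tperm ab addbT.
under [X in X + _]eq_bigr do rewrite Ft.
by rewrite -mulr2n -mulr_natl (_ : 2%:R = 0 :> 'F_2) ?mul0r //; apply/val_inj.
Qed.

(** Rotates the order of the steps, so that the first one becomes the last. *)
Definition pred_perm : 'S_d := perm (can_inj (@ord_predK d)).

Lemma pred_perm0 : pred_perm ord0 = ord_max.
Proof. by rewrite permE; apply/val_inj; rewrite /= modn_small. Qed.

Lemma pred_permS (i : 'I_d) : i != ord0 -> pred_perm i = i.-1 :> nat.
Proof.
move=> i0; rewrite permE /=.
have i0' : (0 < i)%N by rewrite lt0n; apply: contra i0 => /eqP e; apply/eqP/val_inj.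
have -> : ((i + d).-1 = i.-1 + d)%N by lia.
rewrite modnDr modn_small //.
exact: leq_ltn_trans (leq_pred _) (ltn_ord i).
Qed.

(** Dropping the first vertex of a walk leaves the walk of a neighbouring cube
    without its last vertex. *)
Lemma first_facet w :
  \sum_s facet_det (fun j => kuhn_vertex w s (lift ord0 j)) =
  \sum_s chain_det (bump_coord w (last_coord s)) s.
Proof.
rewrite [RHS](reindex_inj (mulIg pred_perm)) /=; apply: eq_bigr => s _.
apply: eq_facet_det => j; apply/ffunP => i.
have lE : last_coord (s * pred_perm)%g = (s^-1)%g ord0.
  apply: (@perm_inj _ (s * pred_perm)%g).
  by rewrite /last_coord permKV permM permKV pred_perm0.
rewrite !ffunE lE permM /= /bump /= add1n.
case: (eqVneq (s i) ord0) => [e|ne].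
  have -> : i = (s^-1)%g ord0 by rewrite -e permK.
  rewrite permKV eqxx pred_perm0 /= ltnNge.
  by have -> : (j <= d')%N by [rewrite -ltnS]; rewrite addn0.
rewrite pred_permS //.
have -> : (i == (s^-1)%g ord0) = false.
  by apply/eqP => e; move: ne; rewrite e permKV eqxx.
have : (0 < s i)%N by rewrite lt0n; apply: contra ne => /eqP e; apply/eqP/val_inj.
by rewrite addn0; case: (s i) => m /= _; lia.
Qed.

Lemma last_facet w s :
  facet_det (fun j => kuhn_vertex w s (lift ord_max j)) = chain_det w s.
Proof. by apply: eq_facet_det => j; rewrite lift_max. Qed.

Lemma facets_cancel w :
  (forall s, ~ injective (fun k : 'I_d.+1 => lab (kuhn_vertex w s k))) ->
  \sum_s (chain_det (bump_coord w (last_coord s)) s + chain_det w s) = 0.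
Proof.
move=> ninj.
have : \sum_s \sum_(k < d.+1) facet_det (fun j => kuhn_vertex w s (lift k j)) = 0.
  by apply: big1 => s _; apply: facet_sum.
move=> H; rewrite -{}[RHS]H [RHS]exchange_big big_ord_recl first_facet.
rewrite big_split big_ord_recr; congr (_ + _).
rewrite [X in _ = X + _]big1 => [|k _].
  rewrite add0r; apply: eq_bigr => s _; rewrite -last_facet.
  by apply: eq_facet_det => j; congr (kuhn_vertex _ _ _).
by apply: (@interior_facets w (lift ord0 (widen_ord (leqnSn d') k)));
  rewrite lift0 //= ltnS.
Qed.

Section Grid.
Variable N' : nat.
Local Notation N := N'.+1.
Implicit Type v : {ffun 'I_d -> 'I_N}.

Definition corner v : {ffun 'I_d -> nat} := [ffun i => nat_of_ord (v i)].

Definition set_coord w (i : 'I_d) (k : nat) : {ffun 'I_d -> nat} :=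
  [ffun j => if j == i then k else w j].

(** Modulo 2, the two ends of each line of the grid are all that remains. *)
Lemma telescope_grid (G : {ffun 'I_d -> nat} -> 'F_2) (i : 'I_d) :
  \sum_v (G (bump_coord (corner v) i) + G (corner v)) =
  \sum_(v : {ffun 'I_d -> 'I_N} | v i == ord_max)
    (G (set_coord (corner v) i N) + G (set_coord (corner v) i 0)).
Proof.
pose sh v : {ffun 'I_d -> 'I_N} := [ffun j => if j == i then ordS (v j) else v j].
have sh_inj : injective sh.
  move=> u v /ffunP e; apply/ffunP => j; have := e j; rewrite !ffunE.
  by case: eqP => // _; apply: (can_inj (@ordSK N)).
rewrite big_split /= [X in _ + X](reindex_inj sh_inj) -big_split /=.
rewrite (bigID (fun v : {ffun 'I_d -> 'I_N} => v i == ord_max)) /= [X in _ + X]big1 ?addr0.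
  apply: eq_bigr => v /eqP vi; congr (G _ + G _); apply/ffunP => j; rewrite !ffunE.
    by case: eqP => [->|]; rewrite ?vi ?addn1 ?addn0.
  by case: eqP => [->|] //; rewrite vi /= modnn.
move=> v vi; have -> : bump_coord (corner v) i = corner (sh v).
  apply/ffunP => j; rewrite !ffunE; case: eqP => [->|]; rewrite ?addn0 //= addn1.
  rewrite modn_small //; have := ltn_ord (v i); rewrite ltnS leq_eqVlt ltnS.
  by case/orP => // /eqP e; case/eqP: vi; apply/val_inj.
by rewrite -mulr2n -mulr_natl (_ : 2%:R = 0 :> 'F_2) ?mul0r //; apply/val_inj.
Qed.

(** Interior facets are counted twice and facets on the other faces of the cube do not
    count, hence the facets on the bottom cancel. *)
Theorem kuhn_sperner (t0 : 'I_d) :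
  (forall v s, ~ injective (fun k : 'I_d.+1 => lab (kuhn_vertex (corner v) s k))) ->
  (forall w s, (forall i, w i <= N)%N -> let i := last_coord s in
     (w i == 0%N) || (w i == N) -> ~~ ((i == t0) && (w i == 0%N)) -> chain_det w s = 0) ->
  \sum_(s | last_coord s == t0) \sum_(v : {ffun 'I_d -> 'I_N} | v t0 == ord_max)
    chain_det (set_coord (corner v) t0 0) s = 0.
Proof.
move=> nfull bdry.
have : \sum_v \sum_s (chain_det (bump_coord (corner v) (last_coord s)) s
    + chain_det (corner v) s) = 0.
  by apply: big1 => v _; apply: facets_cancel.
move=> H; rewrite -{}[RHS]H [RHS]exchange_big /=.
rewrite [RHS](bigID (fun s => last_coord s == t0)) /= [X in _ + X]big1 ?addr0.
  apply: eq_bigr => s /eqP e.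
  rewrite (telescope_grid (fun w => chain_det w s)) e; apply: eq_bigr => v _.
  rewrite [X in X + _]bdry ?add0r //= ?e ?ffunE ?eqxx ?orbT //.
  by move=> i; rewrite !ffunE; case: eqP => // _; apply: ltnW.
move=> s sne; rewrite (telescope_grid (fun w => chain_det w s)) big1 // => v _.
by rewrite !bdry ?addr0 //= ?ffunE ?eqxx ?orbT ?(negbTE sne) // => i;
  rewrite !ffunE; case: eqP => // _; apply: ltnW.
Qed.

Lemma increasing_id (f : nat -> nat) :
  (forall j k, j < k < d -> f j < f k)%N -> (forall j, j < d -> f j < d)%N ->
  forall j, (j < d)%N -> f j = j.
Proof.
move=> finc fd.
have lo j : (j < d)%N -> (j <= f j)%N.
  elim: j => // j IH jd; apply: leq_ltn_trans (IH (ltnW jd)) _.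
  by apply: finc; rewrite leqnn.
have hi j : (j < d)%N -> (f (d' - j) <= d' - j)%N.
  elim: j => [_|j IH jd].
    by rewrite subn0 -ltnS; apply: fd.
  have := IH (ltnW jd); have := finc (d' - j.+1)%N (d' - j)%N; lia.
move=> j jd; apply/eqP; rewrite eqn_leq lo // andbT.
by have := hi (d' - j)%N; rewrite subKn // => -> //; lia.
Qed.

(** On the bottom the label of a point is the first coordinate smaller than [h], up
    to points labelled last.  Labels then increase along a walk that meets all of
    them, which forces the walk to be the one around height [h] with the steps in
    their natural order. *)
Lemma bottom_count (h : nat) : (0 < h <= N)%N ->
  (forall w, w ord_max = 0%N -> lab w != ord_max ->
    ((lab w < d')%N -> forall i : 'I_d, nat_of_ord i = lab w -> w i < h)%N /\
    (forall i : 'I_d, (i < lab w)%N -> (i < d')%N -> h <= w i)%N) ->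
  (forall w, w ord_max = 0%N ->
     (forall i : 'I_d, (i < d')%N -> (h.-1 <= w i <= h)%N) -> lab w != ord_max) ->
  \sum_(s | last_coord s == ord_max) \sum_(v : {ffun 'I_d -> 'I_N} | v ord_max == ord_max)
    chain_det (set_coord (corner v) ord_max 0) s = 1.
Proof.
move=> /andP[h0 hN] Hin Hnear.
have h1N : (h.-1 < N)%N by rewrite prednK.
pose v0 : {ffun 'I_d -> 'I_N} :=
  [ffun i => if i == ord_max then ord_max else Ordinal h1N].
have one1 : last_coord 1%g = ord_max by rewrite /last_coord invg1 perm1.
have kv_max v s (j : nat) : last_coord s = ord_max -> (j < d)%N ->
    kuhn_vertex (set_coord (corner v) ord_max 0) s j ord_max = 0%N.
  move=> e jd; rewrite !ffunE eqxx -{1}e /last_coord permKV /= add0n.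
  by rewrite ltnNge -ltnS jd.
have unique v s : last_coord s = ord_max -> v ord_max = ord_max ->
    chain_det (set_coord (corner v) ord_max 0) s != 0 -> s = 1%g /\ v = v0.
  move=> ls vm cd.
  set w := set_coord _ _ _ in cd.
  pose l j := nat_of_ord (lab (kuhn_vertex w s j)).
  have lnm j : (j < d)%N -> lab (kuhn_vertex w s j) != ord_max.
    move=> jd; apply/eqP => e; case/eqP: cd.
    by apply: (@facet_det_out _ (Ordinal jd)).
  have linj (j k : 'I_d) : j != k -> l j != l k.
    move=> jk; apply/eqP => /val_inj e; case/eqP: cd.
    exact: (facet_det_dup jk).
  have ld j : (j < d)%N -> (l j < d)%N.
    move=> /lnm; rewrite -val_eqE /= -/(l j) => lj.
    by have := ltn_ord (lab (kuhn_vertex w s j)); rewrite -/(l j) ltnS leq_eqVlt (negbTE lj).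
  have lmono j k : (j < k < d)%N -> (l j < l k)%N.
    move=> /andP[jk kd]; have jd := ltn_trans jk kd.
    have : l j != l k.
      by apply: (linj (Ordinal jd) (Ordinal kd)); rewrite -val_eqE /= ltn_eqF.
    rewrite ltn_neqAle => -> /=; rewrite leqNgt; apply/negP => lkj.
    have lkd' : (l k < d')%N by have := ld j jd; lia.
    have [Hk _] := Hin _ (kv_max v s k ls kd) (lnm k kd).
    have [_ Hj] := Hin _ (kv_max v s j ls jd) (lnm j jd).
    pose i : 'I_d := Ordinal (ld k kd).
    have := Hk lkd' i erefl; have := Hj i lkj lkd'.
    rewrite !ffunE /= => A B.
    have : ((s i < j) <= (s i < k))%N.
      by case: (ltnP (s i) j) => //= sij; rewrite (ltn_trans sij jk).
    move: A B; case: ifP => _; lia.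
  have lid := increasing_id lmono ld.
  have key (i : 'I_d) : (i < d')%N -> s i = i /\ v i = h.-1 :> nat.
    move=> id'.
    have i1d : (i.+1 < d)%N by [].
    have inm : (i == ord_max) = false by rewrite -val_eqE /= ltn_eqF.
    have [Hk _] := Hin _ (kv_max v s i ls (ltn_ord i)) (lnm i (ltn_ord i)).
    have [_ Hj] := Hin _ (kv_max v s i.+1 ls i1d) (lnm i.+1 i1d).
    have e1 : nat_of_ord (lab (kuhn_vertex w s i)) = i by apply: lid.
    have e2 : nat_of_ord (lab (kuhn_vertex w s i.+1)) = i.+1 by apply: lid.
    rewrite e1 in Hk; rewrite e2 in Hj.
    have := Hk id' i erefl; have := Hj i (leqnn _) id'.
    rewrite !ffunE inm => A B.
    have si : nat_of_ord (s i) = i by case: (ltnP (s i) i) A B; case: (ltnP (s i) i.+1); lia.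
    split; first exact: val_inj.
    by rewrite si ltnn ltnSn in A B; lia.
  have smax : s ord_max = ord_max by rewrite -{1}ls /last_coord permKV.
  have lt_d' (i : 'I_d) : i != ord_max -> (i < d')%N.
    by rewrite -val_eqE /= => ne; have := ltn_ord i; lia.
  split.
    apply/permP => i; rewrite perm1; case: (eqVneq i ord_max) => [->//|/lt_d' /key[]//].
  apply/ffunP => i; rewrite !ffunE.
  case: (eqVneq i ord_max) => [->//|/lt_d' /key[_ e]]; exact: val_inj.
have base : chain_det (set_coord (corner v0) ord_max 0) 1%g = 1.
  set w := set_coord _ _ _.
  have wE (j : nat) (i : 'I_d) : (i < d')%N -> kuhn_vertex w 1%g j i = (h.-1 + (i < j))%N.
    move=> id'; rewrite !ffunE perm1.
    by have -> : (i == ord_max) = false by rewrite -val_eqE /= ltn_eqF.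
  have labE (j : 'I_d) : nat_of_ord (lab (kuhn_vertex w 1%g j)) = j.
    have wm := kv_max v0 1%g j one1 (ltn_ord j).
    have nm : lab (kuhn_vertex w 1%g j) != ord_max.
      by apply: Hnear => // i id'; rewrite wE //; case: ltnP => _; lia.
    have [H1 H2] := Hin _ wm nm.
    set k := lab _ in nm H1 H2 *.
    have kd : (k < d)%N by move: nm; rewrite -val_eqE /=; have := ltn_ord k; lia.
    apply/eqP; rewrite eqn_leq; apply/andP; split.
      rewrite leqNgt; apply/negP => jk.
      have jd' : (j < d')%N by lia.
      by have := H2 j jk jd'; rewrite wE // ltnn; lia.
    case: (ltnP k d') => kd'; last by have := ltn_ord j; lia.
    have := H1 kd' (Ordinal kd) erefl; rewrite wE //=.
    by rewrite leqNgt; case: (ltnP k j) => //; lia.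
  rewrite /chain_det /facet_det (_ : \matrix_(_, _) _ = 1%:M) ?det1 //.
  by apply/matrixP => j l; rewrite !mxE labE val_eqE.
rewrite (bigD1 1%g) ?one1 //= (bigD1 v0) ?ffunE ?eqxx //= base.
rewrite [X in 1 + X + _]big1 ?[X in _ + X]big1 ?addr0 //.
- move=> s /andP[/eqP ls s1]; rewrite big1 // => v /eqP vm; apply/eqP.
  by apply: contraT => /(unique _ _ ls vm)[e]; rewrite e eqxx in s1.
- move=> v /andP[/eqP vm vv0]; apply/eqP.
  by apply: contraT => /(unique _ _ one1 vm)[_ e]; rewrite e eqxx in vv0.
Qed.

End Grid.
End KuhnSperner.

(** * Euclidean geometry of row vectors *)

Section Euclid.
Variable R : realType.

Definition dot n (u v : 'rV[R]_n) : R := \sum_i u 0 i * v 0 i.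

Lemma dotC n (u v : 'rV[R]_n) : dot u v = dot v u.
Proof. by apply: eq_bigr => i _; rewrite mulrC. Qed.

Lemma dotDl n (u v w : 'rV[R]_n) : dot (u + v) w = dot u w + dot v w.
Proof. by rewrite -big_split; apply: eq_bigr => i _; rewrite mxE mulrDl. Qed.

Lemma dotZl n a (u v : 'rV[R]_n) : dot (a *: u) v = a * dot u v.
Proof. by rewrite mulr_sumr; apply: eq_bigr => i _; rewrite mxE mulrA. Qed.

Lemma dotNl n (u v : 'rV[R]_n) : dot (- u) v = - dot u v.
Proof. by rewrite -scaleN1r dotZl mulN1r. Qed.

Lemma dotDr n (u v w : 'rV[R]_n) : dot u (v + w) = dot u v + dot u w.
Proof. by rewrite dotC dotDl !(dotC u). Qed.

Lemma dotZr n a (u v : 'rV[R]_n) : dot u (a *: v) = a * dot u v.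
Proof. by rewrite dotC dotZl dotC. Qed.

Lemma dotNr n (u v : 'rV[R]_n) : dot u (- v) = - dot u v.
Proof. by rewrite dotC dotNl dotC. Qed.

Lemma dot0l n (u : 'rV[R]_n) : dot 0 u = 0.
Proof. by rewrite -(scale0r 0) dotZl mul0r. Qed.

Lemma dot_ge0 n (u : 'rV[R]_n) : 0 <= dot u u.
Proof. by apply: sumr_ge0 => i _; rewrite -expr2 sqr_ge0. Qed.

Lemma dot_eq0 n (u : 'rV[R]_n) : (dot u u == 0) = (u == 0).
Proof.
apply/eqP/eqP => [u0|->]; last by rewrite dot0l.
apply/rowP => i; rewrite mxE; apply/eqP.
have : u 0 i * u 0 i == 0.
  move/eqP: u0; rewrite /dot psumr_eq0 => [/allP/(_ i)|j _].
    by rewrite mem_index_enum; apply.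
  by rewrite -expr2 sqr_ge0.
by rewrite mulf_eq0 orbb.
Qed.

Lemma dot_gt0 n (u : 'rV[R]_n) : (0 < dot u u) = (u != 0).
Proof. by rewrite lt0r dot_ge0 andbT dot_eq0. Qed.

Lemma coord_le_dot n (u : 'rV[R]_n) i : u 0 i ^+ 2 <= dot u u.
Proof.
rewrite /dot (bigD1 i) //= -expr2 lerDl sumr_ge0 // => j _.
by rewrite -expr2 sqr_ge0.
Qed.

Definition enorm n (u : 'rV[R]_n) : R := Num.sqrt (dot u u).

Lemma enorm_ge0 n (u : 'rV[R]_n) : 0 <= enorm u.
Proof. exact: sqrtr_ge0. Qed.

Lemma enorm_gt0 n (u : 'rV[R]_n) : (0 < enorm u) = (u != 0).
Proof. by rewrite /enorm sqrtr_gt0 dot_gt0. Qed.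

Lemma enorm_eq0 n (u : 'rV[R]_n) : (enorm u == 0) = (u == 0).
Proof. by rewrite -[LHS]negbK -[RHS]negbK -enorm_gt0 lt0r enorm_ge0 andbT. Qed.

Lemma sqr_enorm n (u : 'rV[R]_n) : enorm u ^+ 2 = dot u u.
Proof. by rewrite sqr_sqrtr // dot_ge0. Qed.

Lemma enormZ n a (u : 'rV[R]_n) : enorm (a *: u) = `|a| * enorm u.
Proof. by rewrite /enorm dotZl dotZr mulrA -expr2 sqrtrM ?sqr_ge0 // sqrtr_sqr. Qed.

Definition unitize n (u : 'rV[R]_n) : 'rV[R]_n := (enorm u)^-1 *: u.

Lemma unitize_unit n (u : 'rV[R]_n) : u != 0 -> dot (unitize u) (unitize u) = 1.
Proof.
move=> u0; rewrite /unitize dotZl dotZr -sqr_enorm.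
by field; rewrite enorm_eq0.
Qed.

Lemma unitize_id n (u : 'rV[R]_n) : dot u u = 1 -> unitize u = u.
Proof. by move=> u1; rewrite /unitize /enorm u1 sqrtr1 invr1 scale1r. Qed.

Lemma unitizeZ n a (u : 'rV[R]_n) : 0 < a -> unitize (a *: u) = unitize u.
Proof.
move=> a0; rewrite /unitize enormZ gtr0_norm // scalerA invfM mulrAC mulVf ?gt_eqF //.
by rewrite mul1r.
Qed.

Lemma unit_neq0 n (u : 'rV[R]_n) : dot u u = 1 -> u != 0.
Proof. by move=> u1; rewrite -dot_eq0 u1 oner_eq0. Qed.

Lemma dot_unit_le1 n (u v : 'rV[R]_n) :
  dot u u = 1 -> dot v v = 1 -> -1 <= dot u v <= 1.
Proof.
move=> u1 v1; have := dot_ge0 (u + v); have := dot_ge0 (u - v).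
rewrite !dotDl !dotDr !dotNl !dotNr u1 v1 (dotC v u); lra.
Qed.

Lemma dot_unit_eq1 n (u v : 'rV[R]_n) :
  dot u u = 1 -> dot v v = 1 -> dot u v = 1 -> u = v.
Proof.
move=> u1 v1 uv; apply/eqP; rewrite -subr_eq0 -dot_eq0.
rewrite !dotDl !dotDr !dotNl !dotNr u1 v1 (dotC v u) uv; apply/eqP; ring.
Qed.

Section Cont.
Variables (T : topologicalType) (x : T).

Lemma contat_dot n (f g : T -> 'rV[R]_n) :
  contat f x -> contat g x -> contat (fun y => dot (f y) (g y)) x.
Proof. by move=> cf cg; rewrite /dot; cont. Qed.

Lemma contat_enorm n (f : T -> 'rV[R]_n) :
  contat f x -> contat (fun y => enorm (f y)) x.
Proof. by move=> cf; apply: contat_sqrt; apply: contat_dot. Qed.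

Lemma contat_mxZ m n (a : T -> R) (f : T -> 'M[R]_(m, n)) :
  contat a x -> contat f x -> contat (fun y => a y *: f y) x.
Proof.
move=> ca cf; apply: contat_mx => i j.
by under [fun y => _]eq_fun do rewrite mxE; cont.
Qed.

Lemma contat_mxD m n (f g : T -> 'M[R]_(m, n)) :
  contat f x -> contat g x -> contat (fun y => f y + g y) x.
Proof.
move=> cf cg; apply: contat_mx => i j.
by under [fun y => _]eq_fun do rewrite mxE; cont.
Qed.

Lemma contat_mxN m n (f : T -> 'M[R]_(m, n)) :
  contat f x -> contat (fun y => - f y) x.
Proof.
move=> cf; apply: contat_mx => i j.
by under [fun y => _]eq_fun do rewrite mxE; cont.
Qed.

Lemma contat_mul m n p (f : T -> 'M[R]_(m, n)) (g : T -> 'M[R]_(n, p)) :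
  contat f x -> contat g x -> contat (fun y => f y *m g y) x.
Proof.
move=> cf cg; apply: contat_mx => i j.
by under [fun y => _]eq_fun do rewrite mxE; cont.
Qed.

Lemma contat_matrix m n (F : T -> 'I_m -> 'I_n -> R) :
  (forall i j, contat (fun y => F y i j) x) ->
  contat (fun y => \matrix_(i, j) F y i j) x.
Proof.
move=> cF; apply: contat_mx => i j.
have -> : (fun y => (\matrix_(i, j) F y i j) i j) = (fun y => F y i j).
  by apply/funext => y; rewrite mxE.
exact: cF.
Qed.

Lemma contat_matrix_rows m n (F : T -> 'I_m -> 'rV[R]_n) :
  (forall i, contat (fun y => F y i) x) ->
  contat (fun y => \matrix_i F y i) x.
Proof. by move=> cF; apply: contat_matrix => i j; apply: contat_coord. Qed.

Lemma contat_row m n (f : T -> 'M[R]_(m, n)) i :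
  contat f x -> contat (fun y => row i (f y)) x.
Proof.
move=> cf; apply: contat_mx => k j.
by under [fun y => _]eq_fun do rewrite mxE; cont.
Qed.

Lemma contat_entries m n (f : T -> 'M[R]_(m, n)) (F : 'I_m -> 'I_n -> T -> R) :
  (forall y i j, f y i j = F i j y) ->
  (forall i j, contat (F i j) x) -> contat f x.
Proof.
move=> fF cF; apply: contat_mx => i j.
have -> : (fun y => f y i j) = F i j by apply/funext => y; rewrite fF.
exact: cF.
Qed.

Lemma contat_usubmx m1 m2 n (f : T -> 'M[R]_(m1 + m2, n)) :
  contat f x -> contat (fun y => usubmx (f y)) x.
Proof.
move=> cf; apply: (contat_entries (F := fun i j y => f y (lshift m2 i) j)).
  by move=> y i j; rewrite mxE.
by move=> i j; apply: contat_coord.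
Qed.

Lemma contat_dsubmx m1 m2 n (f : T -> 'M[R]_(m1 + m2, n)) :
  contat f x -> contat (fun y => dsubmx (f y)) x.
Proof.
move=> cf; apply: (contat_entries (F := fun i j y => f y (rshift m1 i) j)).
  by move=> y i j; rewrite mxE.
by move=> i j; apply: contat_coord.
Qed.

Lemma contat_lsubmx m n1 n2 (f : T -> 'M[R]_(m, n1 + n2)) :
  contat f x -> contat (fun y => lsubmx (f y)) x.
Proof.
move=> cf; apply: (contat_entries (F := fun i j y => f y i (lshift n2 j))).
  by move=> y i j; rewrite mxE.
by move=> i j; apply: contat_coord.
Qed.

Lemma contat_rsubmx m n1 n2 (f : T -> 'M[R]_(m, n1 + n2)) :
  contat f x -> contat (fun y => rsubmx (f y)) x.
Proof.
move=> cf; apply: (contat_entries (F := fun i j y => f y i (rshift n1 j))).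
  by move=> y i j; rewrite mxE.
by move=> i j; apply: contat_coord.
Qed.

Lemma contat_row_mx m n1 n2 (f : T -> 'M[R]_(m, n1)) (g : T -> 'M[R]_(m, n2)) :
  contat f x -> contat g x -> contat (fun y => row_mx (f y) (g y)) x.
Proof.
move=> cf cg; apply: (contat_entries (F := fun i j y =>
  match fintype.split j with inl a => f y i a | inr b => g y i b end)).
  by move=> y i j; rewrite mxE.
by move=> i j; case: (fintype.split j) => a; apply: contat_coord.
Qed.

Lemma contat_col_mx m1 m2 n (f : T -> 'M[R]_(m1, n)) (g : T -> 'M[R]_(m2, n)) :
  contat f x -> contat g x -> contat (fun y => col_mx (f y) (g y)) x.
Proof.
move=> cf cg; apply: (contat_entries (F := fun i j y =>
  match fintype.split i with inl a => f y a j | inr b => g y b j end)).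
  by move=> y i j; rewrite mxE.
by move=> i j; case: (fintype.split i) => a; apply: contat_coord.
Qed.

Lemma contat_trmx m n (f : T -> 'M[R]_(m, n)) :
  contat f x -> contat (fun y => (f y)^T) x.
Proof.
move=> cf; apply: (contat_entries (F := fun i j y => f y j i)).
  by move=> y i j; rewrite mxE.
by move=> i j; apply: contat_coord.
Qed.

Lemma contat_vec_mx m n (f : T -> 'rV[R]_(m * n)) :
  contat f x -> contat (fun y => vec_mx (f y)) x.
Proof.
move=> cf; apply: (contat_entries (F := fun i j y => f y 0 (mxvec_index i j))).
  by move=> y i j; rewrite mxE.
by move=> i j; apply: contat_coord.
Qed.

Lemma contat_mxvec m n (f : T -> 'M[R]_(m, n)) :
  contat f x -> contat (fun y => mxvec (f y)) x.
Proof.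
move=> cf; apply: contat_mx => a; rewrite (ord1 a).
case/mxvec_indexP => i j.
have -> : (fun y => mxvec (f y) 0 (mxvec_index i j)) = (fun y => f y i j).
  by apply/funext => y; rewrite mxvecE.
exact: contat_coord.
Qed.

Lemma contat_unitize n (f : T -> 'rV[R]_n) :
  f x != 0 -> contat f x -> contat (fun y => unitize (f y)) x.
Proof.
move=> f0 cf; apply: contat_mxZ => //; apply: contatV.
  by rewrite enorm_eq0.
exact: contat_enorm.
Qed.

End Cont.

(** The product of [n] unit spheres, each given by a row. *)
Definition unit_rows n k : set 'M[R]_(n, k) :=
  [set A | forall i, dot (row i A) (row i A) = 1].

Lemma unit_rows_coord n k (A : 'M[R]_(n, k)) i j : unit_rows A -> A i j ^+ 2 <= 1.
Proof. by move=> /(_ i) <-; have := coord_le_dot (row i A) j; rewrite mxE. Qed.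

Definition pole k : 'rV[R]_k.+1 := delta_mx 0 ord_max.

Lemma pole_unit k : dot (pole k) (pole k) = 1.
Proof.
rewrite /dot (bigD1 ord_max) //= !mxE !eqxx mulr1 big1 ?addr0 // => i ne.
by rewrite !mxE (negbTE ne) mul0r.
Qed.

Lemma dot_pole k (u : 'rV[R]_k.+1) : dot u (pole k) = u 0 ord_max.
Proof.
rewrite /dot (bigD1 ord_max) //= !mxE !eqxx mulr1 big1 ?addr0 // => i ne.
by rewrite !mxE (negbTE ne) mulr0.
Qed.

Definition poles n k : 'M[R]_(n, k.+1) := \matrix_(i, j) (j == ord_max)%:R.

Lemma row_poles n k i : row i (poles n k) = pole k.
Proof. by apply/rowP => j; rewrite !mxE eqxx. Qed.

Lemma poles_unit n k : unit_rows (poles n k).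
Proof. by move=> i; rewrite row_poles pole_unit. Qed.

End Euclid.

(** The rule is chosen by the head symbol of the function: trying the rules in turn
    would let unification unfold the operations of the field. *)
Ltac cont_step ::=
  lazymatch goal with
  | |- contat ?f _ =>
    lazymatch f with
    | (fun y => y) => exact: contat_id
    | (fun y => @GRing.add _ _ _) => first [apply: contatD | apply: contat_mxD]
    | (fun y => @GRing.opp _ _) => first [apply: contatN | apply: contat_mxN]
    | (fun y => @GRing.mul _ _ _) => apply: contatM
    | (fun y => @GRing.exp _ _ _) => apply: contatX
    | (fun y => @GRing.scale _ _ _ _) => apply: contat_mxZ
    | (fun y => mulmx _ _) => apply: contat_mul
    | (fun y => row _ _) => apply: contat_row
    | (fun y => @Order.max _ _ _ _) => apply: contat_max
    | (fun y => @Order.min _ _ _ _) => apply: contat_min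
    | (fun y => Num.sqrt _) => apply: contat_sqrt
    | (fun y => usubmx _) => apply: contat_usubmx
    | (fun y => dsubmx _) => apply: contat_dsubmx
    | (fun y => lsubmx _) => apply: contat_lsubmx
    | (fun y => rsubmx _) => apply: contat_rsubmx
    | (fun y => row_mx _ _) => apply: contat_row_mx
    | (fun y => col_mx _ _) => apply: contat_col_mx
    | (fun y => trmx _) => apply: contat_trmx
    | (fun y => vec_mx _) => apply: contat_vec_mx
    | (fun y => mxvec _) => apply: contat_mxvec
    | (fun y => clamp _) => apply: contat_clamp
    | (fun y => dot _ _) => apply: contat_dot
    | (fun y => enorm _) => apply: contat_enorm
    | (fun y => fun_of_matrix _ _ _) => apply: contat_coord
    | (fun y => pair _ _) => apply: contat_pair
    | (fun y => fst _) => apply: contat_fst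
    | (fun y => snd _) => apply: contat_snd
    | (fun y => set_val _) => apply: contat_val
    | (fun y => \sum_(i <- _ | _) _) => apply: contat_sum => ? _
    | (fun y => \prod_(i <- _ | _) _) => apply: contat_prod => ? _
    | @GRing.opp _ => first [apply: contatN | apply: contat_mxN]
    | _ => first [ assumption | exact: contat_cst | apply: contat_val | apply: contat_coord
                 | apply: contat_fst | apply: contat_snd | apply: contat_row
                 | apply: contat_trmx | apply: contat_usubmx | apply: contat_dsubmx
                 | apply: contat_vec_mx | apply: contat_mxvec
                 | apply: contat_lsubmx | apply: contat_rsubmx ]
    end
  end.

Lemma compact_unif_continuous (R : realType) n (k l : nat) (g : 'rV[R]_n -> 'M[R]_(k, l))
    (K : set 'rV[R]_n) : compact K -> continuous g -> forall e : R, 0 < e ->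
  exists2 d : R, 0 < d & forall z z' : 'rV[R]_n, K z -> (forall i, `|z 0 i - z' 0 i| < d) ->
    forall i j, `|g z i j - g z' i j| < e.
Proof.
move=> cK cg e e0.
have e20 : 0 < e / 2 by rewrite divr_gt0.
pose P (d : R) (z : 'rV[R]_n) := forall z' : 'rV[R]_n,
  (forall i, `|z 0 i - z' 0 i| < d) -> forall i j, `|g z i j - g z' i j| < e.
have /compact_near_coveringP nc := cK.
have [] := nc R (0^'+) P _.
  move=> z Kz; have := cg z (ball (g z) (e / 2)) (nbhsx_ballx _ _ e20).
  rewrite nbhs_simpl /= => /nbhs_ballP[d /= d0 dB].
  exists (ball z (d / 2), [set r | r < d / 2]).
    split; first by apply: nbhsx_ballx; rewrite divr_gt0.
    by apply: nbhs_right_lt; rewrite divr_gt0.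
  move=> [y r] [/= zy rd] z' yz' i j.
  have [_ /(_ i j) By] : ball (g z) (e / 2) (g y).
    by apply: dB; apply: le_ball zy; rewrite ler_pdivrMr // ler_peMr ?ltW // ltr1n.
  have [_ /(_ i j) Bz'] : ball (g z) (e / 2) (g z').
    apply: dB; split => // a b; rewrite ord1 in zy *.
    have [_ /(_ 0 b)] := zy; rewrite /ball /= => zyb.
    have := yz' b; rewrite /ball /= => yzb.
    rewrite (splitr d) (le_lt_trans _ (ltrD zyb (lt_trans yzb rd))) //.
    by rewrite -(subrKA (y 0 b)) ler_normD.
  move: By Bz'; rewrite /ball /= => By Bz'.
  rewrite (splitr e) (le_lt_trans _ (ltrD By Bz')) //.
  rewrite -(subrKA (g z i j)) -[X in _ <= X + _]normrN opprB; exact: ler_normD.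
move=> d /= d0 dP; exists (d / 2); first by rewrite divr_gt0.
move=> z z' Kz zz'; apply: (dP (d / 2) _ _ _ Kz) => //=.
- by rewrite sub0r normrN gtr0_norm ?divr_gt0 // ltr_pdivrMr // ltr_pMr // ltr1n.
- by rewrite divr_gt0.
Qed.

(** * Compactness and cutoff functions *)

Lemma closed_eq (R : realType) (T : topologicalType) (f g : T -> R) :
  continuous f -> continuous g -> closed [set x | f x = g x].
Proof.
move=> cf cg.
have -> : [set x | f x = g x] = (fun x => f x - g x) @^-1` [set 0].
  apply/seteqP; split => x /=; first by move=> ->; rewrite subrr.
  by move/eqP; rewrite subr_eq0 => /eqP.
apply: preimage_closed => [x _|]; last first.
  by apply: compact_closed; [exact: Rhausdorff|exact: compact_set1].
apply: (@contP _ _ (fun y => f y - g y)) => y.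
by apply: contatD; [exact: contE|apply/contatN/contE].
Qed.

Lemma closed_forall (T : topologicalType) (I : Type) (P : I -> set T) :
  (forall i, closed (P i)) -> closed [set x | forall i, P i x].
Proof.
move=> cP; have -> : [set x | forall i, P i x] = \bigcap_i P i.
  by apply/seteqP; split => x /= H i; [move=> _|]; apply: H.
by apply: closed_bigI => i _; apply: cP.
Qed.

Lemma mx_compact (R : realType) m n (A : set 'M[R]_(m, n)) :
  closed A -> (forall M i j, A M -> `|M i j| <= 1) -> compact A.
Proof.
move=> clA bA.
have cv : continuous (@vec_mx R m n).
  by apply: contP => v; apply: contat_vec_mx; cont.
have -> : A = @vec_mx R m n @` (@vec_mx R m n @^-1` A).
  apply/seteqP; split => [M AM|_ [v /= Av <-]] //.
  by exists (mxvec M); rewrite /= mxvecK.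
apply: continuous_compact; first by apply: continuous_subspaceT.
apply: bounded_closed_compact; last by apply: preimage_closed => // x _; apply: cv.
exists 1; split; first exact: num_real.
move=> r r1 v /= Av; rewrite [leLHS](_ : _ = mx_norm v) // mx_normrE.
apply/bigmax_leP; split; first by apply: ltW; apply: lt_trans r1.
move=> [a b] _ /=; rewrite (ord1 a); apply: le_trans (ltW r1).
case/mxvec_indexP: b => i j.
by have := bA (vec_mx v) i j Av; rewrite mxE.
Qed.

Lemma unit_rows_closed (R : realType) n k : closed (@unit_rows R n k).
Proof.
by apply: closed_forall => i; apply: closed_eq; apply: contP => A; cont.
Qed.

Lemma unit_rows_compact (R : realType) n k : compact (@unit_rows R n k).
Proof.
apply: mx_compact; first exact: unit_rows_closed.
move=> M i j UM; have := unit_rows_coord i j UM; rewrite -real_normK ?num_real // => H.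
by rewrite -(@ler_pXn2r _ 2) ?nnegrE // expr1n.
Qed.

Lemma mx_hausdorff (R : realType) m n : hausdorff_space 'M[R]_(m, n).
Proof.
move=> A B cl; apply/matrixP => i j.
apply: (@Rhausdorff R) => U V UA VB.
have [] := cl [set M | U (M i j)] [set M | V (M i j)].
- exact: (@coord_continuous _ m n i j A).
- exact: (@coord_continuous _ m n i j B).
- by move=> M [/= UM VM]; exists (M i j).
Qed.

(** Apply the covering form of compactness to the filter of finite lists ordered by
    inclusion. *)
Lemma finite_subcover (T : topologicalType) (K : set T) (V : T -> set T) :
  compact K -> (forall x, K x -> nbhs x (V x)) ->
  exists s : seq T, forall x, K x -> exists2 y, y \in s & V y x.
Proof.
move=> cK oV.
pose F : set_system (seq T) :=
  filter_from setT (fun l0 : seq T => [set l : seq T | {subset l0 <= l}]).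
have FF : Filter F.
  apply: filter_from_filter; first by exists [::].
  move=> a b _ _; exists (a ++ b) => // l /= sub; split => z zin; apply: sub;
    by rewrite mem_cat zin ?orbT.
have /compact_near_coveringP nc := cK.
have [] := nc _ F (fun l x => exists2 y, y \in l & V y x) FF.
  move=> x Kx; exists (V x, [set l : seq T | x \in l]); first split => //=.
  - exact: oV.
  - by exists [:: x] => // l /= sub; apply: sub; rewrite mem_head.
  - by move=> [x' l] [/= Vx' xl]; exists x.
move=> l _ lP; exists l => x Kx.
by have := lP l (fun z zl => zl) x Kx.
Qed.

Section Cutoff.
Variables (R : realType) (T : topologicalType).
Hypotheses (cT : compact [set: T]) (hT : hausdorff_space T).

Lemma point_separation (x : T) (U : set T) : open U -> U x ->
  exists f : T -> R, [/\ continuous f, f x = 1, forall y, 0 <= f y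
    & forall y, ~ U y -> f y = 0].
Proof.
move=> oU Ux.
have crT : completely_regular_space T.
  apply: (@normal_completely_regular R); last exact: hausdorff_accessible.
  by move=> A clA B; apply: compact_normal.
have clU : closed (~` U) by rewrite closedC.
have /(@uniform_separatorP _ R)[f [cf fr f0 f1]] := crT x _ clU (fun H => H Ux).
exists (fun y => 1 - f y); split.
- by apply: contP => y; apply: contatD; [cont|apply/contatN/contE].
- by have /= := f0 (f x) (ex_intro2 _ _ x erefl erefl) => ->; rewrite subr0.
- by move=> y; have /= := fr (f y) (ex_intro2 _ _ y I erefl); rewrite in_itv /=; lra.
- by move=> y nUy; have /= := f1 (f y) (ex_intro2 _ _ y nUy erefl) => ->; rewrite subrr.
Qed.

(** Separate every point from the complement of a member of the cover containing
    it, keep finitely many of these functions, and add up those that belong to the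
    same member; the affine change and the clamping make the sum vanish near the
    complement and reach 1. *)
Lemma cutoff_functions (J : finType) (U : J -> set T) :
  (forall j, open (U j)) -> (forall x, exists j, U j x) ->
  exists lam : J -> T -> R, [/\ forall j, continuous (lam j),
    forall j x, ~ U j x -> \forall y \near x, lam j y = 0
    & forall x, exists j, lam j x = 1].
Proof.
move=> oU covU.
have /choice[jj jjP] : forall x, exists j, U j x by [].
have /choice[f fP] : forall x, exists f : T -> R, [/\ continuous f, f x = 1,
    forall y, 0 <= f y & forall y, ~ U (jj x) y -> f y = 0].
  by move=> x; apply: point_separation.
pose V x := [set y | 2 / 3 < f x y].
have oV x : open (V x).
  apply: open_lt; first by apply: contP => y; cont.
  by have [] := fP x.
have [D Dcov] : exists s : seq T, forall x, setT x -> exists2 y, y \in s & V y x.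
  apply: finite_subcover => // x _; apply: open_nbhs_nbhs; split => //.
  by rewrite /V /=; have [_ -> _ _] := fP x; lra.
pose L j x : R := \sum_(y <- D | jj y == j) f y x.
have cL j : continuous (L j).
  by apply: contP => x; apply: contat_sum => y _; apply: contE; have [] := fP y.
have LU j x : ~ U j x -> L j x = 0.
  move=> nU; rewrite /L big1 // => y /eqP yj; have [_ _ _] := fP y; apply.
  by rewrite yj.
exists (fun j x => clamp (3 * L j x - 1)); split.
- move=> j; apply: contP => x; apply: contat_clamp.
  by have := contE (x := x) (cL j) => cLx; cont.
- move=> j x nU; near=> y; apply: clamp_le0.
  have : L j y < 1 / 3.
    near: y; apply: near_lt; [exact: cL|cont|by rewrite LU //; lra].
  lra.
- move=> x; have [y yD /= Vy] := Dcov x I; exists (jj y); apply: clamp_ge1.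
  have : 2 / 3 < L (jj y) x.
    apply: lt_le_trans Vy _; rewrite /L (big_rem y) //= eqxx lerDl.
    by apply: sumr_ge0 => z _; have [_ _ + _] := fP z; apply.
  lra.
Unshelve. all: by end_near. Qed.

End Cutoff.

(** * Products of 3-spheres and contractions of single factors *)

Section Degree.
Variables (R : realType) (m : nat).
Implicit Type w : {ffun 'I_(m * 3).+1 -> nat}.
Implicit Type z : 'rV[R]_(m * 3).+1.
Local Notation T := (set_type (@unit_rows R m 4)).
Local Notation D := (m * 3)%N.

(** Clamped, so that the collapse below is defined on the whole vector space. *)
Definition cube_coord (z : 'rV[R]_D.+1) (i : 'I_m) (k : 'I_3) : R :=
  Num.max (-1) (Num.min 1 (z 0 (widen_ord (leqnSn D) (mxvec_index i k)))).

Definition cube_tau z i : R := \prod_(k < 3) (1 - cube_coord z i k ^+ 2).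

(** The collapse of the cube onto the 3-sphere, before normalisation: the boundary
    of the cube, where [cube_tau] vanishes, goes to the pole, and the centre to the
    opposite point. *)
Definition cube_vec z i : 'rV[R]_4 :=
  \row_j if unlift ord_max j is Some k then cube_tau z i * cube_coord z i k
         else 1 - 2 * cube_tau z i.

Lemma cube_vec_neq0 z i : cube_vec z i != 0.
Proof.
apply/eqP => /rowP e.
have := e ord_max; rewrite !mxE unlift_none => e1.
have t12 : cube_tau z i = 1 / 2 by lra.
have u0 k : cube_coord z i k = 0.
  have := e (lift ord_max k); rewrite !mxE liftK => /eqP.
  by rewrite mulf_eq0 => /orP[/eqP|/eqP//]; lra.
by move: t12; rewrite /cube_tau big1 => [|k _]; [lra|rewrite u0 expr0n subr0].
Qed.

Definition cube_mat z : 'M[R]_(m, 4) := \matrix_i unitize (cube_vec z i).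

Lemma cube_mat_unit z : unit_rows (cube_mat z).
Proof. by move=> i; rewrite rowK; apply/unitize_unit/cube_vec_neq0. Qed.

Definition cube_pt z : T := exist _ (cube_mat z) (mem_set (@cube_mat_unit z)).

Lemma cube_pt_cont : continuous cube_pt.
Proof.
apply: contP => z; apply: contat_sub; apply: contat_matrix_rows => i.
apply: contat_unitize; first exact: cube_vec_neq0.
have cu k : contat (fun y => cube_coord y i k) z by rewrite /cube_coord; cont.
have ct : contat (fun y => cube_tau y i) z.
  by rewrite /cube_tau; apply: contat_prod => k _; have := cu k => ?; cont.
apply: contat_matrix => a b.
by case: unliftP => [k _|_]; [have := cu k => ?|]; cont.
Qed.

(** A homotopy, read on the cube with time as last coordinate, from the collapse of
    the cube to a map that always has some row at the pole. *)
Section Labelling.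
Variable F : 'rV[R]_D.+1 -> 'M[R]_(m, 4).
Hypotheses (F_unit : forall z, unit_rows (F z))
  (F_ext : forall z z', cube_mat z = cube_mat z' ->
     z 0 ord_max = z' 0 ord_max -> F z = F z')
  (F_start : forall z, z 0 ord_max = -1 -> F z = cube_mat z)
  (F_end : forall z, z 0 ord_max = 1 -> exists i, row i (F z) = pole R 3).
Variable hh : nat.
Hypotheses (hh3 : (3 <= hh)%N)
  (F_close : forall z z' : 'rV[R]_D.+1, (forall i, `|z 0 i| <= 1) ->
     (forall i, `|z 0 i - z' 0 i| <= hh%:R^-1) ->
     forall i j, `|F z i j - F z' i j| < 1 / 4).

Let hhR : 3 <= hh%:R :> R. Proof. by rewrite ler_nat. Qed.
Let hp : 0 < hh%:R :> R. Proof. by rewrite ltr0n; lia. Qed.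
Let N' := (hh.*2).-1.
Let NE : N'.+1 = hh.*2. Proof. by rewrite /N' prednK // double_gt0; lia. Qed.

Let zz (w : {ffun 'I_D.+1 -> nat}) : 'rV[R]_D.+1 := \row_i ((w i)%:R / hh%:R - 1).

Let zzK w : (forall i, w i <= N'.+1)%N -> forall i, `|zz w 0 i| <= 1.
Proof.
move=> wN i; rewrite mxE ler_norml; have : (w i)%:R <= 2 * hh%:R :> R.
  by rewrite -natrM ler_nat mul2n -NE.
move=> A; have B : (w i)%:R / hh%:R <= 2 :> R by rewrite ler_pdivrMr.
have C : 0 <= (w i)%:R / hh%:R :> R by rewrite divr_ge0 // ltW.
by lra.
Qed.

Let co (A : 'M[R]_(m, 4)) (l : 'I_D) : R :=
  mxvec (\matrix_(i < m, k < 3) A i (lift ord_max k)) 0 l.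
Let neg w : pred 'I_D := fun l => co (F (zz w)) l < 0.
Let out w := [exists i, 0 <= F (zz w) i ord_max].
(** The last label marks the points with some row in the upper hemisphere; the other
    labels record the first negative coordinate, or that there is none. *)
Let lab w : 'I_D.+2 := if out w then ord_max else inord (find (neg w) (enum 'I_D)).

Let coE A i k : co A (mxvec_index i k) = A i (lift ord_max k).
Proof. by rewrite /co mxvecE mxE. Qed.

Let labE w : ~~ out w -> lab w = find (neg w) (enum 'I_D) :> nat.
Proof.
move=> no; rewrite /lab (negbTE no) inordK // ltnS leqW //.
by apply: leq_trans (find_size _ _) _; rewrite size_enum_ord.
Qed.

Let lab_out w : (lab w == ord_max) = out w.
Proof.
case: (boolP (out w)) => [ow|no]; first by rewrite /lab ow eqxx.
rewrite -val_eqE /= labE // ltn_eqF // ltnS.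
by apply: leq_trans (find_size _ _) _; rewrite size_enum_ord.
Qed.

Let lab_lt w (l : 'I_D) : lab w = l :> nat -> neg w l.
Proof.
move=> e; have no : ~~ out w.
  by rewrite -lab_out -val_eqE /= e neq_ltn; have := ltn_ord l; lia.
move: e; rewrite labE // => e.
have : has (neg w) (enum 'I_D) by rewrite has_find e size_enum_ord.
by move/(nth_find l); rewrite e nth_ord_enum.
Qed.

Let lab_before w (l : 'I_D) : ~~ out w -> (l < lab w)%N -> ~~ neg w l.
Proof.
move=> no; rewrite labE // => lt.
by have := before_find l lt; rewrite nth_ord_enum => ->.
Qed.

(** The vertices of a simplex with all labels would have all coordinates of some row
    near zero, which a unit vector forbids. *)
Let no_full_simplex (v : {ffun 'I_D.+1 -> 'I_N'.+1}) (s : 'S_D.+1) :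
  ~ injective (fun k : 'I_D.+2 => lab (kuhn_vertex (corner v) s k)).
Proof.
move=> inj.
pose A (k : 'I_D.+2) := F (zz (kuhn_vertex (corner v) s k)).
have close k k' i j : `|A k i j - A k' i j| < 1 / 4.
  apply: F_close.
    apply: zzK => l; rewrite !ffunE; have := ltn_ord (v l).
    by case: (s l < k)%N; rewrite ?addn0 ?addn1 // => /ltnW.
  move=> l; rewrite !mxE !ffunE.
  rewrite [X in `|X|](_ : _ = ((s l < k)%:R - (s l < k')%:R) / hh%:R); last first.
    by rewrite !natrD; ring.
  rewrite normrM [X in _ * X]gtr0_norm; last by rewrite invr_gt0.
  apply: ler_piMl; first by rewrite invr_ge0 ltW.
  by case: (s l < k)%N; case: (s l < k')%N;
    rewrite ?subrr ?subr0 ?sub0r ?normrN ?normr1 ?normr0 ?ler01.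
have surj (c : 'I_D.+2) : exists k : 'I_D.+2, lab (kuhn_vertex (corner v) s k) = c.
  have [g _ gK] := injF_bij inj; exists (g c); exact: gK.
have [ko koE] := surj ord_max.
have [ki kiE] := surj (inord D).
have no_i : ~~ out (kuhn_vertex (corner v) s ki).
  by rewrite -lab_out kiE -val_eqE /= inordK // neq_ltn ltnSn.
have oo : out (kuhn_vertex (corner v) s ko) by rewrite -lab_out koE.
have small i (kk : 'I_3) k : `|A k i (lift ord_max kk)| < 1 / 4.
  pose l := mxvec_index i kk.
  have [kl klE] := surj (widen_ord (leqW (leqnSn _)) l).
  have n1 : co (A kl) l < 0 by apply: lab_lt; rewrite klE.
  have n2 : 0 <= co (A ki) l.
    rewrite leNgt; apply: lab_before => //; rewrite kiE inordK //; exact: ltn_ord.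
  rewrite !coE in n1 n2.
  have := close k kl i (lift ord_max kk); have := close k ki i (lift ord_max kk).
  by rewrite !ltr_norml; lra.
move: oo => /existsP[i oi]; rewrite -/(A ko) in oi.
have ii : A ki i ord_max < 0.
  by rewrite ltNge; apply: contra no_i => ?; apply/existsP; exists i.
have lastc : `|A ko i ord_max| < 1 / 4.
  by have := close ko ki i ord_max; rewrite !ltr_norml; lra.
have := F_unit (zz (kuhn_vertex (corner v) s ko)) i; rewrite -/(A ko) /dot.
rewrite (bigD1_ord ord_max) //= !mxE.
have sq (x : R) : `|x| < 1 / 4 -> x * x <= 1 / 16.
  by rewrite ltr_norml => /andP[? ?]; nra.
have S3 : \sum_(k < 3) row i (A ko) 0 (lift ord_max k) * row i (A ko) 0 (lift ord_max k)
    <= \sum_(k < 3) (1 / 16 : R).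
  by apply: ler_sum => k _; rewrite !mxE; apply: sq.
move: S3; rewrite sumr_const card_ord -mulr_natl => S3 S1.
have := sq _ lastc; lra.
Qed.

Let mxvec_index_inj (a b : 'I_m) (k l : 'I_3) :
  mxvec_index a k = mxvec_index b l -> a = b /\ k = l.
Proof. by move=> /cast_ord_inj/enum_rank_inj[-> ->]. Qed.

Let lab_ext w w' : F (zz w) = F (zz w') -> lab w = lab w'.
Proof. by move=> e; rewrite /lab /neg /out e. Qed.

Let top_out w : w ord_max = N'.+1 -> out w.
Proof.
move=> wm; have [|i /(congr1 (fun r : 'rV[R]_4 => r 0 ord_max))] := @F_end (zz w).
  by rewrite mxE wm NE -mul2n natrM mulfK ?gt_eqF //; ring.
by rewrite !mxE !eqxx => e; apply/existsP; exists i; rewrite e ler01.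
Qed.

(** The collapse forgets the other coordinates of a sphere as soon as one of them is
    at the boundary, so moving one of those others changes neither the point nor its
    label. *)
Let side_facets w (s : 'S_D.+1) a k :
  let i := widen_ord (leqnSn D) (mxvec_index a k) in
  s i = ord_max -> (w i == 0%N) || (w i == N'.+1) -> chain_det lab w s = 0.
Proof.
move=> i si wi.
have kvi j : (j < D.+1)%N -> kuhn_vertex w s j i = w i.
  by move=> jd; rewrite !ffunE si /= ltnNge -ltnS jd addn0.
pose k' : 'I_3 := inord (k == ord0).
have kk' : k' != k.
  by rewrite -val_eqE /= inordK; case: (k) => -[|[|[|]]].
pose l := widen_ord (leqnSn D) (mxvec_index a k').
have li : l != i.
  rewrite /l /i -val_eqE /=; apply: contra kk' => /eqP e.
  by have /mxvec_index_inj[_ ->] : mxvec_index a k' = mxvec_index a k by apply: val_inj.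
have sl : (s l < D)%N.
  have : s l != ord_max by rewrite -si (inj_eq perm_inj).
  by rewrite -val_eqE /=; have := ltn_ord (s l); lia.
have j2P : ((s l).+1 < D.+1)%N by [].
apply: (@facet_det_dup _ _ _ (s l) (Ordinal j2P)).
  by rewrite -val_eqE /= neq_ltn ltnSn.
apply: lab_ext; rewrite /=.
have same c : c != l -> zz (kuhn_vertex w s (s l)) 0 c = zz (kuhn_vertex w s (s l).+1) 0 c.
  move=> cl; rewrite !mxE !ffunE; congr (_%:R / _ - _); congr (_ + nat_of_bool _)%N.
  rewrite ltnS [in RHS]leq_eqVlt; case: eqP => // /val_inj/perm_inj e.
  by rewrite e eqxx in cl.
have lm : (ord_max : 'I_D.+1) != l.
  apply/eqP => /(congr1 val) e; have e' : D = mxvec_index a k' :> nat := e.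
  by have := ltn_ord (mxvec_index a k'); rewrite -e' ltnn.
apply: F_ext; last exact: same.
apply/row_matrixP => b; rewrite !rowK; congr unitize.
case: (eqVneq b a) => [->|ba].
  have tau0 j : (j < D.+1)%N -> cube_tau (zz (kuhn_vertex w s j)) a = 0.
    move=> jd; rewrite /cube_tau (bigD1 k) //=.
    have -> : cube_coord (zz (kuhn_vertex w s j)) a k ^+ 2 = 1.
      rewrite /cube_coord -/i mxE kvi //; case/orP: wi => /eqP ->.
        by rewrite mul0r sub0r min_r ?max_l ?sqrrN ?expr1n //; lra.
      rewrite NE -mul2n natrM mulfK ?gt_eqF //.
      by rewrite (_ : 2 - 1 = 1 :> R) ?minxx ?max_r ?expr1n //; lra.
    by rewrite subrr mul0r.
  apply/rowP => c; rewrite !mxE !tau0 //.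
  by case: unliftP => // ? _; rewrite !mul0r.
have uE c : cube_coord (zz (kuhn_vertex w s (s l))) b c =
    cube_coord (zz (kuhn_vertex w s (s l).+1)) b c.
  rewrite /cube_coord same // -val_eqE /=; apply: contra ba => /eqP e.
  by have /mxvec_index_inj[-> _] : mxvec_index b c = mxvec_index a k' by apply: val_inj.
have tE : cube_tau (zz (kuhn_vertex w s (s l))) b = cube_tau (zz (kuhn_vertex w s (s l).+1)) b.
  by apply: eq_bigr => c _; rewrite uE.
apply/rowP => c; rewrite !mxE tE.
by case: unliftP => // ? _; rewrite uE.
Qed.

Let boundary_facets w (s : 'S_D.+1) : (forall i, w i <= N'.+1)%N ->
  let i := last_coord s in
  (w i == 0%N) || (w i == N'.+1) -> ~~ ((i == ord_max) && (w i == 0%N)) ->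
  chain_det lab w s = 0.
Proof.
move=> wN i wi nbot.
have si : s i = ord_max by rewrite /i /last_coord permKV.
case: (eqVneq i ord_max) => [ie|ine].
  move: nbot wi; rewrite ie eqxx /= => /negbTE -> /= /eqP wm.
  apply: (@facet_det_out _ _ _ ord0); apply/eqP; rewrite lab_out; apply: top_out.
  by rewrite !ffunE -{2}ie si wm addn0.
have iD : (i < D)%N.
  by move: ine; rewrite -val_eqE /=; have := ltn_ord i; lia.
have : i = widen_ord (leqnSn D) (Ordinal iD) by apply: val_inj.
case/mxvec_indexP: (Ordinal iD) => a k e.
by apply: (@side_facets w s a k); rewrite -e.
Qed.

Let F0c w i j : w ord_max = 0%N -> exists2 c : R, 0 < c &
  F (zz w) i j = c * cube_vec (zz w) i 0 j.
Proof.
move=> w0; exists ((enorm (cube_vec (zz w) i))^-1).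
  by rewrite invr_gt0 enorm_gt0 cube_vec_neq0.
rewrite F_start; last by rewrite mxE w0 mul0r sub0r.
by rewrite /cube_mat mxE /unitize mxE.
Qed.

Let coordE w i k : (cube_coord (zz w) i k < 0) =
  (w (widen_ord (leqnSn D) (mxvec_index i k)) < hh)%N.
Proof.
rewrite /cube_coord mxE gt_max ltrN10 /= gt_min ltr10 /= subr_lt0.
by rewrite ltr_pdivrMr // [1 * _]mul1r ltr_nat.
Qed.

(** At the start of the homotopy the labels are those of the grid points themselves. *)
Let negE w : w ord_max = 0%N -> ~~ out w -> forall l : 'I_D,
  neg w l = (w (widen_ord (leqnSn D) l) < hh)%N.
Proof.
move=> w0 no l; rewrite /neg; case/mxvec_indexP: l => i k; rewrite coE.
have tau_pos : 1 / 2 < cube_tau (zz w) i.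
  have : F (zz w) i ord_max < 0.
    by rewrite ltNge; apply: contra no => ?; apply/existsP; exists i.
  have [c c0 ->] := F0c i ord_max w0.
  by rewrite pmulr_rlt0 // mxE unlift_none; lra.
have [c c0 ->] := F0c i (lift ord_max k) w0.
by rewrite pmulr_rlt0 // mxE liftK pmulr_rlt0 ?coordE //; lra.
Qed.

Let label_in w : w ord_max = 0%N -> lab w != ord_max ->
  ((lab w < D)%N -> forall i : 'I_D.+1, nat_of_ord i = lab w -> w i < hh)%N /\
  (forall i : 'I_D.+1, (i < lab w)%N -> (i < D)%N -> hh <= w i)%N.
Proof.
move=> w0; rewrite lab_out => no; split.
  move=> lD i il; have iD : (i < D)%N by rewrite il.
  have -> : i = widen_ord (leqnSn D) (Ordinal iD) by apply: val_inj.
  by rewrite -negE //; apply: lab_lt.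
move=> i il iD.
have -> : i = widen_ord (leqnSn D) (Ordinal iD) by apply: val_inj.
by rewrite leqNgt -negE //; apply: lab_before.
Qed.

Let near_centre w : w ord_max = 0%N ->
  (forall i : 'I_D.+1, (i < D)%N -> (hh.-1 <= w i <= hh)%N) -> lab w != ord_max.
Proof.
move=> w0 wn; rewrite lab_out; apply/existsPn => i; rewrite -ltNge.
have [c c0 ->] := F0c i ord_max w0.
rewrite pmulr_rlt0 // mxE unlift_none subr_lt0.
have usq k : 8 / 9 <= 1 - cube_coord (zz w) i k ^+ 2.
  set l := widen_ord (leqnSn D) (mxvec_index i k).
  have /andP[lo hi] := wn l (ltn_ord (mxvec_index i k)).
  have lo' : hh%:R - 1 <= (w l)%:R :> R.
    by rewrite lerBlDr natr1 ler_nat; lia.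
  have hi' : (w l)%:R <= hh%:R :> R by rewrite ler_nat.
  have /andP[B1 B2] : - (1 / 3) <= (w l)%:R / hh%:R - (1 : R) <= 0.
    have hh3R := hhR; apply/andP; split.
      by rewrite lerBrDr ler_pdivlMr //; lra.
    by rewrite subr_le0 ler_pdivrMr //; lra.
  rewrite /cube_coord -/l mxE min_r; last by lra.
  by rewrite max_r; [nra|lra].
have : 512 / 729 <= cube_tau (zz w) i.
  rewrite /cube_tau !big_ord_recl big_ord0 mulr1.
  have := usq ord0; have := usq (lift ord0 ord0); have := usq (lift ord0 (lift ord0 ord0)).
  set a := 1 - _; set b := 1 - _; set e := 1 - _ => A1 A2 A3.
  have : 64 / 81 <= b * a by nra.
  by nra.
by lra.
Qed.

(** By Sperner's lemma the number of labelled bottom facets is even, whereas the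
    start of the homotopy has exactly one: this is the statement that the collapse
    of the cube has degree one modulo 2. *)
Lemma no_homotopy_to_fat_wedge_grid : False.
Proof.
have hhN : (0 < hh <= N'.+1)%N by rewrite NE -addnn; lia.
have := bottom_count hhN label_in near_centre.
by rewrite (kuhn_sperner no_full_simplex boundary_facets) => /eqP; rewrite eq_sym oner_eq0.
Qed.

End Labelling.

Variables (U : 'I_m -> set T) (h : 'I_m -> T * R -> 'rV[R]_4).
Hypotheses (oU : forall i, open (U i)) (covU : forall x, exists i, U i x).
Hypotheses (hc : forall i x t, U i x -> contat (h i) (x, t))
  (h1 : forall i x t, U i x -> dot (h i (x, t)) (h i (x, t)) = 1)
  (hs : forall i x, U i x -> h i (x, 0) = row i (set_val x))
  (ht : forall i x, U i x -> h i (x, 1) = pole R 3).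

(** Suppose the [m] factors of the product can be contracted to the pole over the
    [m] members of an open cover.  Running the [i]th contraction only up to the time
    given by a cutoff function supported in the [i]th member deforms the identity,
    all factors at once, to a map that has some row at the pole everywhere; this
    contradicts the degree. *)
Lemma unit_rows_no_contractible_cover : False.
Proof.
have cT : compact [set: T] by apply/set_type_compact/unit_rows_compact.
have hT : hausdorff_space T by apply/set_type_hausdorff/mx_hausdorff.
have [lam [clam lam0 lam1]] := @cutoff_functions R T cT hT _ U oU covU.
pose f i (p : T * R) : 'rV[R]_4 := if `[< U i p.1 >] then h i (p.1, p.2 * lam i p.1)
  else row i (set_val p.1).
have fE i x t : lam i x = 0 -> f i (x, t) = row i (set_val x).
  move=> l0; rewrite /f /=; case: asboolP => // Ux.
  by rewrite l0 mulr0 hs.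
have f1 i p : dot (f i p) (f i p) = 1.
  rewrite /f; case: asboolP => Ux; first exact: h1.
  by have := set_valP p.1; apply.
have cf i p : contat (f i) p.
  case: p => x t; have [Ux|nUx] := pselect (U i x).
    have near_U : \forall p \near (x, t), U i p.1.
      have : contat (fun p : T * R => p.1) (x, t) by cont.
      apply; exact: open_nbhs_nbhs.
    have E : \forall p \near (x, t), f i p = h i (p.1, p.2 * lam i p.1).
      by apply: filterS near_U => p Up; rewrite /f asboolT.
    apply: contat_near E _.
    apply: (contat_comp (g := h i)); first exact: hc.
    have cl : contat (fun p : T * R => lam i p.1) (x, t).
      by apply: (contat_comp (g := lam i)); [exact: contE|cont].
    by cont.
  have E : \forall p \near (x, t), f i p = row i (set_val p.1).
    have : \forall p \near (x, t), lam i p.1 = 0.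
      have : contat (fun p : T * R => p.1) (x, t) by cont.
      by move=> /(_ _ (lam0 _ _ nUx)).
    by apply: filterS => -[y r] /= l0; rewrite fE.
  by apply: contat_near E _; cont.
pose F (z : 'rV[R]_D.+1) : 'M[R]_(m, 4) :=
  \matrix_i f i (cube_pt z, (z 0 ord_max + 1) / 2).
have F1 z : unit_rows (F z) by move=> i; rewrite rowK.
have cF : continuous F.
  apply: contP => z; apply: contat_matrix_rows => i.
  apply: (contat_comp (g := f i)); first exact: cf.
  have := contE (x := z) cube_pt_cont => cz; cont.
pose K := [set z : 'rV[R]_D.+1 | forall i, `|z 0 i| <= 1].
have cK : compact K.
  apply: mx_compact; last by move=> z i j /= /(_ j); rewrite (ord1 i).
  apply: closed_forall => i.
  rewrite [X in closed X](_ : _ = [set z : 'rV[R]_D.+1 | Num.max 1 `|z 0 i| = 1]).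
    by apply: closed_eq; apply: contP => z; [apply: contat_max; [|apply: contat_norm]|]; cont.
  by apply/seteqP; split => z /=; [move/max_idPl|move=> H; apply/max_idPl].
have e0 : (0 : R) < 1 / 4 by lra.
have [dl dl0 Fdl] := compact_unif_continuous cK cF e0.
pose hh := maxn 3 (Num.truncn (dl^-1)).+1.
have hh3 : (3 <= hh)%N by rewrite leq_maxl.
have hhR : 3 <= hh%:R :> R by rewrite ler_nat.
have hhdl : hh%:R^-1 < dl.
  rewrite invf_plt ?posrE //; last by rewrite ltr0n; lia.
  apply: lt_le_trans (truncnS_gt _) _.
  by rewrite ler_nat leq_maxr.
apply: (@no_homotopy_to_fat_wedge_grid F F1 _ _ _ hh hh3).
- move=> z z' e et; have eq : cube_pt z = cube_pt z' by apply: val_inj.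
  by apply/row_matrixP => i; rewrite !rowK eq et.
- move=> z z0; apply/row_matrixP => i; rewrite !rowK z0 addNr mul0r /f /=.
  by case: asboolP => Ux; rewrite ?mul0r ?hs ?rowK.
- move=> z z1; have [k lk] := lam1 (cube_pt z); exists k.
  rewrite rowK z1 (_ : (1 + 1) / 2 = 1); last by lra.
  rewrite /f /= lk mulr1; case: asboolP => [Uk|nUk]; first exact: ht.
  have := lam0 k _ nUk => /nbhs_singleton; rewrite lk => /eqP.
  by rewrite oner_eq0.
- move=> z z' Kz zz'; apply: Fdl => // i; exact: le_lt_trans (zz' i) hhdl.
Qed.

End Degree.

(** * The wedge, its double cover, and the lower bound *)

Section Corestriction.
Variables (T : topologicalType) (A : set T) (a0 : A).

(** Total, with an arbitrary value off the subspace, so that no membership proof has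
    to travel with a point. *)
Definition corestrict (x : T) : A := insubd a0 x.

Lemma corestrictK x : A x -> set_val (corestrict x) = x.
Proof. by move=> Ax; rewrite set_valE /corestrict val_insubd mem_set. Qed.

Lemma corestrict_val (a : A) : corestrict (set_val a) = a.
Proof. by apply: val_inj; rewrite -!set_valE corestrictK //; apply: set_valP. Qed.

Lemma contat_corestrict (U : topologicalType) (f : U -> T) (x : U) :
  contat f x -> (\forall y \near x, A (f y)) ->
  contat (fun y => corestrict (f y)) x.
Proof.
move=> cf nA; apply: contat_sub; apply: contat_near cf.
by apply: filterS nA => y Ay; rewrite corestrictK.
Qed.

Lemma contat_corestrictT (U : topologicalType) (f : U -> T) (x : U) :
  contat f x -> (forall y, A (f y)) -> contat (fun y => corestrict (f y)) x.
Proof. by move=> cf fA; apply: contat_corestrict => //; apply: nearW. Qed.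

End Corestriction.

Section Models.
Variable R : realType.

(** A line is represented by the orthogonal projector onto it; this embeds the
    projective plane into matrices. *)
Definition line_proj k (s : 'rV[R]_k) : 'M[R]_k := s^T *m s.

Lemma line_projE k (s : 'rV[R]_k) i j : line_proj s i j = s 0 i * s 0 j.
Proof. by rewrite /line_proj !mxE big_ord1 !mxE. Qed.

Lemma line_projN k (s : 'rV[R]_k) : line_proj (- s) = line_proj s.
Proof. by apply/matrixP => i j; rewrite !line_projE !mxE mulrNN. Qed.

Definition proj_plane : set 'M[R]_3 :=
  [set P | exists2 s : 'rV[R]_3, dot s s = 1 & P = line_proj s].

Definition north : 'rV[R]_3 := pole R 2.
Definition polar_line : 'M[R]_3 := line_proj north.

(** The wedge of the projective plane and the product of [n] 3-spheres. *)
Definition base_set n : set ('M[R]_3 * 'M[R]_(n, 4)) :=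
  [set p | [/\ proj_plane p.1, unit_rows p.2 &
     p.2 = poles R n 3 \/ p.1 = polar_line]].

(** The 2-sphere with one copy of the product of 3-spheres at each of its poles. *)
Definition cover_set n : set ('rV[R]_3 * 'M[R]_(n, 4)) :=
  [set p | [/\ dot p.1 p.1 = 1, unit_rows p.2 &
     p.2 = poles R n 3 \/ line_proj p.1 = polar_line]].


(** The squared inner product of [s] and [s'] is the inner product of their
    projectors, and unit vectors with inner product 1 or -1 agree up to sign. *)
Lemma line_proj_eq k (s s' : 'rV[R]_k) : dot s s = 1 -> dot s' s' = 1 ->
  line_proj s = line_proj s' -> s' = s \/ s' = - s.
Proof.
move=> s1 s1' e.
have E i j : s 0 i * s 0 j = s' 0 i * s' 0 j.
  by have := congr1 (fun M : 'M[R]_k => M i j) e; rewrite !line_projE.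
have d2 : dot s s' * dot s s' = 1.
  rewrite {1}/dot mulr_suml -s1'; rewrite [in RHS]/dot.
  have -> : \sum_i s' 0 i * s' 0 i = \sum_i s 0 i * s 0 i.
    by apply: eq_bigr => i _; rewrite E.
  rewrite -[X in _ = X]/(dot s s) s1 -[RHS]s1' /dot.
  transitivity (\sum_i \sum_j (s 0 i * s 0 j) * (s' 0 i * s' 0 j)).
    by apply: eq_bigr => i _; rewrite mulr_sumr; apply: eq_bigr => j _; ring.
  transitivity (\sum_i s' 0 i * s' 0 i * dot s' s').
    apply: eq_bigr => i _; rewrite /dot mulr_sumr; apply: eq_bigr => j _.
    by rewrite E; ring.
  by apply: eq_bigr => i _; rewrite s1' mulr1.
have : (dot s s' - 1) * (dot s s' + 1) = 0 by rewrite -subr_sqr expr1n expr2 d2 subrr.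
move/eqP; rewrite mulf_eq0 => /orP[|] /eqP H; [left|right].
  by apply: dot_unit_eq1 => //; rewrite dotC; lra.
by apply: dot_unit_eq1; rewrite ?dotNl ?dotNr ?opprK // dotC; lra.
Qed.

Lemma north_unit : dot north north = 1. Proof. exact: pole_unit. Qed.

Lemma polar_line_unit_eq s : dot s s = 1 -> line_proj s = polar_line ->
  s = north \/ s = - north.
Proof. by move=> s1 /esym/(line_proj_eq north_unit s1). Qed.

Section LowerBound.
Variable n : nat.
Local Notation Xt := (set_type (@cover_set n)).

Lemma cover_set_end (e : bool) (y : 'M[R]_(n, 4)) : unit_rows y ->
  cover_set ((-1) ^+ e *: north, y).
Proof.
move=> y1; split => //=; first by rewrite dotZl dotZr mulrA -expr2 sqrr_sign mul1r north_unit.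
by right; case: e; rewrite ?expr0 ?scale1r // expr1 scaleN1r line_projN.
Qed.

Lemma cover_base_subproof : cover_set ((-1) ^+ false *: north, poles R n 3).
Proof. by apply: cover_set_end; apply: poles_unit. Qed.

Definition cover_base : Xt :=
  exist (fun p => p \in @cover_set n) _ (mem_set cover_base_subproof).

(** The retraction onto the copy of the product at [(-1) ^+ e *: north], which sends
    the rest of the space to the base point of that copy. *)
Definition end_part (e : bool) (p : Xt) : 'M[R]_(n, 4) :=
  if 0 <= (-1) ^+ e * (set_val p).1 0 ord_max then (set_val p).2 else poles R n 3.

Lemma end_part_unit e p : unit_rows (end_part e p).
Proof.
by rewrite /end_part; case: ifP => _; [have [] := set_valP p|apply: poles_unit].
Qed.

Lemma cover_middle (p : Xt) : `|(set_val p).1 0 ord_max| < 1 ->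
  (set_val p).2 = poles R n 3.
Proof.
have [s1 _ []//] := set_valP p; move=> /(polar_line_unit_eq s1)[->|->];
  by rewrite !mxE !eqxx ?normrN normr1 ltxx.
Qed.

Lemma contat_end_part e p : contat (end_part e) p.
Proof.
pose g (q : Xt) : R := (-1) ^+ e * (set_val q).1 0 ord_max.
have cg : contat g p by rewrite /g; cont.
have [g0|g0|g0] := ltgtP (g p) 0.
- apply: (contat_near (g := fun=> poles R n 3)); last by cont.
  have : \forall q \near p, g q < 0 by apply: near_lt => //; cont.
  by apply: filterS => q gq; rewrite /end_part leNgt -/(g q) gq.
- apply: (contat_near (g := fun q => (set_val q).2)); last by cont.
  have : \forall q \near p, 0 < g q by apply: near_lt => //; cont.
  by apply: filterS => q gq; rewrite /end_part -/(g q) ltW.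
- apply: (contat_near (g := fun=> poles R n 3)); last by cont.
  have : \forall q \near p, `|g q| < 1.
    by apply: near_lt; [apply: contat_norm|cont|rewrite g0 normr0].
  apply: filterS => q; rewrite /g normrM normrX normrN1 expr1n mul1r.
  by move=> /cover_middle e2; rewrite /end_part e2 if_same.
Qed.

Lemma end_part_end e e' y : unit_rows y ->
  end_part e (corestrict cover_base ((-1) ^+ nat_of_bool e' *: north, y)) =
  if e == e' then y else poles R n 3.
Proof.
move=> y1; rewrite /end_part corestrictK /=; last exact: cover_set_end.
rewrite !mxE !eqxx mulr1.
by case: e e' => -[]; rewrite /= ?expr0 ?expr1 ?mulrNN ?mulr1 ?mul1r ?ler01 // ler0N1.
Qed.

(** Consider motions from the copy of the product at one pole to the copy at the
    other.  Retracted to the first copy, such a motion ends at the base point;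
    retracted to the second copy, it starts there.  Hence a planner contracts each
    of the [n + n] factors, half of them backwards in time, and [n + n] planners
    would contract the [i]th factor over the [i]th member of the cover. *)
Theorem cover_space_TC_lower j :
  motion_planning_cover R Xt j -> (n + n < j)%N.
Proof.
move=> [U [oU covU pU]]; rewrite ltnNge; apply/negP => jn.
have /choice[H HP] i := homotopy_of_planner (oU i) (pU i).
pose T := set_type (@unit_rows R (n + n) 4).
have unit_u (x : T) : unit_rows (usubmx (set_val x)).
  move=> i; rewrite (_ : row i _ = row (lshift n i) (set_val x)).
    by have := set_valP x; apply.
  by apply/rowP => k; rewrite !mxE.
have unit_d (x : T) : unit_rows (dsubmx (set_val x)).
  move=> i; rewrite (_ : row i _ = row (rshift n i) (set_val x)).
    by have := set_valP x; apply.
  by apply/rowP => k; rewrite !mxE.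
pose iota (x : T) : Xt * Xt :=
  (corestrict cover_base ((-1) ^+ false *: north, usubmx (set_val x)),
   corestrict cover_base ((-1) ^+ true *: north, dsubmx (set_val x))).
have i1 x : (iota x).1 =
    corestrict cover_base ((-1) ^+ nat_of_bool false *: north, usubmx (set_val x)) by [].
have i2 x : (iota x).2 =
    corestrict cover_base ((-1) ^+ nat_of_bool true *: north, dsubmx (set_val x)) by [].
have ci x : contat iota x.
  by apply: contat_pair; apply: contat_corestrictT;
    [cont|move=> y; exact: cover_set_end|cont|move=> y; exact: cover_set_end].
pose V (i : 'I_(n + n)) : set T :=
  if insub (i : nat) is Some i' then iota @^-1` U i' else set0.
pose h (i : 'I_(n + n)) (p : T * R) : 'rV[R]_4 :=
  if insub (i : nat) is Some i' then
    match fintype.split i with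
    | inl a => row a (end_part false (H i' (iota p.1) p.2))
    | inr b => row b (end_part true (H i' (iota p.1) (1 - p.2)))
    end
  else pole R 3.
have cH i' (x : T) (g : R -> R) t : U i' (iota x) -> contat g t ->
    contat (fun p : T * R => H i' (iota p.1) (g p.2)) (x, t).
  move=> Ux cg; have [cH _] := HP i'.
  apply: (contat_comp (g := uncurry (H i')) (f := fun p : T * R => (iota p.1, g p.2))).
    exact: cH.
  apply: contat_pair.
    by apply: (contat_comp (g := iota)); [exact: ci|cont].
  by apply: (contat_comp (g := g)); [|cont].
apply: (@unit_rows_no_contractible_cover R (n + n) V h).
- move=> i; rewrite /V; case: insubP => [i' _ _|_]; last exact: open0.
  by apply: open_comp => // x _; apply: ci.
- move=> x; have : setT (iota x) by [].
  rewrite -covU => -[i _ Ui].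
  have in' : (i < n + n)%N by apply: leq_trans jn.
  by exists (Ordinal in'); rewrite /V /= valK.
- move=> i x t; rewrite /V /h; case: insubP => [i' _ _|//] Ux.
  case: (fintype.split i) => a; apply: contat_row.
    apply: (contat_comp (g := end_part false)); first exact: contat_end_part.
    by apply: (cH _ _ id) => //; cont.
  apply: (contat_comp (g := end_part true)); first exact: contat_end_part.
  have c1 : contat (fun r : R => 1 - r) t by cont.
  exact: (cH i' x (fun r => 1 - r) t Ux c1).
- move=> i x t; rewrite /V /h; case: insubP => [i' _ _|//] Ux.
  by case: (fintype.split i) => a; apply: end_part_unit.
- move=> i x; rewrite /V /h; case: insubP => [i' _ _|//] Ux.
  have [_ /(_ _ Ux)[H0 H1]] := HP i'.
  case: (fintype.splitP i) => a ia.
    rewrite [LHS](_ : _ = row a (end_part false (iota x).1)); last by rewrite -H0.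
    rewrite i1 end_part_end //.
    by apply/rowP => b; rewrite !mxE; congr (set_val x _ b); apply: val_inj.
  rewrite [LHS](_ : _ = row a (end_part true (iota x).2)); last by rewrite -H1 /= subr0.
  rewrite i2 end_part_end //.
  by apply/rowP => b; rewrite !mxE; congr (set_val x _ b); apply: val_inj.
- move=> i x; rewrite /V /h; case: insubP => [i' _ _|//] Ux.
  have [_ /(_ _ Ux)[H0 H1]] := HP i'.
  case: (fintype.split i) => a.
    rewrite [LHS](_ : _ = row a (end_part false (iota x).2)); last by rewrite -H1.
    by rewrite i2 end_part_end // row_poles.
  rewrite [LHS](_ : _ = row a (end_part true (iota x).1)); last by rewrite -H0 /= subrr.
  by rewrite i1 end_part_end // row_poles.
Qed.

End LowerBound.
End Models.

(** * Planners from level sets, and concatenation of motions *)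

Lemma nbhs_subI (T : topologicalType) (x : T) (A B C : set T) :
  nbhs x A -> nbhs x B -> A `&` B `<=` C -> nbhs x C.
Proof. by move=> nA nB sub; apply: filterS sub _; apply: filterI. Qed.

Section Merge.
Variables (R : realType) (X : topologicalType) (K : finType) (f : K -> X * X -> R).
Hypothesis cf : forall k, continuous (f k).

(** The points where the functions indexed by [S] are smaller than the others; the
    bounds 0 and 1/2 record what a planner may use about either kind. *)
Definition level_set (S : {set K}) : set (X * X) :=
  [set z | [/\ forall i j, i \in S -> j \notin S -> f i z < f j z,
      forall j, j \notin S -> 0 < f j z & forall i, i \in S -> f i z < 1 / 2]].

Lemma near_level_set S z : level_set S z -> \forall y \near z, level_set S y.
Proof.
move=> [H1 H2 H3].
have n1 : \forall y \near z, forall i j, i \in S -> j \notin S -> f i y < f j y.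
  apply: (@filter_forall _ _ (fun i y => forall j, i \in S -> j \notin S -> f i y < f j y)
    (nbhs z) (nbhs_filter z)) => i.
  apply: (@filter_forall _ _ (fun j y => i \in S -> j \notin S -> f i y < f j y)
    (nbhs z) (nbhs_filter z)) => j.
  have [iS|_] := boolP (i \in S); last by apply: nearW.
  have [jS|_] := boolP (j \notin S); last by apply: nearW.
  have := near_lt (@cf i z) (@cf j z) (H1 i j iS jS).
  by apply: filterS.
have n2 : \forall y \near z, forall j, j \notin S -> 0 < f j y.
  apply: (@filter_forall _ _ (fun j y => j \notin S -> 0 < f j y) (nbhs z) (nbhs_filter z)) => j.
  have [jS|_] := boolP (j \notin S); last by apply: nearW.
  have := near_lt (@contat_cst _ _ (0 : R) z) (@cf j z) (H2 j jS).
  by apply: filterS.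
have n3 : \forall y \near z, forall i, i \in S -> f i y < 1 / 2.
  apply: (@filter_forall _ _ (fun j y => j \in S -> f j y < 1 / 2) (nbhs z) (nbhs_filter z)) => j.
  have [jS|_] := boolP (j \in S); last by apply: nearW.
  have := near_lt (@cf j z) (@contat_cst _ _ (1 / 2 : R) z) (H3 j jS).
  by apply: filterS.
by near=> y; split; near: y.
Unshelve. all: by end_near. Qed.

Lemma level_set_uniq (S S' : {set K}) z : #|S| = #|S'| -> level_set S z -> level_set S' z -> S = S'.
Proof.
move=> c12 [H _ _] [H' _ _]; apply/eqP; apply: contraT => ne.
have [i iS iS'] : exists2 i, i \in S & i \notin S'.
  have : ~~ (S \subset S').
    by apply: contra ne => sub; rewrite eqEcard sub c12 leqnn.
  by move/subsetPn.
have [j jS' jS] : exists2 j, j \in S' & j \notin S.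
  have : ~~ (S' \subset S).
    by apply: contra ne => sub; rewrite eq_sym eqEcard sub c12 leqnn.
  by move/subsetPn.
by have := lt_trans (H i j iS jS) (H' j i jS' iS'); rewrite ltxx.
Qed.

(** Two distinct sets of the same cardinality have disjoint level sets, so their
    planners fit together, and only the cardinality remains to index the cover. *)
Lemma merged_planners (H : {set K} -> X * X -> R -> X) :
  (forall S z t, level_set S z -> contat (uncurry (H S)) (z, t)) ->
  (forall S z, level_set S z -> H S z 0 = z.1 /\ H S z 1 = z.2) ->
  motion_planning_cover R X #|K|.+1.
Proof.
move=> cH HE.
pose U (c : 'I_#|K|.+1) : set (X * X) :=
  [set z | exists2 S : {set K}, #|S| = c & level_set S z].
exists U; split.
- move=> c; rewrite openE => z [S Sc LS].
  by apply: filterS (near_level_set LS) => y LSy; exists S.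
- rewrite -subTset => z _; pose S : {set K} := finset (fun i => f i z <= 0).
  have Sc : (#|S| < #|K|.+1)%N by rewrite ltnS max_card.
  exists (Ordinal Sc) => //; exists S => //; split.
  + move=> i j; rewrite !inE -ltNge => i0 j0; exact: le_lt_trans j0.
  + by move=> j; rewrite inE -ltNge.
  + by move=> i; rewrite inE => i0; apply: le_lt_trans i0 _; lra.
- move=> c.
  pose s (z : X * X) : {set K} :=
    odflt finset.set0 [pick S : {set K} | (#|S| == c) && `[< level_set S z >]].
  have sE (S : {set K}) z : #|S| = c -> level_set S z -> s z = S.
    move=> Sc LS; rewrite /s; case: pickP => [S' /andP[/eqP S'c /asboolP LS']|/(_ S)].
      by apply: (level_set_uniq _ LS' LS); rewrite S'c.
    by rewrite Sc eqxx asboolT.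
  apply: (planner_of_homotopy (H := fun z => H (s z) z)).
    move=> z t [S Sc LS].
    have E : \forall p \near (z, t), uncurry (fun z => H (s z) z) p = uncurry (H S) p.
      have : \forall p \near (z, t), level_set S p.1.
        have : contat (fun p : X * X * R => p.1) (z, t) by cont.
        by move=> /(_ _ (near_level_set LS)).
      by apply: filterS => -[y r] /= LSy; rewrite (sE _ _ Sc LSy).
    exact: contat_near E (cH _ _ _ LS).
  by move=> z [S Sc LS]; rewrite (sE _ _ Sc LS); apply: HE.
Qed.

End Merge.

Lemma contat_uncurry (T T' U : topologicalType) (f : T -> T' -> U) (p : T * T') :
  contat (fun q => f q.1 q.2) p -> contat (uncurry f) p.
Proof. by move=> cf; have -> : uncurry f = (fun q => f q.1 q.2) by apply/funext => -[]. Qed.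

Lemma contat_uncurry_comp (T T' U W : topologicalType) (f : T -> T' -> U)
    (a : W -> T) (b : W -> T') (x : W) :
  contat (uncurry f) (a x, b x) -> contat a x -> contat b x ->
  contat (fun y => f (a y) (b y)) x.
Proof.
move=> cf ca cb; apply: (contat_comp (g := uncurry f) (f := fun y => (a y, b y))) => //.
by apply: contat_pair.
Qed.

Section Concat.
Variables (R : realType) (T X : topologicalType).
Implicit Types H : T -> R -> X.

Definition concat H1 H2 (z : T) (t : R) : X :=
  if t <= 1 / 2 then H1 z (2 * t) else H2 z (2 * t - 1).

Lemma concat0 H1 H2 z : concat H1 H2 z 0 = H1 z 0.
Proof. by rewrite /concat mulr0 ifT //; lra. Qed.

Lemma concat1 H1 H2 z : concat H1 H2 z 1 = H2 z 1.
Proof. by rewrite /concat ifF; [congr (H2 z _); lra|apply/negbTE; rewrite -ltNge; lra]. Qed.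

Lemma contat_concat H1 H2 z t :
  (forall r, contat (uncurry H1) (z, r)) -> (forall r, contat (uncurry H2) (z, r)) ->
  H1 z 1 = H2 z 0 -> contat (uncurry (concat H1 H2)) (z, t).
Proof.
move=> c1 c2 e12.
have c1' : contat (fun p : T * R => uncurry H1 (p.1, 2 * p.2)) (z, t).
  by apply: contat_comp; [exact: c1|cont].
have c2' : contat (fun p : T * R => uncurry H2 (p.1, 2 * p.2 - 1)) (z, t).
  by apply: contat_comp; [exact: c2|cont].
have cs : contat (fun p : T * R => p.2) (z, t) by cont.
have [tl|tg|te] := ltgtP t (1 / 2).
- have E : \forall p \near (z, t), p.2 < 1 / 2 by apply: near_lt => //; cont.
  apply: contat_near c1'; apply: filterS E => -[y r] /= rl.
  by rewrite /uncurry /concat ltW.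
- have E : \forall p \near (z, t), 1 / 2 < p.2 by apply: near_lt => //; cont.
  apply: contat_near c2'; apply: filterS E => -[y r] /= rl.
  by rewrite /uncurry /concat leNgt rl.
- move=> O; rewrite {1}/uncurry /concat te lexx => nO.
  have e1 : (2 * (1 / 2) = 1 :> R) by lra.
  have n1 := c1' O; have n2 := c2' O.
  rewrite /= te e1 in nO n1 n2.
  have := n1 nO; have : nbhs (uncurry H2 (z, 1 - 1)) O by rewrite subrr /= -e12.
  move=> /n2 m2 m1; rewrite !nbhs_simpl /= in m1 m2 *.
  apply: (nbhs_subI m1 m2) => -[y r] [/= p1 p2].
  by case: ifP.
Qed.

End Concat.


Lemma concat_in (R : realType) (T V : topologicalType) (A : set V)
    (H1 H2 : T -> R -> V) z t :
  (forall r, A (H1 z r)) -> (forall r, A (H2 z r)) -> A (concat H1 H2 z t).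
Proof. by move=> A1 A2; rewrite /concat; case: ifP. Qed.

(** * Motions in spheres and in the projective plane *)

(** Only the chord between antipodal points meets the origin. *)
Lemma chord_neq0 (R : realType) k (a b : 'rV[R]_k) (t : R) :
  dot a a = 1 -> dot b b = 1 -> 0 <= t <= 1 -> -1 < dot a b ->
  (1 - t) *: a + t *: b != 0.
Proof.
move=> a1 b1 /andP[t0 t1] cH; apply/eqP => d0.
have := congr1 (fun u => dot u u) d0; set c := dot a b in cH *.
rewrite !(dotDl, dotDr, dotZl, dotZr) a1 b1 (dotC b a) -/c dot0l => e0.
have /andP[_ c1] : -1 <= c <= 1 by apply: dot_unit_le1.
have u4 : t * (1 - t) <= 1 / 4 by have := sqr_ge0 (t - 1 / 2); rewrite expr2; lra.
have : 0 <= (1 / 4 - t * (1 - t)) * (1 - c) by apply: mulr_ge0; lra.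
by move: e0; lra.
Qed.

Section RowPlanner.
Variables (R : realType) (n : nat).
Implicit Types a b : 'rV[R]_4.

Lemma dot4 a b : dot a b = a 0 0 * b 0 0 + a 0 1 * b 0 1 + a 0 2 * b 0 2 + a 0 3 * b 0 3.
Proof.
rewrite /dot !big_ord_recl big_ord0 addr0 !addrA.
by do ![congr (_ + _)]; congr (a _ _ * b _ _); apply: val_inj.
Qed.

(** A unit tangent vector field, which exists because the sphere has odd dimension. *)
Definition quarter_turn a : 'rV[R]_4 :=
  \row_(j < 4) [:: - a 0 1; a 0 0; - a 0 3; a 0 2]`_j.

Lemma dot_quarter_turn a : dot a (quarter_turn a) = 0.
Proof. by rewrite dot4 !mxE /=; ring. Qed.

Lemma quarter_turn_unit a : dot (quarter_turn a) (quarter_turn a) = dot a a.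
Proof. by rewrite !dot4 !mxE /=; ring. Qed.

Lemma contat_quarter_turn (T : topologicalType) (f : T -> 'rV[R]_4) x :
  contat f x -> contat (fun y => quarter_turn (f y)) x.
Proof.
move=> cf; apply: contat_matrix => i j.
by case: j => -[|[|[|[|//]]]] ? /=; cont.
Qed.

(** From [a] to [b] along the chord, or, if [e] holds, bulging in the direction of
    the tangent field, which avoids the origin when [a] and [b] are close to
    antipodal. *)
Definition detour (e : bool) a b (t : R) : 'rV[R]_4 :=
  (1 - t) *: a + t *: b + (e%:R * (3 * t * (1 - t))) *: quarter_turn a.

Lemma detour_neq0 e a b t : dot a a = 1 -> dot b b = 1 -> 0 <= t <= 1 ->
  (if e then dot a b < - (1 / 2) else -1 < dot a b) -> detour e a b t != 0.
Proof.
move=> a1 b1 t01; case: e => cH; last first.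
  by rewrite /detour mul0r scale0r addr0 chord_neq0.
have /andP[t0 t1] := t01; set c := dot a b in cH; apply/eqP => d0.
have := congr1 (dot a) d0; have := congr1 (dot (quarter_turn a)) d0.
  rewrite /detour !dotDr !dotZr dot_quarter_turn (dotC _ a) dot_quarter_turn.
  rewrite quarter_turn_unit a1 (dotC _ 0) !dot0l (dotC a 0) dot0l -/c mul1r.
  set w := dot (quarter_turn a) b => e1 e2.
  have tpos : 0 < t by rewrite lt0r t0 andbT; apply/eqP => tz; move: e2; rewrite tz; lra.
  have ew : w = - (3 * (1 - t)).
    apply: (mulfI (x := t)); first by rewrite gt_eqF.
    by move: e1; lra.
  have h1 : 1 - t = - (t * c) by lra.
  have h2 : 1 / 3 <= 1 - t by nra.
  have := dot_ge0 (b - c *: a - w *: quarter_turn a).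
  rewrite !(dotDl, dotDr, dotNl, dotNr, dotZl, dotZr) b1 a1 quarter_turn_unit a1.
  rewrite (dotC (quarter_turn a) a) dot_quarter_turn (dotC b a) (dotC b (quarter_turn a)) -/c -/w.
  nra.
Qed.

Lemma detour0 e a b : detour e a b 0 = a.
Proof. by rewrite /detour subr0 scale1r scale0r addr0 !(mulr0, mul0r) scale0r addr0. Qed.

Lemma detour1 e a b : detour e a b 1 = b.
Proof. by rewrite /detour subrr scale0r add0r scale1r !mulr0 scale0r addr0. Qed.

Definition row_path (e : 'I_n -> bool) (v v' : 'M[R]_(n, 4)) (t : R) : 'M[R]_(n, 4) :=
  \matrix_i unitize (detour (e i) (row i v) (row i v') (clamp t)).

Definition row_path_dom (e : 'I_n -> bool) (v v' : 'M[R]_(n, 4)) :=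
  forall i, if e i then dot (row i v) (row i v') < - (1 / 2)
            else -1 < dot (row i v) (row i v').

Section Path.
Variables (e : 'I_n -> bool) (v v' : 'M[R]_(n, 4)).
Hypotheses (v1 : unit_rows v) (v1' : unit_rows v') (dom : row_path_dom e v v').

Lemma row_path_neq0 i t : detour (e i) (row i v) (row i v') (clamp t) != 0.
Proof. by apply: detour_neq0; [apply: v1|apply: v1'|apply: clamp_itv|apply: dom]. Qed.

Lemma row_path_unit t : unit_rows (row_path e v v' t).
Proof. by move=> i; rewrite rowK; apply/unitize_unit/row_path_neq0. Qed.

Lemma row_path0 : row_path e v v' 0 = v.
Proof. by apply/row_matrixP => i; rewrite rowK clamp0 detour0 unitize_id. Qed.

Lemma row_path1 : row_path e v v' 1 = v'.
Proof. by apply/row_matrixP => i; rewrite rowK clamp1 detour1 unitize_id. Qed.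

Lemma contat_row_path (T : topologicalType) (f g : T -> 'M[R]_(n, 4)) (h : T -> R) x :
  f x = v -> g x = v' -> contat f x -> contat g x -> contat h x ->
  contat (fun y => row_path e (f y) (g y) (h y)) x.
Proof.
move=> fv gv cf cg ch; apply: contat_matrix_rows => i.
apply: contat_unitize; first by rewrite fv gv; apply: row_path_neq0.
have cq : contat (fun y => quarter_turn (row i (f y))) x.
  by apply: contat_quarter_turn; cont.
by rewrite /detour; cont.
Qed.

End Path.

Lemma row_path_id e v t : unit_rows v -> (forall i, e i = false) ->
  row_path e v v t = v.
Proof.
move=> v1 e0; apply/row_matrixP => i; rewrite rowK e0 /detour mul0r scale0r addr0.
by rewrite -scalerDl subrK scale1r unitize_id.
Qed.

End RowPlanner.

Section LineContraction.
Variable R : realType.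

(** Deforms the space onto the polar axis; lines with a nonzero [j]th coordinate are
    not collapsed, and the polar line is kept if [j] is the last index. *)
Definition line_pull (j : 'I_3) (t : R) : 'M[R]_3 :=
  (1 - t) *: 1%:M + t *: delta_mx j ord_max.

Definition line_path (j : 'I_3) (P : 'M[R]_3) (t : R) : 'M[R]_3 :=
  let M := (line_pull j (clamp t))^T *m P *m line_pull j (clamp t) in
  (\tr M)^-1 *: M.

Lemma line_pullE j (s : 'rV[R]_3) t :
  s *m line_pull j t = (1 - t) *: s + (t * s 0 j) *: north R.
Proof.
rewrite mulmxDr -scalemxAr mulmx1; congr (_ + _); apply/rowP => k.
rewrite -scalemxAr !mxE (bigD1 j) //= big1 ?addr0 => [|i ij].
  by rewrite !mxE !eqxx -mulrA.
by rewrite !mxE (negbTE ij) mulr0.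
Qed.

Lemma line_pull_neq0 j (s : 'rV[R]_3) t : 0 < s 0 j * s 0 j -> s *m line_pull j t != 0.
Proof.
move=> sj; have sj0 : s 0 j != 0 by apply: contraTneq sj => ->; rewrite mul0r ltxx.
rewrite line_pullE; apply/eqP => /rowP e.
have [t1|t1] := eqVneq t 1.
  have := e ord_max; rewrite !mxE t1 subrr mul0r add0r !eqxx mulr1 mul1r => /eqP.
  by rewrite (negbTE sj0).
have := e j; rewrite !mxE eqxx /=; case: eqVneq => [_|_].
  by rewrite mulr1 -mulrDl subrK mul1r => /eqP; rewrite (negbTE sj0).
rewrite mulr0 addr0 => /eqP; rewrite mulf_eq0 (negbTE sj0) orbF subr_eq0 eq_sym.
by rewrite (negbTE t1).
Qed.

Lemma tr_line_proj k (s : 'rV[R]_k) : \tr (line_proj s) = dot s s.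
Proof. by apply: eq_bigr => i _; rewrite line_projE. Qed.

Lemma line_proj_unitize k (s : 'rV[R]_k) : s != 0 ->
  line_proj (unitize s) = (dot s s)^-1 *: line_proj s.
Proof.
move=> s0; apply/matrixP => i j; rewrite [RHS]mxE !line_projE !mxE -sqr_enorm.
by field; rewrite enorm_eq0.
Qed.

Lemma line_path_proj j (s : 'rV[R]_3) t : 0 < s 0 j * s 0 j ->
  line_path j (line_proj s) t = line_proj (unitize (s *m line_pull j (clamp t))).
Proof.
move=> sj; rewrite line_proj_unitize; last exact: line_pull_neq0.
have E : (line_pull j (clamp t))^T *m line_proj s *m line_pull j (clamp t) =
   line_proj (s *m line_pull j (clamp t)).
  by rewrite /line_proj trmx_mul !mulmxA.
by rewrite /line_path E tr_line_proj.
Qed.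

Section Pt.
Variables (j : 'I_3) (P : 'M[R]_3).
Hypotheses (PP : proj_plane P) (Pj : 0 < P j j).

Lemma line_path_plane t : proj_plane (line_path j P t).
Proof.
have [s s1 Ps] := PP; have sj : 0 < s 0 j * s 0 j by rewrite -line_projE -Ps.
exists (unitize (s *m line_pull j (clamp t))); first by apply/unitize_unit/line_pull_neq0.
by rewrite Ps line_path_proj.
Qed.

Lemma line_path0 : line_path j P 0 = P.
Proof.
have [s s1 Ps] := PP; have sj : 0 < s 0 j * s 0 j by rewrite -line_projE -Ps.
rewrite Ps line_path_proj // clamp0 line_pullE subr0 scale1r mul0r scale0r addr0.
by rewrite unitize_id.
Qed.

Lemma line_path1 : line_path j P 1 = polar_line R.
Proof.
have [s s1 Ps] := PP; have sj : 0 < s 0 j * s 0 j by rewrite -line_projE -Ps.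
rewrite Ps line_path_proj // clamp1 line_pullE subrr scale0r add0r mul1r.
have [p|p] := ltP 0 (s 0 j); first by rewrite unitizeZ // unitize_id // north_unit.
have q : 0 < - s 0 j.
  by rewrite oppr_gt0 lt_neqAle p andbT; apply: contraTneq sj => ->; rewrite mul0r ltxx.
rewrite (_ : s 0 j *: north R = (- s 0 j) *: (- north R)); last by rewrite scalerN scaleNr opprK.
rewrite unitizeZ // unitize_id ?line_projN //.
by rewrite dotNl dotNr opprK north_unit.
Qed.

Lemma contat_line_path (T : topologicalType) (f : T -> 'M[R]_3) (h : T -> R) x :
  f x = P -> contat f x -> contat h x ->
  contat (fun y => line_path j (f y) (h y)) x.
Proof.
move=> fP cf ch.
have cL : contat (fun y => line_pull j (clamp (h y))) x.
  by rewrite /line_pull; cont.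
have cM : contat (fun y => (line_pull j (clamp (h y)))^T *m f y *m line_pull j (clamp (h y))) x.
  by cont.
apply: contat_mxZ => //; apply: contatV; last first.
  by rewrite /mxtrace; cont.
rewrite fP; have [s s1 Ps] := PP; have sj : 0 < s 0 j * s 0 j by rewrite -line_projE -Ps.
rewrite Ps (_ : _ *m _ *m _ = line_proj (s *m line_pull j (clamp (h x)))).
  by rewrite tr_line_proj dot_eq0 line_pull_neq0.
by rewrite /line_proj trmx_mul !mulmxA.
Qed.

End Pt.

Lemma line_path_polar t : line_path ord_max (polar_line R) t = polar_line R.
Proof.
rewrite /polar_line line_path_proj; last by rewrite !mxE !eqxx mulr1 ltr01.
by rewrite line_pullE !mxE !eqxx mulr1 -scalerDl subrK scale1r unitize_id // north_unit.
Qed.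

End LineContraction.

(** * The upper bound for the wedge *)

Section BaseUpper.
Variables (R : realType) (n : nat).
Local Notation V := ('M[R]_3 * 'M[R]_(n, 4))%type.
Local Notation X := (set_type (@base_set R n)).
Local Notation K := ('I_n + bool * bool)%type.

Lemma base_set_base : base_set (polar_line R, poles R n 3).
Proof.
split; [|exact: poles_unit|by left].
by exists (north R) => //; exact: north_unit.
Qed.

Definition base_pt : X := exist (fun p => p \in @base_set R n) _ (mem_set base_set_base).

Definition side (b : bool) (z : X * X) : V := set_val (if b then z.2 else z.1).

(** Positivity decides which motion applies: for a pair of points in a 3-sphere
    whether they avoid being antipodal, for a line whether its projector has a
    nonzero last or first diagonal entry. *)
Definition test_fun (k : K) (z : X * X) : R :=
  match k with
  | inl i => 1 + dot (row i (side false z).2) (row i (side true z).2)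
  | inr (b, c) => let j := if c then 0 else ord_max in (side b z).1 j j
  end.

Lemma contat_side b z : contat (side b) z.
Proof. by rewrite /side; case: b; cont. Qed.

Lemma test_fun_cont k : continuous (test_fun k).
Proof.
apply: contP => z; have c1 := @contat_side false z; have c2 := @contat_side true z.
case: k => [i|[b c]] /=; first by rewrite /test_fun; cont.
by have c3 := @contat_side b z; rewrite /test_fun; cont.
Qed.

(** A coordinate that does not vanish on the given line, the last one if possible, so
    that a line already at the base point does not move. *)
Definition chart (S : {set K}) (b : bool) : 'I_3 :=
  if inr (b, false) \notin S then ord_max
  else if inr (b, true) \notin S then 0 else 1.

Lemma proj_plane_trace (P : 'M[R]_3) : proj_plane P ->
  P 0 0 + P 1 1 + P ord_max ord_max = 1.
Proof.
move=> [s s1 ->]; rewrite !line_projE -s1 /dot !big_ord_recl big_ord0 addr0 addrA.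
by do ![congr (_ + _)]; congr (s _ _ * s _ _); apply: val_inj.
Qed.

(** If neither the last nor the first entry is known to be positive, both are below
    1/2, and the trace leaves something for the middle one. *)
Lemma chart_pos S b z : level_set test_fun S z ->
  0 < (side b z).1 (chart S b) (chart S b).
Proof.
move=> [_ H0 H1]; rewrite /chart.
case: ifPn => [nS|/negPn iS]; first exact: (H0 (inr (b, false))).
case: ifPn => [nS|/negPn iS']; first exact: (H0 (inr (b, true))).
have := H1 _ iS; have := H1 _ iS'; rewrite /=.
have [P1 _ _] : base_set (side b z) by apply: set_valP.
by have := proj_plane_trace P1; lra.
Qed.

Lemma chart_polar S b z : level_set test_fun S z ->
  (side b z).1 = polar_line R -> chart S b = ord_max.
Proof.
move=> [_ _ H1] e; rewrite /chart; case: ifPn => // /negPn /H1 /=.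
rewrite e /polar_line line_projE !mxE !eqxx mulr1 => {e H1} /= ?; exfalso; lra.
Qed.

Definition row_bits (S : {set K}) (i : 'I_n) : bool := inl i \in S.

Lemma row_bits_dom S z : level_set test_fun S z ->
  row_path_dom (row_bits S) (side false z).2 (side true z).2.
Proof.
move=> [_ H0 H1] i; rewrite /row_bits; case: ifPn => iS.
  by have := H1 _ iS; rewrite /=; lra.
by have := H0 _ iS; rewrite /=; lra.
Qed.

Definition leave S (z : X * X) (t : R) : V :=
  (line_path (chart S false) (side false z).1 t, (side false z).2).
Definition cross S (z : X * X) (t : R) : V :=
  (polar_line R, row_path (row_bits S) (side false z).2 (side true z).2 t).
Definition arrive S (z : X * X) (t : R) : V :=
  (line_path (chart S true) (side true z).1 (1 - t), (side true z).2).
(** Retract the line of the start to the base point, move in the product of spheres,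
    then undo the retraction of the line of the end.  Each leg stays in the wedge because a
    line at the base point does not move. *)
Definition itinerary S := concat (concat (leave S) (cross S)) (arrive S).

Lemma line_path_base S b z t : level_set test_fun S z ->
  base_set (line_path (chart S b) (side b z).1 t, (side b z).2).
Proof.
move=> LS; have [P1 v1 Pv] : base_set (side b z) by apply: set_valP.
split => //=; first exact/line_path_plane/chart_pos.
case: Pv => [->|e]; [by left|right].
by rewrite (chart_polar LS e) e line_path_polar.
Qed.

Lemma itinerary_in S z t : level_set test_fun S z -> base_set (itinerary S z t).
Proof.
move=> LS; apply: concat_in => r; last exact: line_path_base.
apply: concat_in => {}r; first exact: line_path_base.
have [_ v1 _] : base_set (side false z) by apply: set_valP.
have [_ v2 _] : base_set (side true z) by apply: set_valP.
split => /=; [|exact: row_path_unit (row_bits_dom LS) _|by right].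
by exists (north R) => //; exact: north_unit.
Qed.

Section Legs.
Variables (S : {set K}) (z : X * X) (T : topologicalType) (f : T -> X * X) (h : T -> R) (x : T).
Hypotheses (LS : level_set test_fun S z) (fz : f x = z) (cf : contat f x) (ch : contat h x).

Let cs b : contat (fun y => side b (f y)) x.
Proof. by apply: (contat_comp (g := side b)) => //; apply: contat_side. Qed.

Lemma contat_leg b (k : T -> R) : contat k x ->
  contat (fun y => (line_path (chart S b) (side b (f y)).1 (k y), (side b (f y)).2)) x.
Proof.
have [P1 _ _] : base_set (side b z) by apply: set_valP.
have c := @cs b; move=> ck; apply: contat_pair; last by cont.
by apply: (contat_line_path P1 (chart_pos b LS)) => //; [rewrite fz|cont].
Qed.

Lemma contat_cross : contat (fun y => cross S (f y) (h y)) x.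
Proof.
have [_ v1 _] : base_set (side false z) by apply: set_valP.
have [_ v2 _] : base_set (side true z) by apply: set_valP.
have c1 : contat (fun y => (side false (f y)).2) x by have c := @cs false; cont.
have c2 : contat (fun y => (side true (f y)).2) x by have c := @cs true; cont.
apply: contat_pair; first by cont.
apply: (contat_row_path v1 v2 (row_bits_dom LS) _ _ c1 c2 ch); by rewrite fz.
Qed.

End Legs.

Lemma contat_itinerary S z t : level_set test_fun S z ->
  contat (uncurry (itinerary S)) (z, t).
Proof.
move=> LS; have pos0 := chart_pos false LS; have pos1 := chart_pos true LS.
have [P1 v1 _] : base_set (side false z) by apply: set_valP.
have [P2 v2 _] : base_set (side true z) by apply: set_valP.
have e1 : leave S z 1 = cross S z 0.
  by rewrite /leave /cross line_path1 ?row_path0.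
have e2 : cross S z 1 = arrive S z 0.
  by rewrite /arrive /cross subr0 line_path1 ?row_path1.
apply: contat_concat; last by rewrite concat1.
  move=> r; apply: contat_concat => // {}r; apply: contat_uncurry.
    by apply: (contat_leg (z := z)); cont.
  by apply: (contat_cross (z := z)); cont.
by move=> r; apply: contat_uncurry; apply: (contat_leg (z := z)); cont.
Qed.

(** One test function for each 3-sphere and two for each of the two lines. *)
Theorem base_space_TC_upper : motion_planning_cover R X (n + 5).
Proof.
have -> : (n + 5 = #|{: K}|.+1)%N.
  by rewrite card_sum card_prod !card_bool card_ord addnS.
apply: (@merged_planners R X _ test_fun test_fun_cont
  (fun S z t => corestrict base_pt (itinerary S z t))).
  move=> S z t LS; apply/contat_uncurry/contat_corestrict.
    by apply: contat_uncurry_comp; [exact: contat_itinerary|cont|cont].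
  have : \forall p \near (z, t), level_set test_fun S p.1.
    have : contat (fun p : X * X * R => p.1) (z, t) by cont.
    by move=> /(_ _ (near_level_set test_fun_cont LS)).
  by apply: filterS => -[y r] /= LSy; apply: itinerary_in.
move=> S z LS.
have [P1 v1 _] : base_set (side false z) by apply: set_valP.
have [P2 v2 _] : base_set (side true z) by apply: set_valP.
rewrite /itinerary !concat0 concat1 /leave /arrive subrr.
rewrite !line_path0 ?(chart_pos _ LS) //.
have pE (p : V) : (p.1, p.2) = p by case: p.
by rewrite !pE !corestrict_val.
Qed.

End BaseUpper.

(** * A finite motion planning cover of the double cover *)

(** Contract the start to a common point, and reverse the contraction of the end. *)
Lemma TC_finite_of_contractions (R : realType) (X : topologicalType) (J : finType)
    (W : J -> set X) (C : J -> X -> R -> X) (x0 : X) :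
  (forall j, open (W j)) -> (forall x, exists j, W j x) ->
  (forall j x t, W j x -> contat (uncurry (C j)) (x, t)) ->
  (forall j x, W j x -> C j x 0 = x /\ C j x 1 = x0) ->
  motion_planning_cover R X #|{: J * J}|.
Proof.
move=> oW covW cC CE.
exists (fun k => let j := enum_val k in [set z | W j.1 z.1 /\ W j.2 z.2]); split.
- move=> k; set j := enum_val k; rewrite /=.
  have -> : [set z : X * X | W j.1 z.1 /\ W j.2 z.2] =
      (fst @^-1` W j.1) `&` (snd @^-1` W j.2) by [].
  by apply: openI; apply: open_comp => // z _; [apply: cvg_fst|apply: cvg_snd].
- rewrite -subTset => -[x y] _; have [j Wx] := covW x; have [j' Wy] := covW y.
  by exists (enum_rank (j, j')) => //=; rewrite enum_rankK.
- move=> k; set j := enum_val k => /=.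
  pose H (z : X * X) (t : R) := concat (fun z => C j.1 z.1) (fun z t => C j.2 z.2 (1 - t)) z t.
  apply: (planner_of_homotopy (H := H)).
    move=> z t [W1 W2]; apply: contat_concat.
    + move=> r; apply/contat_uncurry.
      by apply: contat_uncurry_comp; [exact: cC|cont|cont].
    + move=> r; apply/contat_uncurry.
      by apply: contat_uncurry_comp; [exact: cC|cont|cont].
    + by have [_ ->] := CE _ _ W1; rewrite subr0; have [_ ->] := CE _ _ W2.
  move=> z [W1 W2]; rewrite /H concat0 concat1 subrr.
  by have [-> _] := CE _ _ W1; have [-> _] := CE _ _ W2.
Qed.

Lemma near_lt_cst (R : realType) (T : topologicalType) (f : T -> R) (c : R) (x : T) :
  contat f x -> f x < c -> \forall y \near x, f y < c.
Proof. by move=> cf fc; apply: near_lt => //; cont. Qed.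

Lemma near_gt_cst (R : realType) (T : topologicalType) (f : T -> R) (c : R) (x : T) :
  contat f x -> c < f x -> \forall y \near x, c < f y.
Proof. by move=> cf fc; apply: near_lt => //; cont. Qed.

Section CoverFinite.
Variables (R : realType) (n : nat).
Local Notation V := ('rV[R]_3 * 'M[R]_(n, 4))%type.
Local Notation Xt := (set_type (@cover_set R n)).

Definition arc k (a b : 'rV[R]_k) (t : R) : 'rV[R]_k :=
  unitize ((1 - clamp t) *: a + clamp t *: b).

Section Arc.
Variables (k : nat) (a b : 'rV[R]_k).
Hypotheses (a1 : dot a a = 1) (b1 : dot b b = 1) (ab : -1 < dot a b).

Lemma arc_unit t : dot (arc a b t) (arc a b t) = 1.
Proof. by apply/unitize_unit/chord_neq0 => //; apply: clamp_itv. Qed.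

Lemma arc0 : arc a b 0 = a.
Proof. by rewrite /arc clamp0 subr0 scale1r scale0r addr0 unitize_id. Qed.

Lemma arc1 : arc a b 1 = b.
Proof. by rewrite /arc clamp1 subrr scale1r scale0r add0r unitize_id. Qed.

Lemma contat_arc (T : topologicalType) (f : T -> 'rV[R]_k) (h : T -> R) x :
  f x = a -> contat f x -> contat h x -> contat (fun y => arc (f y) b (h y)) x.
Proof.
move=> fa cf ch; apply: contat_unitize; last by cont.
by rewrite fa chord_neq0 //; apply: clamp_itv.
Qed.

End Arc.

Definition equator : 'rV[R]_3 := delta_mx 0 0.

Lemma equator_unit : dot equator equator = 1.
Proof.
by rewrite /dot !big_ord_recl big_ord0 !mxE /= !mulr0 mulr1 !addr0.
Qed.

Lemma equator_north : dot equator (north R) = 0.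
Proof. by rewrite dot_pole !mxE. Qed.

(** Contracts the sphere minus a pole to the north pole.  Away from the north pole the
    sphere first shrinks to the south pole, which is then carried along a meridian. *)
Definition to_north (b : bool) : 'rV[R]_3 -> R -> 'rV[R]_3 :=
  if b then concat (fun s => arc s (- north R))
             (concat (fun=> arc (- north R) equator) (fun=> arc equator (north R)))
  else fun s => arc s (north R).

Definition punctured (b : bool) (s : 'rV[R]_3) :=
  -1 < dot s (if b then - north R else north R).

Lemma to_north_spec b s t : dot s s = 1 -> punctured b s ->
  [/\ dot (to_north b s t) (to_north b s t) = 1, to_north b s 0 = s,
      to_north b s 1 = north R & contat (uncurry (to_north b)) (s, t)].
Proof.
have N1 := north_unit R; have E1 := equator_unit; have EN := equator_north.
have N1' : dot (- north R) (- north R) = 1 by rewrite dotNl dotNr opprK.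
have d1 : -1 < dot (- north R) equator by rewrite dotNl dotC EN oppr0; lra.
have d2 : -1 < dot equator (north R) by rewrite EN; lra.
move=> s1; rewrite /punctured /to_north; case: b => d; last first.
  split; [exact: arc_unit|exact: arc0|exact: arc1|].
  by apply/contat_uncurry/(contat_arc s1 N1 d) => //; cont.
split.
- apply: (@concat_in R _ _ [set v | dot v v = 1]) => r /=; first exact: arc_unit.
  by apply: (@concat_in R _ _ [set v | dot v v = 1]) => ? /=; apply: arc_unit.
- by rewrite concat0 arc0.
- by rewrite !concat1 arc1.
- apply: contat_concat; last by rewrite arc1 // concat0 arc0.
    by move=> r; apply/contat_uncurry/(contat_arc s1 N1' d) => //; cont.
  move=> r; apply: contat_concat; last by rewrite arc1 // arc0.
    by move=> ?; apply/contat_uncurry/(contat_arc N1' E1 d1) => //; cont.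
  by move=> ?; apply/contat_uncurry/(contat_arc E1 N1 d2) => //; cont.
Qed.

Local Notation J := ({set 'I_n} * bool)%type.

(** Rows are moved to the pole first, while the point of the 2-sphere rests; the
    point of the 2-sphere moves once all rows are there. *)
Definition retract_rows (S : {set 'I_n}) (p : V) (t : R) : V :=
  (p.1, row_path (fun i => i \in S) p.2 (poles R n 3) t).
Definition retract_sphere (b : bool) (p : V) (t : R) : V :=
  (to_north b p.1 t, poles R n 3).

Definition cover_piece (j : J) : set Xt :=
  [set x | row_path_dom (fun i => i \in j.1) (set_val x).2 (poles R n 3) /\
           punctured j.2 (set_val x).1].

Definition cover_contraction (j : J) (x : Xt) (t : R) : Xt :=
  corestrict (cover_base R n) (concat (retract_rows j.1) (retract_sphere j.2) (set_val x) t).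

Lemma near_cover_piece j x : cover_piece j x -> \forall y \near x, cover_piece j y.
Proof.
move=> [H1 H2].
have n1 : \forall y \near x, row_path_dom (fun i => i \in j.1) (set_val y).2 (poles R n 3).
  apply: (@filter_forall _ _ (fun i (y : Xt) => if i \in j.1 then
     dot (row i (set_val y).2) (row i (poles R n 3)) < - (1 / 2)
     else -1 < dot (row i (set_val y).2) (row i (poles R n 3)))
     (nbhs x) (nbhs_filter x)) => i.
  have ci : contat (fun y : Xt => dot (row i (set_val y).2) (row i (poles R n 3))) x by cont.
  by have := H1 i; case: ifP => _ H; [exact: (near_lt_cst ci H)|exact: (near_gt_cst ci H)].
have n2 : \forall y \near x, punctured j.2 (set_val y).1.
  have cp : contat (fun y : Xt => dot (set_val y).1 (if j.2 then - north R else north R)) x.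
    by cont.
  exact: (near_gt_cst cp H2).
exact: nbhs_subI n1 n2 _.
Qed.

Lemma cover_contraction_in j x t : cover_piece j x ->
  cover_set (concat (retract_rows j.1) (retract_sphere j.2) (set_val x) t).
Proof.
move=> [H1 H2]; have [s1 v1 sv] : cover_set (set_val x) by apply: set_valP.
apply: concat_in => r.
  split => //=; first exact: (row_path_unit v1 (@poles_unit R n 3) H1).
  case: sv => [e|]; [left|by right].
  rewrite e row_path_id //; first exact: poles_unit.
  move=> i; apply/negbTE/negP => iS; have := H1 i; rewrite iS e row_poles pole_unit.
  lra.
have [u1 _ _ _] := to_north_spec r s1 H2.
by split => //=; [exact: poles_unit|left].
Qed.

Lemma cover_piece_cover (x : Xt) : exists j, cover_piece j x.
Proof.
have [s1 v1 _] : cover_set (set_val x) by apply: set_valP.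
pose S : {set 'I_n} := finset (fun i =>
  dot (row i (set_val x).2) (row i (poles R n 3)) < - (1 / 2)).
exists (S, ~~ (-1 < dot (set_val x).1 (north R))); split => /=.
  by move=> i; rewrite inE; case: ifPn => //; rewrite -leNgt; lra.
rewrite /punctured; case: (boolP (-1 < dot (set_val x).1 (north R))) => //=.
by rewrite -leNgt dotNr; lra.
Qed.

Lemma cover_contraction_continuous j x t : cover_piece j x ->
  contat (uncurry (cover_contraction j)) (x, t).
Proof.
move=> jx; apply/contat_uncurry/contat_corestrict; last first.
  have : \forall p \near (x, t), cover_piece j p.1.
    have : contat (fun p : Xt * R => p.1) (x, t) by cont.
    by move=> /(_ _ (near_cover_piece jx)).
  by apply: filterS => -[y r] /= jy; apply: cover_contraction_in.
have [H1 H2] := jx; have [s1 v1 sv] : cover_set (set_val x) by apply: set_valP.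
apply: contat_uncurry_comp; [|by cont|by cont].
apply: contat_concat.
- move=> r; apply/contat_uncurry/contat_pair; first by cont.
  by apply: (contat_row_path v1 (@poles_unit R n 3) H1) => //; cont.
- move=> r; apply/contat_uncurry/contat_pair; last by cont.
  have [_ _ _ c] := to_north_spec r s1 H2.
  by apply: contat_uncurry_comp; [exact: c|cont|cont].
- rewrite /retract_rows /retract_sphere row_path1; last exact: poles_unit.
  by have [_ -> _ _] := to_north_spec 0 s1 H2.
Qed.

Lemma cover_contraction_ends j x : cover_piece j x ->
  cover_contraction j x 0 = x /\ cover_contraction j x 1 = cover_base R n.
Proof.
move=> [H1 H2]; have [s1 v1 sv] : cover_set (set_val x) by apply: set_valP.
rewrite /cover_contraction concat0 concat1 /retract_rows /retract_sphere.
rewrite row_path0 //.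
have [_ _ -> _] := to_north_spec 0 s1 H2; split.
  by rewrite -[RHS](corestrict_val (cover_base R n)); congr corestrict; case: (set_val x).
rewrite -[RHS](corestrict_val (cover_base R n)); congr corestrict.
by rewrite -[RHS]/((-1) ^+ nat_of_bool false *: north R, poles R n 3) expr0 scale1r.
Qed.

Lemma cover_space_TC_finite : exists k, motion_planning_cover R Xt k.
Proof.
exists #|{: J * J}|.
apply: (@TC_finite_of_contractions R Xt J cover_piece cover_contraction (cover_base R n)).
- by move=> j; rewrite openE => x; apply: near_cover_piece.
- exact: cover_piece_cover.
- by move=> j x t; apply: cover_contraction_continuous.
- by move=> j x; apply: cover_contraction_ends.
Qed.

End CoverFinite.

(** * Quotients by free involutions *)

Section FreeInvolution.
Variables (E B : topologicalType) (p : E -> B) (tau : E -> E).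
Hypotheses (cE : compact [set: E]) (hE : hausdorff_space E) (hB : hausdorff_space B).
Hypotheses (cp : continuous p) (ctau : continuous tau).
Hypotheses (p_surj : forall b, exists e, p e = b)
  (p_tau : forall e, p (tau e) = p e)
  (p_fibre : forall e e', p e = p e' -> e' = e \/ e' = tau e)
  (tau_free : forall e, tau e <> e).

Let tauK e : tau (tau e) = e.
Proof.
have [//|/tau_free//] := p_fibre (esym (etrans (p_tau (tau e)) (p_tau e))).
Qed.

(** The complement of the saturation of an open set is compact, and so is its image. *)
Lemma quotient_map_open (V : set E) : open V -> open (p @` V).
Proof.
move=> oV.
have clV : closed (~` (V `|` tau @^-1` V)).
  by rewrite closedC; apply: openU => //; apply: open_comp => // e _; apply: ctau.
have -> : p @` V = ~` (p @` (~` (V `|` tau @^-1` V))).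
  apply/seteqP; split => b.
    move=> [e Ve <-] [e' nV e'e]; apply: nV.
    have [->|->] := p_fibre (esym e'e); first by left.
    by right; rewrite /= tauK.
  move=> nb; have [e eb] := p_surj b.
  have [Ve|nVe] := pselect ((V `|` tau @^-1` V) e); last first.
    by case: nb; exists e.
  by case: Ve => Ve; [exists e|exists (tau e) => //; rewrite p_tau].
rewrite openC; apply: compact_closed => //; apply: continuous_compact.
  exact: continuous_subspaceT.
exact: (subclosed_compact clV cE).
Qed.

Lemma sheet_homeomorphism (V : set E) (U : set B) :
  open V -> (forall e, V e -> ~ V (tau e)) -> p @` V = U ->
  exists f : V -> U, is_homeomorphism f /\ forall e : V, set_val (f e) = p (set_val e).
Proof.
move=> oV Vtau <-.
have fP (e : V) : (p @` V) (p (set_val e)) by exists (set_val e) => //; apply: set_valP.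
pose f (e : V) : p @` V := exist (fun b => b \in p @` V) _ (mem_set (fP e)).
have /choice[g gP] : forall b : p @` V, exists e : V, p (set_val e) = set_val b.
  move=> b; have [e Ve eb] := set_valP b.
  by exists (exist (fun e => e \in V) e (mem_set Ve)).
have inj (e e' : V) : p (set_val e) = p (set_val e') -> e = e'.
  move=> /p_fibre[|] h; apply: val_inj => /=; first by rewrite -!set_valE h.
  by have := Vtau _ (set_valP e); rewrite -h => /(_ (set_valP e')).
exists f; split => //; split.
  apply: contP => e; apply: contat_sub; apply: (contat_comp (g := p)).
    exact: contE.
  by cont.
exists g; split.
- apply: contP => b O [_ [[P oP <-] /= Pb PO]].
  have oPV : open (p @` (P `&` V)) by apply: quotient_map_open; apply: openI.
  have nb : nbhs (set_val b) (p @` (P `&` V)).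
    apply: open_nbhs_nbhs; split => //; exists (set_val (g b)); last exact: gP.
    by split => //; apply: set_valP.
  have cv : contat (fun y : p @` V => set_val y) b by cont.
  refine (@filterS _ _ (nbhs_filter b) _ (g @^-1` O) _ (cv _ nb)).
  move=> b' [e [Pe Ve] eb']; apply: PO => /=.
  have -> : g b' = exist (fun e => e \in V) e (mem_set Ve) by apply: inj; rewrite gP.
  exact: Pe.
- by move=> e; apply: inj; rewrite gP.
- by move=> b; apply: val_inj; apply: gP.
Qed.

(** Separate a point from its image by open sets; the part of the first set sent into
    the second is disjoint from its own image, and both are sheets. *)
Lemma free_involution_covering : is_covering_map p.
Proof.
split => //; first by move=> b _; have [e eb] := p_surj b; exists e.
move=> b; have [e eb] := p_surj b.
have := hE; rewrite open_hausdorff => /(_ e (tau e)).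
case=> [|[P Q] /= [/set_mem Pe /set_mem Qt] [oP oQ /eqP PQ]].
  by apply/eqP => h; apply: (@tau_free e).
have otau W : open W -> open (tau @^-1` W).
  by move=> oW; apply: open_comp => // y _; apply: ctau.
pose V := P `&` tau @^-1` Q.
have oV : open V by apply: openI => //; apply: otau.
have Vtau y : V y -> ~ V (tau y).
  by move=> [_ Qy] [Py _]; have : (P `&` Q) (tau y) by []; rewrite PQ.
have pW : p @` (tau @^-1` V) = p @` V.
  apply/seteqP; split => _ [y Vy <-]; first by exists (tau y) => //; rewrite p_tau.
  by exists (tau y); rewrite ?p_tau //= tauK.
exists (p @` V); split; [exact: quotient_map_open|by exists e|].
exists bool, (fun c : bool => if c then V else tau @^-1` V); split.
- by case => //; apply: otau.
- by move=> [] [] _ _ // [y [/= h h']]; have := Vtau _ h => //; have := Vtau _ h'.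
- apply/seteqP; split => y.
    move=> [z Vz zy]; have [->|->] := p_fibre zy; first by exists true.
    by exists false => //=; rewrite tauK.
  by move=> [[] _ Vy]; [exists y|exists (tau y); rewrite ?p_tau].
- case; first exact: sheet_homeomorphism.
  apply: sheet_homeomorphism => //; first exact: otau.
  by move=> y /= Vy; apply: Vtau.
Qed.

Lemma free_involution_two_to_one : two_to_one p.
Proof.
move=> b; have [e eb] := p_surj b; apply/card_set_bijP.
have fib y : p y = b -> y = e \/ y = tau e by move=> yb; apply: p_fibre; rewrite eb yb.
exists (fun y => nat_of_bool `[< y = e >]); split.
- by move=> y _ /=; case: asboolP.
- move=> y z /set_mem /fib hy /set_mem /fib hz.
  case: asboolP => [->|ny]; case: asboolP => [->|nz] //=.
  by case: hy => // ->; case: hz.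
- move=> [|[|//]] _; [exists (tau e)|exists e] => //=.
  + by rewrite p_tau.
  + by case: asboolP => // /tau_free.
  + by case: asboolP.
Qed.

End FreeInvolution.

Lemma prod_hausdorff (T U : topologicalType) :
  hausdorff_space T -> hausdorff_space U -> hausdorff_space (T * U)%type.
Proof.
move=> hT hU [a b] [c d] cl; congr (_, _).
  apply: hT => A B Aa Bc; have [] := cl (fst @^-1` A) (fst @^-1` B).
  - exact: (@cvg_fst _ _ (nbhs a) (nbhs b) _ _ Aa).
  - exact: (@cvg_fst _ _ (nbhs c) (nbhs d) _ _ Bc).
  - by move=> z [/= Az Bz]; exists z.1.
apply: hU => A B Ab Bd; have [] := cl (snd @^-1` A) (snd @^-1` B).
- exact: (@cvg_snd _ _ (nbhs a) (nbhs b) _ _ Ab).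
- exact: (@cvg_snd _ _ (nbhs c) (nbhs d) _ _ Bd).
- by move=> z [/= Az Bz]; exists z.2.
Qed.

Lemma unit_sphere_compact (R : realType) k : compact [set s : 'rV[R]_k | dot s s = 1].
Proof.
apply: mx_compact; first by apply: closed_eq; apply: contP => s; cont.
move=> M i j /= S1; rewrite (ord1 i).
have := coord_le_dot M j; rewrite S1 -real_normK ?num_real // => H.
by rewrite -(@ler_pXn2r _ 2) ?nnegrE // expr1n.
Qed.

Section CoverMap.
Variables (R : realType) (n : nat).
Local Notation X := (set_type (@base_set R n)).
Local Notation Xt := (set_type (@cover_set R n)).

Lemma contat_line_proj (T : topologicalType) k (f : T -> 'rV[R]_k) x :
  contat f x -> contat (fun y => line_proj (f y)) x.
Proof. by move=> cf; rewrite /line_proj; cont. Qed.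

Lemma closed_mx_eq (T : topologicalType) k l (f g : T -> 'M[R]_(k, l)) :
  continuous f -> continuous g -> closed [set x | f x = g x].
Proof.
move=> cf cg; have -> : [set x | f x = g x] = [set x | forall i j, f x i j = g x i j].
  apply/seteqP; split => x /=; first by move=> ->.
  by move=> h; apply/matrixP.
by apply: closed_forall => i; apply: closed_forall => j; apply: closed_eq; apply: contP => x;
  apply: contat_coord; apply: contE.
Qed.

Lemma cover_set_compact : compact (@cover_set R n).
Proof.
pose S : set 'rV[R]_3 := [set s | dot s s = 1].
have cS : compact S by apply: unit_sphere_compact.
have cK : compact (S `*` @unit_rows R n 4) by apply: compact_setX => //; apply: unit_rows_compact.
have -> : @cover_set R n = (S `*` @unit_rows R n 4) `&`
    [set p | p.2 = poles R n 3 \/ line_proj p.1 = polar_line R].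
  by apply/seteqP; split => -[s y] /=; [move=> [? ? ?]|move=> [[? ?] ?]].
apply: (subclosed_compact _ cK) => //; apply: closedI.
  by apply: compact_closed => //; apply: prod_hausdorff; apply: mx_hausdorff.
apply: closedU; apply: closed_mx_eq; apply: contP => p; cont.
by apply: contat_line_proj; cont.
Qed.

Definition cover_map (x : Xt) : X :=
  corestrict (base_pt R n) (line_proj (set_val x).1, (set_val x).2).

Definition antipode (x : Xt) : Xt :=
  corestrict (cover_base R n) (- (set_val x).1, (set_val x).2).

Lemma cover_map_in (x : Xt) : base_set (line_proj (set_val x).1, (set_val x).2).
Proof.
have [s1 y1 sy] : cover_set (set_val x) by apply: set_valP.
by split => //=; exists (set_val x).1.
Qed.

Lemma antipode_in (x : Xt) : cover_set (- (set_val x).1, (set_val x).2).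
Proof.
have [s1 y1 sy] : cover_set (set_val x) by apply: set_valP.
by split => //=; rewrite ?line_projN // dotNl dotNr opprK.
Qed.

Lemma cover_mapE x : set_val (cover_map x) = (line_proj (set_val x).1, (set_val x).2).
Proof. exact: corestrictK (cover_map_in x). Qed.

Lemma antipodeE x : set_val (antipode x) = (- (set_val x).1, (set_val x).2).
Proof. exact: corestrictK (antipode_in x). Qed.

Lemma cover_map_continuous : continuous cover_map.
Proof.
apply: contP => x; apply: contat_corestrictT; last exact: cover_map_in.
by apply: contat_pair; [apply: contat_line_proj|]; cont.
Qed.

Lemma antipode_continuous : continuous antipode.
Proof.
by apply: contP => x; apply: contat_corestrictT; [cont|exact: antipode_in].
Qed.

Lemma cover_map_covering : is_covering_map cover_map /\ two_to_one cover_map.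
Proof.
have surj b : exists e, cover_map e = b.
  have [[s s1 Ps] y1 sy] : base_set (set_val b) by apply: set_valP.
  have es : cover_set (s, (set_val b).2) by split => //=; rewrite -Ps.
  exists (exist (fun p => p \in @cover_set R n) _ (mem_set es)).
  apply: val_inj; rewrite -!set_valE cover_mapE /=.
  by rewrite -Ps; case: (set_val b).
have inv e : cover_map (antipode e) = cover_map e.
  by apply: val_inj; rewrite -!set_valE !cover_mapE antipodeE /= line_projN.
have fibre e e' : cover_map e = cover_map e' -> e' = e \/ e' = antipode e.
  move=> /(congr1 set_val); rewrite !cover_mapE => -[es ey].
  have [s1 _ _] : cover_set (set_val e) by apply: set_valP.
  have [s1' _ _] : cover_set (set_val e') by apply: set_valP.
  have pE (p : 'rV[R]_3 * 'M[R]_(n, 4)) : p = (p.1, p.2) by case: p.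
  have [E|E] := line_proj_eq s1 s1' es; [left|right]; apply: val_inj; rewrite -!set_valE ?antipodeE.
    by rewrite [LHS]pE E -ey -pE.
  by rewrite [LHS]pE E -ey.
have free e : antipode e <> e.
  move=> /(congr1 set_val); rewrite antipodeE => /(congr1 fst) /= E.
  have [s1 _ _] : cover_set (set_val e) by apply: set_valP.
  have : dot (set_val e).1 (- (set_val e).1) = 1 by rewrite E.
  by rewrite dotNr s1; lra.
have cXt : compact [set: Xt] by apply/set_type_compact/cover_set_compact.
have hXt : hausdorff_space Xt.
  by apply/set_type_hausdorff/prod_hausdorff; apply: mx_hausdorff.
have hX : hausdorff_space X.
  by apply/set_type_hausdorff/prod_hausdorff; apply: mx_hausdorff.
split; last exact: (free_involution_two_to_one surj inv fibre free).
exact: (free_involution_covering cXt hXt hX cover_map_continuous antipode_continuous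
  surj inv fibre free).
Qed.

End CoverMap.

(** * Neighbourhood retracts *)

(** A retraction of the open set [O] onto [A], given as a self-map of the ambient
    space of which only the values on [O] matter. *)
Definition nbhd_retraction (T : topologicalType) (A O : set T) (r : T -> T) :=
  [/\ open O, A `<=` O, forall x, O x -> contat r x /\ A (r x) & forall x, A x -> r x = x].

Lemma enorm0 (R : realType) k : enorm (0 : 'rV[R]_k) = 0.
Proof. by apply/eqP; rewrite enorm_eq0. Qed.

Section Transport.
Variables (R : realType) (a b c d : nat).
Local Notation V := ('M[R]_(a, b) * 'M[R]_(c, d))%type.

Definition flatten_pair (p : V) : 'rV[R]_(a * b + c * d) := row_mx (mxvec p.1) (mxvec p.2).
Definition unflatten_pair (v : 'rV[R]_(a * b + c * d)) : V :=
  (vec_mx (lsubmx v), vec_mx (rsubmx v)).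

Lemma flatten_pairK p : unflatten_pair (flatten_pair p) = p.
Proof. by case: p => p q; rewrite /unflatten_pair row_mxKl row_mxKr !mxvecK. Qed.

Lemma unflatten_pairK v : flatten_pair (unflatten_pair v) = v.
Proof. by rewrite /flatten_pair /= !vec_mxK hsubmxK. Qed.

Lemma contat_flatten_pair (T : topologicalType) (f : T -> V) x :
  contat f x -> contat (fun y => flatten_pair (f y)) x.
Proof. by move=> cf; rewrite /flatten_pair; cont. Qed.

Lemma contat_unflatten_pair (T : topologicalType) (f : T -> 'rV[R]_(a * b + c * d)) x :
  contat f x -> contat (fun y => unflatten_pair (f y)) x.
Proof. by move=> cf; rewrite /unflatten_pair; cont. Qed.

Lemma ENR_of_retraction (A O : set V) r : nbhd_retraction A O r -> is_ENR R (set_type A).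
Proof.
move=> [oO AO rO rA].
have pull (W : set V) : open W -> open (unflatten_pair @^-1` W).
  move=> oW; apply: open_comp => // v _; apply: (@contat_unflatten_pair _ (fun v => v)).
  exact: contat_id.
exists _, (unflatten_pair @^-1` A), (unflatten_pair @^-1` O); split.
- have H1 (x : A) : (unflatten_pair @^-1` A) (flatten_pair (set_val x)).
    by rewrite /= flatten_pairK; apply: set_valP.
  have H2 (y : unflatten_pair @^-1` A) : A (unflatten_pair (set_val y)) by apply: (set_valP y).
  exists (fun x => exist (fun v => v \in unflatten_pair @^-1` A) _ (mem_set (H1 x))); split.
    by apply: contP => x; apply: contat_sub; apply: contat_flatten_pair; cont.
  exists (fun y => exist (fun p => p \in A) _ (mem_set (H2 y))); split.
  + by apply: contP => x; apply: contat_sub; apply: contat_unflatten_pair; cont.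
  + by move=> x; apply: val_inj; apply: flatten_pairK.
  + by move=> x; apply: val_inj; apply: unflatten_pairK.
- exact: pull.
- by move=> v /= /AO.
- have H (x : unflatten_pair @^-1` O) :
      (unflatten_pair @^-1` A) (flatten_pair (r (unflatten_pair (set_val x)))).
    by rewrite /= flatten_pairK; have [] := rO _ (set_valP x).
  exists (fun x => exist (fun v => v \in unflatten_pair @^-1` A) _ (mem_set (H x))); split.
    apply: contP => x; apply: contat_sub; apply: contat_flatten_pair.
    apply: (contat_comp (g := r)); first by have [] := rO _ (set_valP x).
    by apply: contat_unflatten_pair; cont.
  by move=> x Ax; rewrite set_valE /= (rA _ Ax) unflatten_pairK.
Qed.

Lemma contat_squeeze0 (T : topologicalType) k l (m : T -> R) (f : T -> 'M[R]_(k, l)) x :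
  (forall y, 0 <= m y <= 1) -> f x = 0 -> contat f x -> contat (fun y => m y *: f y) x.
Proof.
move=> m01 f0 cf; apply: contat_mx => i j.
have c1 : contat (fun y => `|f y i j|) x by apply: contat_norm; cont.
have c2 : contat (fun y => - `|f y i j|) x by cont.
rewrite /contat f0 scaler0 mxE.
move: c1 c2; rewrite /contat f0 mxE normr0 oppr0 => c1 c2.
apply: (squeeze_cvgr _ c2 c1); apply: nearW => y; rewrite mxE -ler_norml normrM.
have /andP[m0 m1] := m01 y; rewrite -[leRHS]mul1r ler_wpM2r // ger0_norm //.
Qed.

Section Wedge.
Variables (A A0 OA : set 'M[R]_(a, b)) (rA center : 'M[R]_(a, b) -> 'M[R]_(a, b)).
Variables (B OB : set 'M[R]_(c, d)) (rB : 'M[R]_(c, d) -> 'M[R]_(c, d)) (b0 : 'M[R]_(c, d)).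
Hypotheses (retA : nbhd_retraction A OA rA) (retB : nbhd_retraction B OB rB) (Bb0 : B b0).
Hypotheses (c_center : continuous center) (center_A0 : forall u, A0 u -> center u = u)
  (center_in : forall u, OA (center u) -> A0 (rA (center u))).

Let rho (p : V) : R := enorm (mxvec (p.1 - center p.1)).
Let sigma (p : V) : R := enorm (mxvec (p.2 - b0)).
Let t1 p := clamp (1 - sigma p / rho p).
Let t2 p := clamp (1 - rho p / sigma p).

(** The pair is drawn towards the wedge: the factor closer to its center is moved
    onto it, the other one part of the way. *)
Let pinch (p : V) : V :=
  (center p.1 + t1 p *: (p.1 - center p.1), b0 + t2 p *: (p.2 - b0)).

Let contat_rho p : contat rho p.
Proof.
have cc : contat (fun p : V => center p.1) p.
  by apply: (contat_comp (g := center)); [exact: contE|cont].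
by rewrite /rho; cont.
Qed.

Let contat_sigma p : contat sigma p. Proof. by rewrite /sigma; cont. Qed.

Let mx0 k l (M : 'M[R]_(k, l)) : enorm (mxvec M) = 0 -> M = 0.
Proof. by move/eqP; rewrite enorm_eq0 => /eqP e; rewrite -[M]mxvecK e linear0. Qed.

Let contat_pinch p : contat pinch p.
Proof.
have c1 := @contat_rho p; have c2 := @contat_sigma p.
have cc : contat (fun p : V => center p.1) p.
  by apply: (contat_comp (g := center)); [exact: contE|cont].
apply: contat_pair.
  apply: contat_mxD => //; have [r0|r0] := eqVneq (rho p) 0.
    apply: contat_squeeze0; [by move=> y; apply: clamp_itv|exact: mx0|by cont].
  apply: contat_mxZ; last by cont.
  by have cV := contatV r0 c1; rewrite /t1; cont.
apply: contat_mxD; first by cont.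
have [r0|r0] := eqVneq (sigma p) 0.
  apply: contat_squeeze0; [by move=> y; apply: clamp_itv|exact: mx0|by cont].
apply: contat_mxZ; last by cont.
by have cV := contatV r0 c2; rewrite /t2; cont.
Qed.

(** Apply the two retractions after pinching.  At the wedge point the pinching factors
    are discontinuous, but they multiply vectors that tend to zero. *)
Lemma wedge_ENR : is_ENR R (set_type [set p : V | [/\ A p.1, B p.2 & p.2 = b0 \/ A0 p.1]]).
Proof.
have [oA AO rOA rAA] := retA; have [oB BO rOB rBB] := retB.
have rho0 p : 0 <= rho p by apply: enorm_ge0.
have sigma0 p : 0 <= sigma p by apply: enorm_ge0.
have pinchE p : p.2 = b0 \/ A0 p.1 -> pinch p = p.
  case: p => u v /= [->|Au].
    rewrite /pinch /t1 /sigma /= subrr linear0 enorm0 ?mul0r subr0 clamp1 scale1r.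
    by rewrite scaler0 addr0 addrC subrK.
  have r0 : rho (u, v) = 0 by rewrite /rho /= center_A0 // subrr linear0 enorm0.
  rewrite /pinch /t2 r0 mul0r subr0 clamp1 scale1r /= center_A0 // subrr scaler0 addr0.
  by rewrite addrC subrK.
apply: (@ENR_of_retraction _ (pinch @^-1` (OA `*` OB)) (fun p => (rA (pinch p).1, rB (pinch p).2))).
split.
- have -> : pinch @^-1` (OA `*` OB) =
      (fun p => (pinch p).1) @^-1` OA `&` (fun p => (pinch p).2) @^-1` OB by [].
  have cp := @contat_pinch; apply: openI.
    by apply: open_comp => // p _; apply: (contat_fst (cp p)).
  by apply: open_comp => // p _; apply: (contat_snd (cp p)).
- move=> p [Ap Bp /pinchE e]; change ((OA `*` OB) (pinch p)); rewrite e.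
  by split; [apply: AO|apply: BO].
- move=> p [OAp OBp]; have [cA Ap] := rOA _ OAp; have [cB Bp] := rOB _ OBp.
  have cp := @contat_pinch p; split.
    apply: contat_pair; [apply: (contat_comp (g := rA))|apply: (contat_comp (g := rB))] => //.
      exact: (contat_fst cp).
    exact: (contat_snd cp).
  split => //=; have [le|lt] := leP (rho p) (sigma p).
    right; have [s0|s0] := eqVneq (sigma p) 0.
      have r0 : p.1 - center p.1 = 0 by apply: mx0; apply/eqP; rewrite eq_le rho0 -s0 le.
      by move: OAp; rewrite /= r0 scaler0 addr0; apply: center_in.
    have [r0|r0] := eqVneq (rho p) 0.
      have {}r0 : p.1 - center p.1 = 0 by apply: mx0.
      by move: OAp; rewrite /= r0 scaler0 addr0; apply: center_in.
    have t0 : t1 p = 0.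
      rewrite /t1 clamp_le0 // subr_le0 ler_pdivlMr ?mul1r //.
      by rewrite lt0r r0 rho0.
    by move: OAp; rewrite /= t0 scale0r addr0; apply: center_in.
  left; have [s0|s0] := eqVneq (sigma p) 0.
    by rewrite (mx0 s0) scaler0 addr0 rBB.
  have t0 : t2 p = 0.
    rewrite /t2 clamp_le0 // subr_le0 ler_pdivlMr ?mul1r; first exact: ltW.
    by rewrite lt0r s0 sigma0.
  by rewrite t0 scale0r addr0 rBB.
- by move=> p [Ap Bp /pinchE e]; rewrite e rAA // rBB //; case: (p).
Qed.

End Wedge.
End Transport.

Lemma unit_rows_retraction (R : realType) n k : nbhd_retraction (@unit_rows R n k)
  [set M | forall i, row i M != 0] (fun M => \matrix_i unitize (row i M)).
Proof.
split.
- rewrite openE => M /= M0.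
  apply: (@filter_forall _ _ (fun i (N : 'M[R]_(n, k)) => row i N != 0) (nbhs M) (nbhs_filter M)) => i.
  have cd : contat (fun N : 'M[R]_(n, k) => dot (row i N) (row i N)) M by cont.
  have := near_gt_cst cd (_ : 0 < dot (row i M) (row i M)); rewrite dot_gt0 => /(_ (M0 i)).
  by apply: filterS => N; rewrite dot_gt0.
- by move=> M M1 i; apply: unit_neq0.
- move=> M M0; split; last by move=> i; rewrite rowK unitize_unit.
  by apply: contat_matrix_rows => i; apply: contat_unitize => //; cont.
- by move=> M M1; apply/row_matrixP => i; rewrite rowK unitize_id.
Qed.

Lemma sphere_retraction (R : realType) k : nbhd_retraction
  [set s : 'rV[R]_k | dot s s = 1] [set s | s != 0] (@unitize R k).
Proof.
split.
- have -> : [set s : 'rV[R]_k | s != 0] = [set s | 0 < dot s s].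
    by apply/seteqP; split => s /=; rewrite dot_gt0.
  by apply: open_lt; apply: contP => s; cont.
- by move=> s; apply: unit_neq0.
- by move=> s s0; split; [apply: contat_unitize => //; cont|apply: unitize_unit].
- by move=> s; apply: unitize_id.
Qed.

Section ProjPlane.
Variable R : realType.
Implicit Types (M P Q : 'M[R]_3) (s t w : 'rV[R]_3).

Definition near_projector M := exists2 P, proj_plane P & forall i j, `|M i j - P i j| < 1 / 10.

(** The projectors of rank one that are nearest to [M], their distance to [M] being a
    decreasing function of this trace. *)
Definition best_projector M P :=
  proj_plane P /\ forall Q, proj_plane Q -> \tr (M *m Q) <= \tr (M *m P).

Definition qform M w : R := dot (w *m M) w.

Lemma trace_line_proj M s : \tr (M *m line_proj s) = qform M s.
Proof.
rewrite /line_proj mulmxA mxtrace_mulC mulmxA /qform /mxtrace big_ord1 mxE.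
by apply: eq_bigr => i _; rewrite [s^T _ _]mxE.
Qed.

Lemma qform_line_proj s w : qform (line_proj s) w = dot w s ^+ 2.
Proof.
have -> : qform (line_proj s) w = dot (dot w s *: s) w.
  congr dot; rewrite /line_proj mulmxA; apply/rowP => j; rewrite !mxE big_ord1.
  by congr (_ * _); rewrite mxE; apply: eq_bigr => i _; rewrite mxE.
by rewrite dotZl (dotC s) expr2.
Qed.

Lemma qform_small (E : 'M[R]_3) w (e : R) :
  (forall i j, `|E i j| < e) -> `|qform E w| <= 3 * e * dot w w.
Proof.
move=> Ee; have -> : qform E w = \sum_j \sum_i w 0 i * E i j * w 0 j.
  by apply: eq_bigr => j _; rewrite mxE mulr_suml.
have -> : 3 * e * dot w w = \sum_(j < 3) \sum_(i < 3) e * ((w 0 i ^+ 2 + w 0 j ^+ 2) / 2).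
  by rewrite /dot !big_ord_recl !big_ord0; field.
apply: le_trans (ler_norm_sum _ _ _) _; apply: ler_sum => j _.
apply: le_trans (ler_norm_sum _ _ _) _; apply: ler_sum => i _.
rewrite !normrM -(real_normK (num_real (w 0 i))) -(real_normK (num_real (w 0 j))).
have := normr_ge0 (w 0 i); have := normr_ge0 (w 0 j); have := ltW (Ee i j).
have := normr_ge0 (E i j).
move: (`|w 0 i|) (`|w 0 j|) (`|E i j|) => x y z z0 ze y0 x0.
have h1 : 0 <= (e - z) * (x * y) by rewrite !mulr_ge0 // subr_ge0.
have h2 : 0 <= e * (x - y) ^+ 2 by rewrite mulr_ge0 ?sqr_ge0 //; lra.
by nra.
Qed.

(** Let [s] and [t] be maximisers of the quadratic form of [M], of value [l].  Then
    [l |w|^2 - M(w)] is nonnegative and vanishes on the span of [s] and [t].  That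
    span contains a vector orthogonal to the axis of the nearby projector, where the
    form of [M] is small, whereas [l] is close to 1; so the vector is zero and [s], [t]
    are proportional. *)
Lemma best_projector_unique M P Q : near_projector M ->
  best_projector M P -> best_projector M Q -> P = Q.
Proof.
move=> [P0 [s0 s01 P0E] ME] [[s s1 PE] Pm] [[t t1 QE] Qm].
pose E := M - P0; have Es i j : `|E i j| < 1 / 10 by rewrite !mxE; apply: ME.
have qM w : qform M w = dot w s0 ^+ 2 + qform E w.
  have -> : M = P0 + E by rewrite addrC subrK.
  by rewrite /qform mulmxDr dotDl -/(qform P0 w) P0E qform_line_proj.
have qE w : `|qform E w| <= 3 * (1 / 10) * dot w w := qform_small w Es.
pose l := qform M s.
have max w : qform M w <= l * dot w w.
  have [->|w0] := eqVneq w 0; first by rewrite /qform mul0mx !dot0l mulr0.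
  have := Pm (line_proj (unitize w)); rewrite PE !trace_line_proj -/l => /(_ _)H.
  have {}H : qform M (unitize w) <= l by apply: H; exists (unitize w) => //; exact: unitize_unit.
  have dw : 0 < dot w w by rewrite dot_gt0.
  rewrite -ler_pdivrMr //; apply: le_trans H; rewrite /qform /unitize -scalemxAl !(dotZl, dotZr).
  by rewrite mulrA -invfM -expr2 sqr_enorm mulrC.
have lt : qform M t = l.
  by apply/eqP; rewrite eq_le /l -!trace_line_proj -PE -QE Pm ?Qm //; [exists s|exists t].
have l7 : 7 / 10 <= l.
  have := max s0; rewrite s01 qM s01 => H; have := qE s0; rewrite s01 ler_norml; lra.
have zero x y : l * dot (x *: s + y *: t) (x *: s + y *: t) <= qform M (x *: s + y *: t).
  have := max (x *: s - y *: t); move: lt (erefl l); rewrite /qform {2}/l /qform.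
  rewrite !(mulmxDl, mulNmx, dotDl, dotDr, dotNl, dotNr) -!scalemxAl !(dotZl, dotZr) s1 t1.
  by move=> e1 e2; rewrite e1 e2; lra.
have small w x y : w = x *: s + y *: t -> dot w s0 = 0 -> dot w w = 0.
  move=> we ws; have := zero x y; rewrite -we qM ws expr0n add0r => H.
  have := qE w; have := dot_ge0 w; rewrite ler_norml => h1 /andP[h2 h3].
  apply/eqP; rewrite eq_le h1 andbT; nra.
have sn0 : dot s s0 != 0.
  apply/eqP => s_s0; have := small s 1 0; rewrite scale1r scale0r addr0 => /(_ erefl s_s0).
  by rewrite s1 => /eqP; rewrite oner_eq0.
have w0 : dot t s0 *: s = dot s s0 *: t.
  apply/eqP; rewrite -subr_eq0 -dot_eq0 -scaleNr; apply/eqP; apply: (small _ _ _ erefl).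
  by rewrite dotDl !dotZl; ring.
have e2 : dot t s0 ^+ 2 = dot s s0 ^+ 2.
  have := congr1 (fun w => dot w w) w0; rewrite !(dotZl, dotZr) s1 t1 !mulr1 => H.
  by rewrite !expr2.
have lZ k (u : 'rV[R]_3) : line_proj (k *: u) = k ^+ 2 *: line_proj u.
  by apply/matrixP => i j; rewrite [RHS]mxE !line_projE !mxE; ring.
have := congr1 (@line_proj R 3) w0; rewrite !lZ e2 PE QE; apply: scalerI.
by rewrite expf_neq0.
Qed.

Lemma proj_plane_compact : compact (@proj_plane R).
Proof.
have -> : @proj_plane R = @line_proj R 3 @` [set s | dot s s = 1].
  by apply/seteqP; split => P [s]; [exists s|move=> ? <-; exists s].
apply: continuous_compact; last exact: unit_sphere_compact.
by apply: continuous_subspaceT; apply: contP => s; apply: contat_line_proj; cont.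
Qed.

Lemma best_projector_self P : proj_plane P -> best_projector P P.
Proof.
move=> PP; split => // _ [t t1 ->]; have [s s1 ->] := PP.
rewrite !trace_line_proj !qform_line_proj s1 expr1n.
have := dot_unit_le1 t1 s1; nra.
Qed.

Lemma contat_tr (T : topologicalType) k (f : T -> 'M[R]_k) x :
  contat f x -> contat (fun y => \tr (f y)) x.
Proof. by move=> cf; rewrite /mxtrace; cont. Qed.

(** The nearest projector depends continuously on the matrix because it is unique and
    ranges over a compact set. *)
Lemma proj_plane_retraction : exists r, nbhd_retraction (@proj_plane R) near_projector r.
Proof.
have ex M : exists P, best_projector M P.
  have [||P /set_mem PP Pm] :=
    @compact_EVT_max _ R (fun P => \tr (M *m P)) (@proj_plane R) _ proj_plane_compact.
  - by exists (polar_line R), (north R) => //; exact: north_unit.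
  - by apply: continuous_subspaceT; apply: contP => P; apply: contat_tr; apply: contat_mul; cont.
  - by exists P; split => // Q QP; apply: Pm; rewrite inE.
have [r rP] := choice ex; exists r; split.
- rewrite openE => M [P PP MP]; rewrite /interior /=.
  have : \forall N \near M, forall i j, `|(N : 'M[R]_3) i j - P i j| < 1 / 10.
    apply: (@filter_forall _ _ (fun i (N : 'M[R]_3) => forall j, `|N i j - P i j| < 1 / 10)
      (nbhs M) (nbhs_filter M)) => i.
    apply: (@filter_forall _ _ (fun j (N : 'M[R]_3) => `|N i j - P i j| < 1 / 10)
      (nbhs M) (nbhs_filter M)) => j.
    have cn : contat (fun N : 'M[R]_3 => `|N i j - P i j|) M by apply: contat_norm; cont.
    exact: near_lt_cst cn (MP i j).
  by apply: filterS => N NP; exists P.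
- by move=> P PP; exists P => // i j; rewrite subrr normr0; lra.
- move=> M OM; split; last by have [] := rP M.
  move=> U rU; rewrite nbhs_simpl /=.
  (* projectors outside U stay strictly worse for all N near M *)
  have cK : compact (@proj_plane R `&` ~` U°).
    apply: (subclosed_compact _ proj_plane_compact) => //; apply: closedI.
      by apply: compact_closed; [exact: mx_hausdorff|exact: proj_plane_compact].
    by apply: open_closedC; apply: open_interior.
  have /compact_near_coveringP nc := cK.
  have := nc _ (nbhs M) (fun N Q => \tr (N *m Q) < \tr (N *m r M)) (nbhs_filter M).
  suff near_worse : forall Q, (@proj_plane R `&` ~` U°) Q ->
      \forall Q' \near Q & N \near M, \tr (N *m Q') < \tr (N *m r M).
    move=> /(_ near_worse); apply: filterS => N HN.
    apply: contrapT => nU; have [rN1 rN2] := rP N.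
    have := HN (r N) (conj rN1 (fun h : U° (r N) => nU (interior_subset h))).
    by rewrite ltNge rN2 //; have [] := rP M.
  move=> Q [QP nQ].
  have lt : \tr (M *m Q) < \tr (M *m r M).
    rewrite lt_neqAle (rP M).2 // andbT; apply/eqP => e; apply: nQ.
    suff -> : Q = r M by [].
    apply: (best_projector_unique OM _ (rP M)); split => // Q' Q'P.
    by rewrite e; apply: (rP M).2.
  have c1 : contat (fun p : 'M[R]_3 * 'M[R]_3 => \tr (p.2 *m p.1)) (Q, M) by apply: contat_tr; cont.
  have c2 : contat (fun p : 'M[R]_3 * 'M[R]_3 => \tr (p.2 *m r M)) (Q, M) by apply: contat_tr; cont.
  exact: near_lt c1 c2 lt.
- move=> P PP; apply: (best_projector_unique _ (rP P)); last exact: best_projector_self.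
  by exists P => // i j; rewrite subrr normr0; lra.
Qed.

End ProjPlane.

Section ENR.
Variables (R : realType) (n : nat).

Theorem base_space_ENR : is_ENR R (set_type (@base_set R n)).
Proof.
have [r rr] := proj_plane_retraction R; have [_ _ _ rid] := rr.
apply: (@wedge_ENR R 3 3 n 4 (@proj_plane R) [set P | P = polar_line R] _ r (fun=> polar_line R)
  _ _ _ (poles R n 3) rr (unit_rows_retraction R n 4) (@poles_unit R n 3)) => //.
  by apply: contP => P; cont.
by move=> u _ /=; apply: rid; exists (north R) => //; exact: north_unit.
Qed.

Theorem cover_space_ENR : is_ENR R (set_type (@cover_set R n)).
Proof.
apply: (@wedge_ENR R 1 3 n 4 _ [set s | line_proj s = polar_line R] _ _
  (fun s : 'rV[R]_3 => s 0 ord_max *: north R)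
  _ _ _ (poles R n 3) (sphere_retraction R 3) (unit_rows_retraction R n 4) (@poles_unit R n 3)) => //.
- by apply: contP => P; cont.
- move=> s /= e; have /polar_line_unit_eq : dot s s = 1.
    by rewrite -tr_line_proj e tr_line_proj north_unit.
  have N1 : (north R) 0 ord_max = 1 by rewrite mxE !eqxx.
  by case/(_ e) => ->; [rewrite N1 scale1r|rewrite [_ 0 _]mxE N1 scaleN1r].
- move=> s /= s0; rewrite line_proj_unitize // dotZl dotZr north_unit mulr1.
  have {}s0 : s 0 ord_max != 0 by apply: contraNneq s0 => ->; rewrite scale0r.
  apply/matrixP => i j; rewrite mxE !line_projE !mxE.
  by field.
Qed.

End ENR.

(** * Cell structures *)

Section CellStructures.
Variable R : realType.

(** Cells of a subset of an ambient space.  The characteristic maps are continuous on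
    the whole vector space, which makes products and images direct; the base point is
    required to be a cell of dimension zero, so that wedges are subcomplexes. *)
Record cell_structure (V : topologicalType) (A : set V) (b0 : V) := CellStructure {
  cell_index : finType;
  cell_dim : cell_index -> nat;
  cell_map : forall j, 'rV[R]_(cell_dim j) -> V;
  cell_map_continuous : forall j, continuous (@cell_map j);
  cell_map_inj : forall j (u v : 'rV[R]_(cell_dim j)),
    dot u u < 1 -> dot v v < 1 -> cell_map u = cell_map v -> u = v;
  cell_disjoint : forall j k (u : 'rV[R]_(cell_dim j)) (v : 'rV[R]_(cell_dim k)),
    dot u u < 1 -> dot v v < 1 -> cell_map u = cell_map v -> j = k;
  cell_in : forall j (v : 'rV[R]_(cell_dim j)), dot v v < 1 -> A (cell_map v);
  cell_cover : forall x, A x -> exists j (v : 'rV[R]_(cell_dim j)), dot v v < 1 /\ cell_map v = x;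
  cell_boundary : forall j (v : 'rV[R]_(cell_dim j)), dot v v = 1 ->
    exists k (u : 'rV[R]_(cell_dim k)),
      [/\ (cell_dim k < cell_dim j)%N, dot u u < 1 & cell_map u = cell_map v];
  base_cell : cell_index;
  base_cell_dim : cell_dim base_cell = 0%N;
  base_cell_map : forall v : 'rV[R]_(cell_dim base_cell), cell_map v = b0 }.

Arguments cell_map {V A b0} c j v : rename.
Arguments cell_dim {V A b0} c j.

Lemma cell_closed (V : topologicalType) (A : set V) b0 (C : cell_structure A b0) j v :
  dot v v <= 1 -> exists k u, [/\ (cell_dim C k <= cell_dim C j)%N, dot u u < 1 &
    cell_map C k u = cell_map C j v].
Proof.
rewrite le_eqVlt => /orP[/eqP v1|v1]; last by exists j, v.
by have [k [u [/ltnW ? ? ?]]] := cell_boundary v1; exists k, u.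
Qed.

Lemma rV0_eq m (u v : 'rV[R]_m) : m = 0%N -> u = v.
Proof. by move=> m0; apply/rowP => -[i im]; exfalso; rewrite m0 in im. Qed.

Lemma rV0_dot m (u : 'rV[R]_m) : m = 0%N -> dot u u = 0.
Proof. by move=> m0; rewrite (rV0_eq u 0 m0) dot0l. Qed.

Program Definition point_cell (V : topologicalType) (b0 : V) : cell_structure [set b0] b0 :=
  @CellStructure _ _ _ unit (fun=> 0%N) (fun _ _ => b0) _ _ _ _ _ _ tt _ _.
Next Obligation. by move=> *; apply: contP => x; apply: contat_cst. Qed.
Next Obligation. by move=> *; apply: rV0_eq. Qed.
Next Obligation. by move=> V b0 [] []. Qed.
Next Obligation. by []. Qed.
Next Obligation. by move=> V b0 x ->; exists tt, 0; rewrite dot0l ltr01. Qed.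
Next Obligation.
by move=> V b0 j v v1; have := rV0_dot v erefl; rewrite v1 => /eqP; rewrite oner_eq0.
Qed.
Next Obligation. by []. Qed.
Next Obligation. by []. Qed.

Section Attach.
Variables (V : topologicalType) (A : set V) (b0 : V) (C : cell_structure A b0).
Variables (D : nat) (f : 'rV[R]_D -> V).
Hypotheses (cf : continuous f)
  (f_inj : forall u v : 'rV[R]_D, dot u u < 1 -> dot v v < 1 -> f u = f v -> u = v)
  (f_out : forall u : 'rV[R]_D, dot u u < 1 -> ~ A (f u))
  (f_bd : forall u : 'rV[R]_D, dot u u = 1 -> A (f u))
  (dimC : forall j, (cell_dim C j < D)%N).

Definition attach_dim (j : option (cell_index C)) : nat :=
  if j is Some j' then cell_dim C j' else D.

Definition attach_map (j : option (cell_index C)) : 'rV[R]_(attach_dim j) -> V :=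
  match j with Some j' => cell_map C j' | None => f end.

(** One new cell of higher dimension than all others. *)
Program Definition attach_cell : cell_structure (A `|` f @` [set u | dot u u < 1]) b0 :=
  @CellStructure _ _ _ (option (cell_index C)) attach_dim attach_map _ _ _ _ _ _
    (Some (base_cell C)) _ _.
Next Obligation. by case=> [j|]; [apply: cell_map_continuous|apply: cf]. Qed.
Next Obligation. by case=> [j|]; [apply: cell_map_inj|apply: f_inj]. Qed.
Next Obligation.
move=> [j|] [k|] u v /= u1 v1 e //.
- by congr Some; apply: cell_disjoint e.
- by exfalso; apply: (f_out v1); rewrite -e; apply: cell_in.
- by exfalso; apply: (f_out u1); rewrite e; apply: cell_in.
Qed.
Next Obligation. by case=> [j|] v /= v1; [left; apply: cell_in|right; exists v]. Qed.
Next Obligation.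
move=> x [/(cell_cover C)[j [v vx]]|[v v1 vx]]; first by exists (Some j), v.
by exists None, v.
Qed.
Next Obligation.
case=> [j|] v /= v1.
  by have [k [u ku]] := cell_boundary v1; exists (Some k), u.
have [k [u [u1 ku]]] := cell_cover C (f_bd v1).
by exists (Some k), u; split => //; apply: dimC.
Qed.
Next Obligation. exact: base_cell_dim. Qed.
Next Obligation. exact: base_cell_map. Qed.

End Attach.

Section Image.
Variables (V W : topologicalType) (A : set V) (b0 : V) (C : cell_structure A b0).
Variables (f : V -> W).
Hypotheses (cf : continuous f) (f_inj : forall x y, A x -> A y -> f x = f y -> x = y).

Program Definition image_cells : cell_structure (f @` A) (f b0) :=
  @CellStructure _ _ _ (cell_index C) (cell_dim C) (fun j v => f (cell_map C j v)) _ _ _ _ _ _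
    (base_cell C) (base_cell_dim C) _.
Next Obligation.
by move=> j; apply: contP => v; apply: (contat_comp (g := f));
  [exact: contE|exact/contE/cell_map_continuous].
Qed.
Next Obligation.
move=> j u v u1 v1 /f_inj e.
by apply: (@cell_map_inj _ _ _ C) => //; apply: e; apply: cell_in.
Qed.
Next Obligation.
move=> j k u v u1 v1 /f_inj e.
by apply: (@cell_disjoint _ _ _ C _ _ u v) => //; apply: e; apply: cell_in.
Qed.
Next Obligation. by move=> j v v1; exists (cell_map C j v) => //; apply: cell_in. Qed.
Next Obligation.
by move=> _ [x /(cell_cover C)[j [v [v1 <-]]] <-]; exists j, v.
Qed.
Next Obligation.
by move=> j v v1; have [k [u [? ? e]]] := cell_boundary v1; exists k, u; split; rewrite ?e.
Qed.
Next Obligation. by move=> v /=; rewrite base_cell_map. Qed.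

End Image.

Section Subcomplex.
Variables (V : topologicalType) (A A' : set V) (b0 : V) (C : cell_structure A b0).
Variable K : pred (cell_index C).
Hypotheses (K_in : forall j v, K j -> dot v v <= 1 -> A' (cell_map C j v))
  (K_cover : forall x, A' x -> exists j v, [/\ K j, dot v v < 1 & cell_map C j v = x])
  (K_base : K (base_cell C)).

(** Cells that are closed in [A'] and exhaust it; the boundary of such a cell lies in
    [A'], hence in lower cells of the family. *)
Program Definition subcomplex : cell_structure A' b0 :=
  @CellStructure _ _ _ {j | K j} (fun j => cell_dim C (val j)) (fun j => cell_map C (val j))
    _ _ _ _ _ _ (exist _ (base_cell C) K_base) (base_cell_dim C) _.
Next Obligation. by move=> j; apply: cell_map_continuous. Qed.
Next Obligation. by move=> j; apply: cell_map_inj. Qed.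
Next Obligation. by move=> j k u v u1 v1 e; apply: val_inj; apply: cell_disjoint e. Qed.
Next Obligation. by move=> j v v1; apply: K_in; [apply: valP|apply: ltW]. Qed.
Next Obligation. by move=> x /K_cover[j [v [Kj v1 vx]]]; exists (exist _ j Kj), v. Qed.
Next Obligation.
move=> j v v1; have [k [u [ud u1 e]]] := cell_boundary v1.
have [|k' [u' [Kk' u1' e']]] := K_cover (_ : A' (cell_map C (val j) v)).
  by apply: K_in; [apply: valP|rewrite v1].
have kk : k' = k by apply: (@cell_disjoint _ _ _ C _ _ u' u) => //; rewrite e.
rewrite -kk in ud; by exists (exist _ k' Kk'), u'.
Qed.
Next Obligation. by move=> v; apply: base_cell_map. Qed.

End Subcomplex.

Section BallProduct.
Variables m n : nat.
Implicit Type v : 'rV[R]_(m + n).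

Definition max_enorm v : R := Num.max (enorm (lsubmx v)) (enorm (rsubmx v)).

(** The homeomorphism from the ball onto the product of two balls: each ray is
    rescaled so that the larger of the two norms becomes the norm of the vector. *)
Definition blow v : 'rV[R]_(m + n) := (enorm v / (2 * max_enorm v)) *: (2 *: v).
Definition unblow v : 'rV[R]_(m + n) := (max_enorm v / enorm v) *: v.

Lemma dot_split v : dot v v = dot (lsubmx v) (lsubmx v) + dot (rsubmx v) (rsubmx v).
Proof.
by rewrite /dot big_split_ord; congr (_ + _); apply: eq_bigr => i _; rewrite !mxE.
Qed.

Lemma max_enorm_ge0 v : 0 <= max_enorm v.
Proof. by rewrite /max_enorm le_max enorm_ge0. Qed.

Lemma max_enormZ (a : R) v : max_enorm (a *: v) = `|a| * max_enorm v.
Proof. by rewrite /max_enorm !linearZ /= !enormZ maxr_pMr. Qed.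

Lemma enorm_bounds v : max_enorm v <= enorm v <= 2 * max_enorm v.
Proof.
have l0 := enorm_ge0 (lsubmx v); have r0 := enorm_ge0 (rsubmx v); have v0 := enorm_ge0 v.
have e : enorm v ^+ 2 = enorm (lsubmx v) ^+ 2 + enorm (rsubmx v) ^+ 2.
  by rewrite !sqr_enorm dot_split.
rewrite /max_enorm; have [h|h] := leP (enorm (lsubmx v)) (enorm (rsubmx v)).
  by apply/andP; split; nra.
by apply/andP; split; nra.
Qed.

Lemma max_enorm_eq0 v : (max_enorm v == 0) = (v == 0).
Proof.
rewrite -enorm_eq0; have := enorm_bounds v; have := max_enorm_ge0 v; have := enorm_ge0 v.
move=> h1 h2 /andP[h3 h4]; apply/eqP/eqP => h; apply/eqP; rewrite eq_le; apply/andP; split; lra.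
Qed.

Lemma blow0 : blow 0 = 0. Proof. by rewrite /blow !scaler0. Qed.
Lemma unblow0 : unblow 0 = 0. Proof. by rewrite /unblow scaler0. Qed.

Lemma max_enorm_blow v : max_enorm (blow v) = enorm v.
Proof.
have [->|v0] := eqVneq v 0; first by rewrite blow0 enorm0; apply/eqP; rewrite max_enorm_eq0.
rewrite /blow scalerA max_enormZ ger0_norm.
  by field; rewrite max_enorm_eq0.
by rewrite mulr_ge0 // divr_ge0 ?enorm_ge0 // mulr_ge0 // max_enorm_ge0.
Qed.

Lemma enorm_unblow v : enorm (unblow v) = max_enorm v.
Proof.
have [->|v0] := eqVneq v 0.
  by rewrite unblow0 enorm0; apply/esym/eqP; rewrite max_enorm_eq0.
rewrite /unblow enormZ ger0_norm; first by field; rewrite enorm_eq0.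
by rewrite divr_ge0 ?enorm_ge0 // max_enorm_ge0.
Qed.

Lemma blowK v : unblow (blow v) = v.
Proof.
have [->|v0] := eqVneq v 0; first by rewrite blow0 unblow0.
have e0 : enorm v != 0 by rewrite enorm_eq0.
have m0 : max_enorm v != 0 by rewrite max_enorm_eq0.
rewrite /unblow max_enorm_blow /blow !scalerA enormZ normrM normr_nat ger0_norm.
  by rewrite -[RHS]scale1r; congr (_ *: _); field; rewrite e0 m0.
by rewrite divr_ge0 ?enorm_ge0 // mulr_ge0 // max_enorm_ge0.
Qed.

Lemma unblowK v : blow (unblow v) = v.
Proof.
have [->|v0] := eqVneq v 0; first by rewrite unblow0 blow0.
have e0 : enorm v != 0 by rewrite enorm_eq0.
have m0 : max_enorm v != 0 by rewrite max_enorm_eq0.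
rewrite /blow enorm_unblow /unblow max_enormZ !scalerA ger0_norm.
  by rewrite -[RHS]scale1r; congr (_ *: _); field; rewrite e0 m0.
by rewrite divr_ge0 ?enorm_ge0 // max_enorm_ge0.
Qed.

Lemma contat_blow (T : topologicalType) (f : T -> 'rV[R]_(m + n)) x :
  contat f x -> contat (fun y => blow (f y)) x.
Proof.
move=> cf; have [f0|f0] := eqVneq (f x) 0.
  apply: contat_squeeze0; last by cont.
    move=> y; have /andP[h1 h2] := enorm_bounds (f y).
    have h0 := max_enorm_ge0 (f y).
    rewrite divr_ge0 ?enorm_ge0 ?mulr_ge0 //=.
    have [->|h3] := eqVneq (max_enorm (f y)) 0; first by rewrite mulr0 invr0 mulr0 ler01.
    by rewrite ler_pdivrMr ?mul1r // mulr_gt0 // lt0r h3.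
  by rewrite f0 scaler0.
apply: contat_mxZ; last by cont.
have m0 : 2 * max_enorm (f x) != 0 by rewrite mulf_neq0 ?max_enorm_eq0 // pnatr_eq0.
have cV := @contatV R T (fun y => 2 * max_enorm (f y)) x m0; apply: contatM; first by cont.
by apply: cV; rewrite /max_enorm; cont.
Qed.

End BallProduct.

Lemma enorm_lt1 k (v : 'rV[R]_k) : (enorm v < 1) = (dot v v < 1).
Proof. by rewrite -sqr_enorm -[X in _ = (_ < X)](expr1n _ 2) ltr_pXn2r // nnegrE ?enorm_ge0. Qed.

Lemma enorm_le1 k (v : 'rV[R]_k) : (enorm v <= 1) = (dot v v <= 1).
Proof. by rewrite -sqr_enorm -[X in _ = (_ <= X)](expr1n _ 2) ler_pXn2r // nnegrE ?enorm_ge0. Qed.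

Section Product.
Variables (V V' : topologicalType) (A : set V) (A' : set V') (b0 : V) (b0' : V').
Variables (C : cell_structure A b0) (C' : cell_structure A' b0').

Definition prod_dim (j : cell_index C * cell_index C') := (cell_dim C j.1 + cell_dim C' j.2)%N.

Definition prod_map j (v : 'rV[R]_(prod_dim j)) : V * V' :=
  (cell_map C j.1 (lsubmx (blow v)), cell_map C' j.2 (rsubmx (blow v))).

Lemma blow_disk k l (v : 'rV[R]_(k + l)) :
  (dot v v < 1) = (dot (lsubmx (blow v)) (lsubmx (blow v)) < 1) &&
                  (dot (rsubmx (blow v)) (rsubmx (blow v)) < 1).
Proof. by rewrite -!enorm_lt1 -gt_max -/(max_enorm _) max_enorm_blow. Qed.

Lemma blow_closed_disk k l (v : 'rV[R]_(k + l)) : dot v v <= 1 ->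
  dot (lsubmx (blow v)) (lsubmx (blow v)) <= 1 /\
  dot (rsubmx (blow v)) (rsubmx (blow v)) <= 1.
Proof.
by rewrite -!enorm_le1 -max_enorm_blow /max_enorm ge_max => /andP[].
Qed.

(** The ball of a product cell is identified with the product of the two balls; on its
    boundary one of the two factors is on the boundary. *)
Program Definition prod_cells : cell_structure (A `*` A') (b0, b0') :=
  @CellStructure _ _ _ (cell_index C * cell_index C')%type prod_dim prod_map
    _ _ _ _ _ _ (base_cell C, base_cell C') _ _.
Next Obligation.
move=> j; apply: contP => v; have c : contat (fun v : 'rV[R]_(prod_dim j) => blow v) v.
  by apply: contat_blow; cont.
have c1 : contat (fun v : 'rV[R]_(prod_dim j) => lsubmx (blow v)) v by cont.
have c2 : contat (fun v : 'rV[R]_(prod_dim j) => rsubmx (blow v)) v by cont.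
apply: contat_pair.
  by apply: (contat_comp (g := cell_map C j.1)) => //; exact/contE/cell_map_continuous.
by apply: (contat_comp (g := cell_map C' j.2)) => //; exact/contE/cell_map_continuous.
Qed.
Next Obligation.
move=> j u v; rewrite !blow_disk => /andP[u1 u2] /andP[v1 v2] [e1 e2].
rewrite -[u]blowK -[v]blowK; congr unblow; rewrite -[LHS]hsubmxK -[RHS]hsubmxK.
by congr row_mx; [apply: (cell_map_inj u1 v1 e1)|apply: (cell_map_inj u2 v2 e2)].
Qed.
Next Obligation.
move=> [j j'] [k k'] u v; rewrite !blow_disk => /andP[u1 u2] /andP[v1 v2] [e1 e2].
by have /= -> := cell_disjoint u1 v1 e1; have /= -> := cell_disjoint u2 v2 e2.
Qed.
Next Obligation.
by move=> j v; rewrite blow_disk => /andP[v1 v2]; split; apply: cell_in.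
Qed.
Next Obligation.
move=> [x x'] [/(cell_cover C)[j [v [v1 vx]]] /(cell_cover C')[j' [v' [v1' vx']]]].
exists (j, j'), (unblow (row_mx v v')).
by rewrite blow_disk /prod_map unblowK row_mxKl row_mxKr v1 v1' vx vx'.
Qed.
Next Obligation.
move=> j v v1.
have [h1 h2] : dot (lsubmx (blow v)) (lsubmx (blow v)) <= 1 /\
  dot (rsubmx (blow v)) (rsubmx (blow v)) <= 1 by apply: blow_closed_disk; rewrite v1.
have [k [u [ku u1 eu]]] := cell_closed h1; have [k' [u' [ku' u1' eu']]] := cell_closed h2.
have done k1 w k2 w' : (cell_dim C k1 + cell_dim C' k2 < prod_dim j)%N ->
    dot w w < 1 -> dot w' w' < 1 -> cell_map C k1 w = cell_map C j.1 (lsubmx (blow v)) ->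
    cell_map C' k2 w' = cell_map C' j.2 (rsubmx (blow v)) ->
    exists k0 (u0 : 'rV[R]_(prod_dim k0)), [/\ (prod_dim k0 < prod_dim j)%N, dot u0 u0 < 1 &
       prod_map u0 = prod_map v].
  move=> kd w1 w1' ew ew'; exists (k1, k2), (unblow (row_mx w w')); split => //.
    by rewrite blow_disk unblowK row_mxKl row_mxKr w1 w1'.
  by rewrite /prod_map unblowK row_mxKl row_mxKr ew ew'.
have : ~~ (dot v v < 1) by rewrite v1 ltxx.
rewrite blow_disk negb_and -!leNgt => /orP[h|h].
  have {}h : dot (lsubmx (blow v)) (lsubmx (blow v)) = 1 by apply/eqP; rewrite eq_le h1 h.
  have [i [w [iw w1 ew]]] := cell_boundary h.
  by apply: (done i w k' u') => //; rewrite -addSn leq_add.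
have {}h : dot (rsubmx (blow v)) (rsubmx (blow v)) = 1 by apply/eqP; rewrite eq_le h2 h.
have [i [w [iw w1 ew]]] := cell_boundary h.
by apply: (done k u i w) => //; rewrite -addnS leq_add.
Qed.
Next Obligation. by rewrite /prod_dim !base_cell_dim. Qed.
Next Obligation. by move=> v; rewrite /prod_map !base_cell_map. Qed.

End Product.

Lemma mx11_dot k (c : R) (v : 'rV[R]_k) :
  dot (row_mx v c%:M) (row_mx v c%:M : 'rV[R]_(k + 1)) = dot v v + c ^+ 2.
Proof.
by rewrite dot_split row_mxKl row_mxKr; congr (_ + _); rewrite /dot big_ord1 mxE eqxx mulr1n expr2.
Qed.

Lemma mx11_dot_left k (c : R) (v : 'rV[R]_k) :
  dot (row_mx c%:M v) (row_mx c%:M v : 'rV[R]_(1 + k)) = c ^+ 2 + dot v v.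
Proof.
by rewrite dot_split row_mxKl row_mxKr; congr (_ + _); rewrite /dot big_ord1 mxE eqxx mulr1n expr2.
Qed.

Section Sphere.
Variable k : nat.

Definition sphere_height (b : 'rV[R]_k) : R := 2 * dot b b - 1.

(** The ball wrapped around the sphere, its boundary going to the pole. *)
Definition sphere_wrap (b : 'rV[R]_k) : 'rV[R]_(k + 1) :=
  row_mx ((2 * Num.sqrt (1 - dot b b)) *: b) (sphere_height b)%:M.

Definition sphere_base : 'rV[R]_(k + 1) := row_mx 0 1%:M.

Lemma scalar_mx11_inj (c d : R) : c%:M = d%:M :> 'M[R]_1 -> c = d.
Proof. by move/(congr1 (fun M : 'M[R]_1 => M 0 0)); rewrite !mxE eqxx !mulr1n. Qed.

Lemma contat_scalar11 (T : topologicalType) (f : T -> R) x :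
  contat f x -> contat (fun y => (f y)%:M : 'M[R]_1) x.
Proof.
move=> cf; apply: contat_mx => i j; rewrite !ord1.
by under [fun y => _]eq_fun do rewrite mxE eqxx mulr1n.
Qed.

Lemma sphere_wrap_boundary b : dot b b = 1 -> sphere_wrap b = sphere_base.
Proof.
move=> b1; rewrite /sphere_wrap /sphere_height b1 subrr sqrtr0 mulr0 scale0r.
by congr row_mx; congr (_ %:M); lra.
Qed.

Lemma sphere_wrap_inj b b' : dot b b < 1 -> dot b' b' < 1 ->
  sphere_wrap b = sphere_wrap b' -> b = b'.
Proof.
move=> b1 b1' /eq_row_mx[e1 /scalar_mx11_inj e2].
have e : dot b b = dot b' b' by move: e2; rewrite /sphere_height; lra.
move: e1; rewrite e; apply: scalerI; rewrite mulf_neq0 ?pnatr_eq0 //.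
by rewrite gt_eqF // sqrtr_gt0 subr_gt0.
Qed.

Lemma sphere_wrap_out b : dot b b < 1 -> sphere_wrap b <> sphere_base.
Proof.
by move=> b1 /eq_row_mx[_ /scalar_mx11_inj]; rewrite /sphere_height; lra.
Qed.

Lemma sphere_wrap_onto (s : 'rV[R]_(k + 1)) : dot s s = 1 -> s <> sphere_base ->
  exists2 b, dot b b < 1 & sphere_wrap b = s.
Proof.
rewrite -[s]hsubmxK [rsubmx s]mx11_scalar; move: (lsubmx s) (rsubmx s 0 0) => u c.
rewrite mx11_dot => s1 sN.
have u0 := dot_ge0 u.
have c1 : c < 1.
  rewrite lt_neqAle; apply/andP; split; last by nra.
  apply/eqP => ce; apply: sN; rewrite ce; congr row_mx.
  by apply/eqP; rewrite -dot_eq0; apply/eqP; move: s1; rewrite ce; lra.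
have c1' : - 1 <= c by nra.
pose q := Num.sqrt ((1 - c) / 2).
have q0 : 0 < q by rewrite sqrtr_gt0 divr_gt0 // subr_gt0.
have q2 : q ^+ 2 = (1 - c) / 2 by rewrite sqr_sqrtr // divr_ge0 // subr_ge0 ltW.
have bb : dot ((2 * q)^-1 *: u) ((2 * q)^-1 *: u) = (1 + c) / 2.
  rewrite dotZl dotZr mulrA -invfM -expr2 exprMn q2.
  have -> : dot u u = (1 - c) * (1 + c) by move: s1; rewrite expr2; lra.
  by field; rewrite gt_eqF // subr_gt0.
exists ((2 * q)^-1 *: u); first by rewrite bb; lra.
rewrite /sphere_wrap /sphere_height bb scalerA; congr row_mx; last first.
  by congr (_ %:M); field.
have -> : 1 - (1 + c) / 2 = (1 - c) / 2 by field.
by rewrite -/q mulfV ?scale1r // mulf_neq0 ?pnatr_eq0 // gt_eqF.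
Qed.

Lemma sphere_cells : (0 < k)%N ->
  inhabited (cell_structure [set s : 'rV[R]_(k + 1) | dot s s = 1] sphere_base).
Proof.
move=> k0; have cf : continuous sphere_wrap.
  apply: contP => b; apply: contat_row_mx; first by cont.
  by apply: contat_scalar11; rewrite /sphere_height; cont.
pose C := point_cell sphere_base.
have bd b : dot b b = 1 -> [set sphere_base] (sphere_wrap b) by apply: sphere_wrap_boundary.
have := @attach_cell _ _ _ C k sphere_wrap cf sphere_wrap_inj sphere_wrap_out bd (fun=> k0).
set A := (X in cell_structure X); suff -> : A = [set s | dot s s = 1] by move=> c; exists.
apply/seteqP; split => s.
  case=> [->|[b b1 <-]] /=; first by rewrite mx11_dot dot0l add0r expr1n.
  rewrite mx11_dot dotZl dotZr mulrA -expr2 exprMn sqr_sqrtr ?subr_ge0 ?ltW //.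
  by rewrite /sphere_height; ring.
move=> s1; have [->|sN] := pselect (s = sphere_base); [by left|right].
by have [b b1 <-] := sphere_wrap_onto s1 sN; exists b.
Qed.

End Sphere.

Lemma sphere_base4 : sphere_base 3 = pole R 3.
Proof.
apply/rowP => j; case: (@split_ordP 3 1 j) => i ->.
  by rewrite [LHS](@row_mxEl _ 1 3 1) !mxE /=; case: i => -[|[|[|//]]].
by rewrite [LHS](@row_mxEr _ 1 3 1) !mxE (ord1 i).
Qed.

Lemma unit_rows_cells n : inhabited (cell_structure (@unit_rows R n 4) (poles R n 3)).
Proof.
have [S] := @sphere_cells 3 isT; rewrite sphere_base4 in S.
elim: n => [|n [C]].
  have -> : @unit_rows R 0 4 = [set poles R 0 3].
    by apply/seteqP; split => M _ //=; [apply/matrixP => -[]|case].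
  by exists; apply: point_cell.
pose glue (p : 'rV[R]_4 * 'M[R]_(n, 4)) : 'M[R]_(1 + n, 4) := col_mx p.1 p.2.
have cg : continuous glue by apply: contP => p; rewrite /glue; cont.
have ig p q : [set s : 'rV[R]_4 | dot s s = 1] p.1 /\ unit_rows p.2 ->
    [set s : 'rV[R]_4 | dot s s = 1] q.1 /\ unit_rows q.2 -> glue p = glue q -> p = q.
  by move=> _ _ /eq_col_mx[]; case: p => ? ?; case: q => ? ? /= -> ->.
have := image_cells (prod_cells S C) cg ig.
have -> : glue (pole R 3, poles R n 3) = poles R n.+1 3.
  apply/row_matrixP => i; rewrite row_poles; case: (@split_ordP 1 n i) => k ->.
    by rewrite [row _ _](@rowKu _ 1 n) row_id.
  by rewrite [row _ _](@rowKd _ 1 n) row_poles.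
set A := (X in cell_structure X); suff -> : A = @unit_rows R n.+1 4 by move=> c; exists.
apply/seteqP; split => M.
  move=> [[s y] [/= s1 y1] <-] i; case: (@split_ordP 1 n i) => k ->.
    by rewrite [row _ _](@rowKu _ 1 n) row_id.
  by rewrite [row _ _](@rowKd _ 1 n).
move=> M1; exists (@usubmx R 1 n 4 M, @dsubmx R 1 n 4 M); last exact: vsubmxK.
split => /= [|i].
  by rewrite -[@usubmx R 1 n 4 M](row_id 0) row_usubmx; apply: M1.
by rewrite row_dsubmx; apply: M1.
Qed.

Section ProjectiveSpace.

Definition proj_space m : set 'M[R]_(m.+1) :=
  [set P | exists2 s : 'rV[R]_(m.+1), dot s s = 1 & P = line_proj s].

Definition pad_line m (P : 'M[R]_m.+1) : 'M[R]_(1 + m.+1) := block_mx 0 0 0 P.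

Lemma line_proj_row_mx m (a : 'rV[R]_1) (u : 'rV[R]_m) :
  line_proj (row_mx a u) = block_mx (line_proj a) (a^T *m u) (u^T *m a) (line_proj u).
Proof. by rewrite /line_proj tr_row_mx mul_col_row. Qed.

Lemma pad_line_proj m (u : 'rV[R]_m.+1) : pad_line (line_proj u) = line_proj (row_mx 0 u).
Proof. by rewrite line_proj_row_mx /line_proj !trmx0 !mul0mx mulmx0. Qed.

Lemma line_proj_entry00 m (a : R) (u : 'rV[R]_m) : line_proj (row_mx a%:M u) 0 0 = a ^+ 2.
Proof.
have e0 : (0 : 'I_(1 + m)) = lshift m 0 by apply: val_inj.
by rewrite line_projE e0 row_mxEl mxE eqxx mulr1n expr2.
Qed.

(** The hemisphere over the ball, read as lines; over the boundary the first
    coordinate is zero, which gives lines of the smaller space. *)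
Definition line_wrap m (v : 'rV[R]_m) : 'M[R]_(1 + m) :=
  line_proj (row_mx (Num.sqrt (1 - dot v v))%:M v).

Lemma line_wrap_inj m (u v : 'rV[R]_m) : dot u u < 1 -> dot v v < 1 ->
  line_wrap u = line_wrap v -> u = v.
Proof.
move=> u1 v1 /line_proj_eq[||/eq_row_mx[_ ->]|] //.
- by rewrite mx11_dot_left sqr_sqrtr ?subrK // subr_ge0 ltW.
- by rewrite mx11_dot_left sqr_sqrtr ?subrK // subr_ge0 ltW.
rewrite opp_row_mx => /eq_row_mx[/(congr1 (fun M : 'M[R]_1 => M 0 0))].
rewrite !mxE eqxx !mulr1n => e _; exfalso.
have := sqrtr_ge0 (1 - dot u u); have : 0 < Num.sqrt (1 - dot v v) by rewrite sqrtr_gt0 subr_gt0.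
by rewrite e; lra.
Qed.

Lemma proj_space_step m : @proj_space m.+1 =
  (@pad_line m @` @proj_space m) `|` (@line_wrap m.+1 @` [set v | dot v v < 1]).
Proof.
apply/seteqP; split => P.
  move=> [s s1 ->]; move: s1; rewrite -[s](@hsubmxK _ 1 1 m.+1).
  rewrite [@lsubmx _ 1 1 m.+1 s]mx11_scalar.
  move: (@lsubmx _ 1 1 m.+1 s 0 0) (@rsubmx _ 1 1 m.+1 s) => c u.
  rewrite mx11_dot_left => cu.
  wlog c0 : c u cu / 0 <= c.
    move=> H; have [c0|c0] := leP 0 c; first exact: H.
    have := H (- c) (- u); rewrite sqrrN dotNl dotNr opprK oppr_ge0.
    rewrite (_ : row_mx (- c)%:M (- u) = - row_mx c%:M u); last first.
      by rewrite opp_row_mx raddfN.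
    by rewrite line_projN; apply => //; apply: ltW.
  have [c00|c00] := eqVneq c 0.
    left; exists (line_proj u); first by exists u => //; move: cu; rewrite c00; lra.
    by rewrite pad_line_proj c00 raddf0.
  have c2 : 0 < c ^+ 2 by rewrite exprn_gt0 // lt0r c00.
  right; exists u; first by rewrite /=; lra.
  rewrite /line_wrap (_ : 1 - dot u u = c ^+ 2); last by rewrite -cu addrK.
  by rewrite sqrtr_sqr ger0_norm.
case=> [[_ [u u1 ->] <-]|[v v1 <-]].
  exists (row_mx 0 u : 'rV[R]_(1 + m.+1)); last exact: pad_line_proj.
  by rewrite (@dot_split 1 m.+1) row_mxKl row_mxKr dot0l add0r.
exists (row_mx (Num.sqrt (1 - dot v v))%:M v : 'rV[R]_(1 + m.+1)) => //.
by rewrite (@mx11_dot_left m.+1) sqr_sqrtr ?subrK // subr_ge0 ltW.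
Qed.

Lemma pad_pole m : row_mx 0 (pole R m) = pole R m.+1 :> 'rV[R]_(1 + m.+1).
Proof.
apply/rowP => j; case: (@split_ordP 1 m.+1 j) => i ->.
  by rewrite row_mxEl !mxE (ord1 i) eqxx.
rewrite row_mxEr !mxE !eqxx /=; congr (_%:R); congr nat_of_bool.
Qed.

(** One cell in each dimension, attached to the projective space of lines with first
    coordinate zero. *)
Lemma proj_space_cells m :
  exists C : cell_structure (@proj_space m) (line_proj (pole R m)),
    forall j, (cell_dim C j <= m)%N.
Proof.
elim: m => [|m [C dC]].
  have e : @proj_space 0 = [set line_proj (pole R 0)].
    apply/seteqP; split => P /=; last by move=> ->; exists (pole R 0); rewrite ?pole_unit.
    move=> [s s1 ->]; have : line_proj s = 1%:M.
      rewrite [line_proj s]mx11_scalar line_projE; congr (_ %:M).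
      by move: s1; rewrite /dot big_ord1.
    move=> ->; rewrite [RHS]mx11_scalar line_projE !mxE !eqxx mulr1 //.
  by rewrite e; exists (point_cell _).
have padi : forall x y, proj_space x -> proj_space y -> @pad_line m x = pad_line y -> x = y.
  by move=> x y _ _ /eq_block_mx[_ _ _].
have padc : continuous (@pad_line m).
  apply: contP => P; rewrite /pad_line /block_mx; apply: contat_col_mx; first by cont.
  by apply: contat_row_mx; cont.
pose C' := image_cells C padc padi.
have wc : continuous (@line_wrap m.+1).
  apply: contP => v; apply: contat_line_proj; apply: contat_row_mx; last by cont.
  by apply: contat_scalar11; cont.
have out (u : 'rV[R]_m.+1) : dot u u < 1 -> ~ (@pad_line m @` @proj_space m) (line_wrap u).
  move=> u1 [P _ e]; have := congr1 (fun M : 'M[R]_(1 + m.+1) => M 0 0) e.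
  rewrite /= line_proj_entry00 sqr_sqrtr ?subr_ge0 ?ltW //.
  have e0 : (0 : 'I_(1 + m.+1)) = lshift m.+1 0 by apply: val_inj.
  by rewrite /pad_line e0 block_mxEul mxE; lra.
have bd (u : 'rV[R]_m.+1) : dot u u = 1 -> (@pad_line m @` @proj_space m) (line_wrap u).
  move=> u1; exists (line_proj u); first by exists u.
  by rewrite pad_line_proj /line_wrap u1 subrr sqrtr0 raddf0.
have dC' j : (cell_dim C' j < m.+1)%N by apply: dC.
rewrite proj_space_step.
have := erefl (line_proj (pole R m.+1)).
rewrite -{1}pad_pole -pad_line_proj => <-.
exists (attach_cell wc (@line_wrap_inj m.+1) out bd dC') => -[j|] //=.
exact/leqW/dC.
Qed.

End ProjectiveSpace.

(** The subcomplex of the product in which one of the two factors is the base cell. *)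
Lemma base_set_cells n :
  inhabited (cell_structure (@base_set R n) (polar_line R, poles R n 3)).
Proof.
have [C _] := proj_space_cells 2; have [C'] := unit_rows_cells n.
pose D := prod_cells C C'.
pose K (j : cell_index D) := (j.1 == base_cell C) || (j.2 == base_cell C').
have inA k (v : 'rV[R]_(cell_dim C k)) : dot v v <= 1 -> proj_plane (cell_map C k v).
  by move=> /cell_closed[i [u [_ u1 <-]]]; apply: cell_in.
have inA' k (v : 'rV[R]_(cell_dim C' k)) : dot v v <= 1 -> unit_rows (cell_map C' k v).
  by move=> /cell_closed[i [u [_ u1 <-]]]; apply: cell_in.
exists; apply: (@subcomplex _ _ (@base_set R n) _ D K).
- move=> j v Kj /blow_closed_disk[v1 v2]; split; [exact: inA|exact: inA'|].
  case/orP: Kj => /eqP e; [right|left].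
    by rewrite /= /prod_map /=; move: (lsubmx _); rewrite e => w; rewrite base_cell_map.
  by rewrite /= /prod_map /=; move: (rsubmx _); rewrite e => w; rewrite base_cell_map.
- move=> [P y] [/= PP y1 Py].
  have z0 : dot (0 : 'rV[R]_(cell_dim C (base_cell C))) 0 < 1 by rewrite dot0l.
  have z0' : dot (0 : 'rV[R]_(cell_dim C' (base_cell C'))) 0 < 1 by rewrite dot0l.
  have build j (v : 'rV[R]_(cell_dim C j)) j' (v' : 'rV[R]_(cell_dim C' j')) :
      K (j, j') -> dot v v < 1 -> dot v' v' < 1 -> cell_map C j v = P -> cell_map C' j' v' = y ->
      exists k w, [/\ K k, dot w w < 1 & cell_map D k w = (P, y)].
    move=> Kj v1 v1' e e'; exists (j, j'), (unblow (row_mx v v')).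
    by rewrite blow_disk /= /prod_map unblowK row_mxKl row_mxKr v1 v1' /= e e'.
  case: Py => e.
    have [j [v [v1 vP]]] := cell_cover C PP.
    by apply: (build j v (base_cell C') 0) => //; rewrite ?base_cell_map // /K /= eqxx orbT.
  have [j [v [v1 vy]]] := cell_cover C' y1.
  by apply: (build (base_cell C) 0 j v) => //; rewrite ?base_cell_map // /K /= eqxx.
- by rewrite /K /= eqxx.
Qed.

(** The retraction of the vector space onto the ball makes the characteristic maps take
    values in the complex everywhere. *)
Definition ball_clamp k (v : 'rV[R]_k) : 'rV[R]_k := (Num.max 1 (enorm v))^-1 *: v.

Lemma ball_clamp_id k (v : 'rV[R]_k) : dot v v <= 1 -> ball_clamp v = v.
Proof. by rewrite -enorm_le1 => v1; rewrite /ball_clamp max_l // invr1 scale1r. Qed.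

Lemma ball_clamp_in k (v : 'rV[R]_k) : dot (ball_clamp v) (ball_clamp v) <= 1.
Proof.
have m1 : 1 <= Num.max 1 (enorm v) by rewrite le_max lexx.
rewrite -enorm_le1 /ball_clamp enormZ ger0_norm ?invr_ge0; last exact: le_trans m1.
by rewrite ler_pdivrMl ?(lt_le_trans _ m1) // mulr1 le_max lexx orbT.
Qed.

Lemma contat_ball_clamp (T : topologicalType) k (f : T -> 'rV[R]_k) x :
  contat f x -> contat (fun y => ball_clamp (f y)) x.
Proof.
move=> cf; apply: contat_mxZ => //; apply: contatV; last by cont.
by rewrite gt_eqF // lt_max ltr01.
Qed.

Lemma diskE k (v : 'rV[R]_k) : disk v = (dot v v <= 1).
Proof. by rewrite /disk /=; congr (is_true (_ <= _)); apply: eq_bigr => i _; rewrite expr2. Qed.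

Lemma open_diskE k (v : 'rV[R]_k) : open_disk v = (dot v v < 1).
Proof. by rewrite /open_disk /=; congr (is_true (_ < _)); apply: eq_bigr => i _; rewrite expr2. Qed.

Lemma finite_complex_of_cells (V : topologicalType) (A : set V) (b0 : V) :
  hausdorff_space V -> A b0 -> cell_structure A b0 -> is_finite_complex R (set_type A).
Proof.
move=> hV Ab0 C; split; first exact: set_type_hausdorff.
pose a0 : A := exist (fun x => x \in A) b0 (mem_set Ab0).
pose ix (i : 'I_#|cell_index C|) : cell_index C := enum_val i.
pose Phi i v : A := corestrict a0 (cell_map C (ix i) (ball_clamp v)).
have inA j (v : 'rV[R]_(cell_dim C j)) : dot v v <= 1 -> A (cell_map C j v).
  by move=> /cell_closed[i [u [_ u1 <-]]]; apply: cell_in.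
have PhiE i v : dot v v <= 1 -> set_val (Phi i v) = cell_map C (ix i) v.
  by move=> v1; rewrite corestrictK ball_clamp_id //; apply: inA.
have cellP i x : (Phi i @` @open_disk R _) x <->
    exists2 v, dot v v < 1 & set_val x = cell_map C (ix i) v.
  split => [[v]|[v v1 e]]; first by rewrite open_diskE => v1 <-; exists v => //; rewrite PhiE // ltW.
  by exists v; rewrite ?open_diskE //; apply: val_inj; rewrite -!set_valE PhiE ?e // ltW.
exists #|cell_index C|, (fun i => cell_dim C (ix i)), Phi; split.
- move=> i; apply: continuous_subspaceT; apply: contP => v; apply: contat_corestrictT.
    apply: (contat_comp (g := cell_map C (ix i))); first exact/contE/cell_map_continuous.
    by apply: contat_ball_clamp; cont.
  by move=> w; apply/inA/ball_clamp_in.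
- move=> i u v /set_mem + /set_mem; rewrite !open_diskE => u1 v1 /(congr1 set_val).
  by rewrite !PhiE ?ltW //; apply: cell_map_inj.
- move=> i j _ _ [x [/cellP[u u1 xu] /cellP[v v1 xv]]]; apply: enum_val_inj.
  by apply: (cell_disjoint u1 v1); rewrite -xu -xv.
- apply/seteqP; split => // x _; have [j [v [v1 vx]]] := cell_cover C (set_valP x).
  have {vx v1} : exists2 v, dot v v < 1 & set_val x = cell_map C j v by exists v.
  rewrite -[j]enum_rankK => vx; exists (enum_rank j) => //; exact/cellP.
- move=> i _ [v [+ +] <-]; rewrite diskE open_diskE => v1 /negP nv1.
  have {}v1 : dot v v = 1 by apply/eqP; rewrite eq_le v1 leNgt nv1.
  have [k [u [ku u1 e]]] := cell_boundary v1.
  have {e u1} : exists2 u, dot u u < 1 & set_val (Phi i v) = cell_map C k u.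
    by exists u => //; rewrite PhiE ?v1 // e.
  rewrite -[k]enum_rankK in ku * => ke; exists (enum_rank k) => //; exact/cellP.
Qed.

Theorem base_space_finite_complex n : is_finite_complex R (set_type (@base_set R n)).
Proof.
have [C] := base_set_cells n; apply: (finite_complex_of_cells _ _ C).
  by apply: prod_hausdorff; apply: mx_hausdorff.
exact: base_set_base.
Qed.

End CellStructures.

(** * Punctured spheres, generic points and polygons *)

Section Stereographic.
Variables (R : realType) (k : nat) (p : 'rV[R]_k).
Hypothesis p1 : dot p p = 1.
Implicit Types v d q : 'rV[R]_k.

Definition stereo v : 'rV[R]_k := (1 - dot v p)^-1 *: (v - p).
(** Inverse of the stereographic projection from [p], onto the plane of vectors with
    inner product -1 with [p]. *)
Definition unstereo d : 'rV[R]_k := p + (2 / dot d d) *: d.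

Lemma dot_stereo v : dot v p < 1 -> dot (stereo v) p = - 1.
Proof. by move=> vp; rewrite dotZl dotDl dotNl p1; field; rewrite gt_eqF // subr_gt0. Qed.

Lemma polar_neq0 d : dot d p = - 1 -> d != 0.
Proof.
by move=> dp; apply/eqP => d0; move: dp; rewrite d0 dot0l => /eqP; rewrite eq_sym oppr_eq0 oner_eq0.
Qed.

Lemma unstereo_unit d : dot d p = - 1 -> dot (unstereo d) (unstereo d) = 1.
Proof.
move=> dp; have d0 := polar_neq0 dp.
rewrite /unstereo !(dotDl, dotDr, dotZl, dotZr) p1 dp (dotC p d) dp.
by field; rewrite dot_eq0.
Qed.

Lemma stereoK v : dot v v = 1 -> dot v p < 1 -> unstereo (stereo v) = v.
Proof.
move=> v1 vp; have n0 : 1 - dot v p != 0 by rewrite gt_eqF // subr_gt0.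
have -> : unstereo (stereo v) = p + (v - p); last by rewrite addrC subrK.
congr (_ + _); rewrite /stereo scalerA -[RHS]scale1r; congr (_ *: _).
rewrite !(dotZl, dotZr) !(dotDl, dotDr, dotNl, dotNr) v1 p1 (dotC p v).
rewrite (_ : 1 - dot v p + (- dot v p - - 1) = 2 * (1 - dot v p)); last by ring.
by field.
Qed.

Lemma contat_unstereo (T : topologicalType) (f : T -> 'rV[R]_k) x :
  f x != 0 -> contat f x -> contat (fun y => unstereo (f y)) x.
Proof.
move=> f0 cf; apply: contat_mxD; first by cont.
apply: contat_mxZ => //; apply: contatM; first by cont.
by apply: contatV; [rewrite dot_eq0|cont].
Qed.

Variable q : 'rV[R]_k.
Hypotheses (q1 : dot q q = 1) (qp : dot q p < 1).

(** The contraction of the punctured sphere onto [q], straight in the stereographic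
    plane; it keeps [q] fixed. *)
Definition slide v (t : R) : 'rV[R]_k := unstereo ((1 - t) *: stereo v + t *: stereo q).

Section Point.
Variable v : 'rV[R]_k.
Hypotheses (v1 : dot v v = 1) (vp : dot v p < 1).

Lemma dot_slide_dir t : dot ((1 - t) *: stereo v + t *: stereo q) p = - 1.
Proof. by rewrite dotDl (dotZl (1 - t)) (dotZl t) !dot_stereo //; ring. Qed.

Lemma slide_unit t : dot (slide v t) (slide v t) = 1.
Proof. exact/unstereo_unit/dot_slide_dir. Qed.

Lemma slide0 : slide v 0 = v.
Proof. by rewrite /slide subr0 scale1r scale0r addr0 stereoK. Qed.

Lemma slide1 : slide v 1 = q.
Proof. by rewrite /slide subrr scale1r scale0r add0r stereoK. Qed.

Lemma contat_slide (T : topologicalType) (f : T -> 'rV[R]_k) (h : T -> R) x :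
  f x = v -> contat f x -> contat h x -> contat (fun y => slide (f y) (h y)) x.
Proof.
move=> fv cf ch; have cs : contat (fun y => stereo (f y)) x.
  rewrite /stereo; apply: contat_mxZ; last by cont.
  by apply: contatV; [rewrite fv gt_eqF // subr_gt0|cont].
apply: contat_unstereo; first by rewrite fv; apply/polar_neq0/dot_slide_dir.
by apply: contat_mxD; apply: contat_mxZ => //; cont.
Qed.

End Point.

Lemma slide_fixed t : slide q t = q.
Proof. by rewrite /slide -scalerDl subrK scale1r stereoK. Qed.

End Stereographic.

Section GenericPoint.
Variable R : realType.

Lemma plane_functional (a b : 'rV[R]_3) :
  exists w : 'rV[R]_3, [/\ w != 0, dot w a = 0 & dot w b = 0].
Proof.
pose M := (col_mx a b)^T; pose w := nz_row (kermx M).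
have wM : w *m M = 0 by apply/sub_kermxP/nz_row_sub.
have dotE (c : 'rV[R]_3) : dot w c = (w *m c^T) 0 0.
  by rewrite mxE; apply: eq_bigr => i _; rewrite [c^T _ _]mxE.
move: wM; rewrite /M tr_col_mx mul_mx_row -[0]hsubmxK => /eq_row_mx[wa wb].
exists w; split; last 2 first.
- by rewrite dotE wa !mxE.
- by rewrite dotE wb !mxE.
rewrite nz_row_eq0 -mxrank_eq0 mxrank_ker -lt0n subn_gt0.
exact: leq_ltn_trans (rank_leq_col _) _.
Qed.

Definition moment (x : R) : 'rV[R]_3 := \row_(j < 3) x ^+ j.

(** A plane through the origin contains at most two points of the moment curve, the
    zeros of a quadratic polynomial, so the curve has a point in [0, 1/2] outside of
    finitely many planes. *)
Lemma moment_avoids N (a b : 'I_N -> 'rV[R]_3) :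
  exists x : R, [/\ 0 < x, x <= 1 / 2 & forall i, exists w : 'rV[R]_3,
    [/\ dot w (a i) = 0, dot w (b i) = 0 & dot w (moment x) != 0]].
Proof.
have /choice[w wP] := fun i => plane_functional (a i) (b i).
pose P i : {poly R} := \poly_(j < 3) w i 0 (inord j).
have hP i x : (P i).[x] = dot (w i) (moment x).
  by rewrite horner_poly; apply: eq_bigr => j _; rewrite inord_val !mxE.
have P0 i : P i != 0.
  have [w0 _ _] := wP i; apply: contraNneq w0 => Pi0; apply/eqP/rowP => j.
  by have := congr1 (fun p : {poly R} => p`_j) Pi0; rewrite coef_poly ltn_ord inord_val coef0 mxE.
have Q0 : \prod_i P i != 0 by apply/prodf_neq0 => i _; apply: P0.
pose xs : seq R := [seq j.+2%:R^-1 | j <- iota 0 (size (\prod_i P i))].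
have ux : uniq xs.
  by rewrite map_inj_uniq ?iota_uniq // => i j /invr_inj/eqP; rewrite eqr_nat => /eqP[].
have /allPn[x /mapP[j _ xj] nr] : ~~ all (root (\prod_i P i)) xs.
  by apply/negP => rx; have := max_poly_roots Q0 rx ux; rewrite size_map size_iota ltnn.
exists x; split.
- by rewrite xj invr_gt0.
- by rewrite xj div1r lef_pV2 ?posrE // ler_nat.
- move=> i; exists (w i); have [_ ? ?] := wP i; split => //.
  rewrite -hP; apply: contra nr => /eqP Px0; rewrite /root horner_prod (bigD1 i) //=.
  by rewrite Px0 mul0r.
Qed.

End GenericPoint.

Section PiecewiseLinear.
Variables (R : realType) (k N : nat) (a : 'I_N.+2 -> 'rV[R]_k).

Definition hat (x : R) : R := Num.max 0 (1 - `|x|).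

(** The polygonal path with the given nodes, parametrised so that node [i] is reached at
    time [i]; as a sum of hat functions it is visibly continuous. *)
Definition polygon (x : R) : 'rV[R]_k := \sum_(i < N.+2) hat (x - i%:R) *: a i.

Lemma contat_polygon (T : topologicalType) (f : T -> R) x :
  contat f x -> contat (fun y => polygon (f y)) x.
Proof.
move=> cf; apply: contat_mx => i j.
have -> : (fun y => polygon (f y) i j) = (fun y => \sum_(l < N.+2) hat (f y - l%:R) * a l i j).
  by apply/funext => y; rewrite summxE; apply: eq_bigr => l _; rewrite mxE.
apply: contat_sum => l _; apply: contatM; last by cont.
by rewrite /hat; apply: contat_max; [cont|apply: contatD; [cont|apply/contatN/contat_norm; cont]].
Qed.

Lemma polygon_segment (i : 'I_N.+1) (t : R) : 0 <= t <= 1 ->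
  polygon (i%:R + t) = (1 - t) *: a (widen_ord (leqnSn _) i) + t *: a (lift ord0 i).
Proof.
move=> /andP[t0 t1]; rewrite /polygon (bigD1 (widen_ord (leqnSn _) i)) //=.
rewrite addrAC subrr add0r (bigD1 (lift ord0 i)) /=; last first.
  by rewrite -val_eqE /= /bump /= add1n neq_ltn ltnSn orbT.
rewrite big1 ?addr0 => [|j /andP[ji ji']].
  congr (_ *: _ + _ *: _); first by rewrite /hat ger0_norm // max_r // subr_ge0.
  rewrite /bump /= add1n -natr1 opprD addrACA subrr add0r /hat.
  by rewrite ler0_norm ?subr_le0 // opprB opprD opprK addrA subrr add0r max_r.
rewrite /hat max_l ?scale0r // subr_le0.
move: ji ji'; rewrite -!val_eqE /= /bump /= add1n => ji ji'.
have [lt|ge] := ltnP j i.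
  have : (j%:R + 1 <= i%:R :> R) by rewrite natr1 ler_nat.
  by move=> ?; rewrite ger0_norm; lra.
have : (i%:R + 2 <= j%:R :> R).
  by rewrite -natrD ler_nat addn2 ltn_neqAle eq_sym ji' /= ltn_neqAle eq_sym ji.
by move=> ?; rewrite ler0_norm; lra.
Qed.

Lemma polygon_node (i : 'I_N.+1) : polygon i%:R = a (widen_ord (leqnSn _) i).
Proof.
by rewrite -[i%:R]addr0 polygon_segment ?lexx ?ler01 // subr0 scale1r scale0r addr0.
Qed.

Lemma polygon_locate (x : R) : 0 <= x <= N%:R -> exists i : 'I_N.+1, 0 <= x - i%:R <= 1.
Proof.
move=> /andP[x0 xN]; have /andP[h1 h2] := truncn_itv x0.
have iN : (Num.truncn x < N.+1)%N by rewrite ltnS -(ler_nat R); apply: le_trans h1 xN.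
by exists (Ordinal iN) => /=; move: h2; rewrite -natr1; lra.
Qed.

End PiecewiseLinear.

(** * Free contraction of loops in spheres *)

Section Convexity.
Variables (R : realType) (k : nat).
Implicit Types u v w : 'rV[R]_k.

Lemma dot_comb_le1 u v (t : R) : 0 <= t <= 1 -> dot u u <= 1 -> dot v v <= 1 ->
  dot ((1 - t) *: u + t *: v) ((1 - t) *: u + t *: v) <= 1.
Proof.
move=> /andP[t0 t1] u1 v1; have := dot_ge0 (u - v).
rewrite !(dotDl, dotDr, dotNl, dotNr, dotZl, dotZr) (dotC v u) => h.
have h1 : 0 <= t * (1 - t) by rewrite mulr_ge0 // subr_ge0.
have := mulr_ge0 h1 h; have : 0 <= t * (1 - dot v v) by rewrite mulr_ge0 // subr_ge0.
have : 0 <= (1 - t) * (1 - dot u u) by rewrite mulr_ge0 // subr_ge0.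
lra.
Qed.

Lemma sqr_dot_unit u w : dot w w = 1 -> dot u w ^+ 2 <= dot u u.
Proof.
move=> w1; have := dot_ge0 (u - dot u w *: w).
by rewrite !(dotDl, dotDr, dotNl, dotNr, dotZl, dotZr) w1 (dotC w u); lra.
Qed.

Lemma dot_close u v w : dot u u = 1 -> dot v v = 1 -> dot w w = 1 ->
  31 / 32 <= dot u v -> dot u w - 1 / 4 <= dot v w.
Proof.
move=> u1 v1 w1 uv; have := sqr_dot_unit (u - v) w1.
rewrite !(dotDl, dotDr, dotNl, dotNr) u1 v1 (dotC v u) => h.
nra.
Qed.

Lemma dot_unitize_ge v w : v != 0 -> dot v v <= 1 -> 0 <= dot v w -> dot v w <= dot (unitize v) w.
Proof.
move=> v0 v1 vw; rewrite dotZl -[leLHS]mul1r ler_wpM2r // -invr1 lef_pV2 ?posrE ?enorm_gt0 //.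
by rewrite enorm_le1.
Qed.

End Convexity.

Lemma contat_slide_family (R : realType) k (p q : 'rV[R]_k) (P : R -> 'rV[R]_k) (t r : R) :
  dot p p = 1 -> dot q p < 1 -> dot (P t) p < 1 -> contat P t ->
  contat (uncurry (fun t s => slide p q (P t) s)) (t, r).
Proof.
move=> p1 qp Pp cP; apply: contat_uncurry; apply: (contat_slide p1 qp Pp) => //; last by cont.
by apply: (contat_comp (g := P)); [|cont].
Qed.

Section LoopContraction.
Variables (R : realType) (k : nat) (c : R -> 'rV[R]_(3 + k)).
Hypotheses (cc : forall t, contat c t) (c1 : forall t, dot (c t) (c t) = 1)
  (c_clamp : forall t, c (clamp t) = c t) (c01 : c 0 = c 1).
Local Notation q := (pole R k.+2).

Lemma subdivision : exists2 N : nat, (0 < N)%N & forall t t' : R, 0 <= t <= 1 ->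
  `|t - t'| <= N%:R^-1 -> 31 / 32 <= dot (c t) (c t').
Proof.
pose g (z : 'rV[R]_1) := c (z 0 0).
have cg : continuous g by apply: contP => z; apply: (contat_comp (g := c)) => //; cont.
pose K : set 'rV[R]_1 := [set z | z 0 0 = clamp (z 0 0)].
have K01 z : K z -> 0 <= z 0 0 <= 1 by move=> ->; apply: clamp_itv.
have cK : compact K.
  apply: mx_compact; first by apply: closed_eq; apply: contP => z; cont.
  by move=> z i j /K01; rewrite !ord1 => /andP[z0 z1]; rewrite ger0_norm.
pose e : R := (4 * (3 + k)%:R)^-1.
have e0 : 0 < e by rewrite invr_gt0 mulr_gt0 // ltr0n.
have [d d0 dP] := compact_unif_continuous cK cg e0.
exists (Num.bound d^-1) => [|t t' t01 tt'].
  by rewrite -(ltr_nat R); apply: le_lt_trans (archi_boundP _); rewrite invr_ge0 ltW.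
have bd : d^-1 < (Num.bound d^-1)%:R by apply: archi_boundP; rewrite invr_ge0 ltW.
have bd0 : 0 < (Num.bound d^-1)%:R :> R by apply: lt_trans bd; rewrite invr_gt0.
have {}tt' : `|t - t'| < d.
  by apply: le_lt_trans tt' _; rewrite -[ltRHS]invrK ltf_pV2 ?posrE ?invr_gt0.
have := dP (\row_(j < 1) t) (\row_(j < 1) t') _ _ 0; rewrite /K /= !mxE clamp_id // => /(_ erefl) H.
have {}H j : `|c t 0 j - c t' 0 j| < e.
  by have := H _ j; rewrite /g !mxE; apply => i; rewrite !mxE.
have : dot (c t - c t') (c t - c t') <= (3 + k)%:R * e ^+ 2.
  rewrite mulr_natl -[X in _ *+ X]card_ord -sumr_const; apply: ler_sum => j _.
  rewrite !mxE -expr2 -real_normK ?num_real // ler_pXn2r ?nnegrE ?normr_ge0 ?(ltW e0) //.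
  exact/ltW/H.
have -> : (3 + k)%:R * e ^+ 2 = 1 / 16 * (3 + k)%:R^-1.
  have m0 : (3 + k)%:R != 0 :> R by rewrite pnatr_eq0.
  by rewrite /e; move: (_%:R) m0 => m m0; field.
have : (3 + k)%:R^-1 <= 1 :> R by rewrite invf_le1 ?ler1n // ltr0n.
by rewrite !(dotDl, dotDr, dotNl, dotNr) !c1 (dotC (c t') (c t)); lra.
Qed.

Section Push.
Variables (N : nat).
Hypotheses (N0 : (0 < N)%N) (N_fine : forall t t' : R, 0 <= t <= 1 ->
  `|t - t'| <= N%:R^-1 -> 31 / 32 <= dot (c t) (c t')).

Definition node (i : 'I_N.+2) : 'rV[R]_(3 + k) := c (i%:R / N%:R).
Definition poly_loop (t : R) : 'rV[R]_(3 + k) := polygon node (N%:R * clamp t).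

Lemma poly_loop_segment t : exists (i : 'I_N.+1) (s : R),
  [/\ 0 <= s <= 1, 31 / 32 <= dot (c t) (node (widen_ord (leqnSn _) i)),
      31 / 32 <= dot (c t) (node (lift ord0 i)) &
      poly_loop t = (1 - s) *: node (widen_ord (leqnSn _) i) + s *: node (lift ord0 i)].
Proof.
have NR : 0 < N%:R :> R by rewrite ltr0n.
have /andP[t0 t1] := clamp_itv t.
have [|i /andP[s0 s1]] := @polygon_locate R N (N%:R * clamp t).
  by apply/andP; split; [rewrite mulr_ge0 // ltW|rewrite ler_piMr // ltW].
have tE (u : R) : `|clamp t - u / N%:R| <= N%:R^-1 <-> `|N%:R * clamp t - u| <= 1.
  rewrite -[X in X <= _ <-> _](_ : `|N%:R * clamp t - u| / N%:R = _).
    by rewrite ler_pdivrMr // mulVf // gt_eqF.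
  by rewrite -[X in _ / X](gtr0_norm NR) -normf_div mulrBl mulrAC mulfV ?mul1r // gt_eqF.
exists i, (N%:R * clamp t - i%:R); split.
- by rewrite s0.
- rewrite -c_clamp; apply: N_fine; first exact: clamp_itv.
  by apply/tE; rewrite ger0_norm.
- rewrite -c_clamp; apply: N_fine; first exact: clamp_itv.
  apply/tE; rewrite /= /bump /= add1n -natr1 ler_norml; lra.
- by rewrite /poly_loop -polygon_segment ?s0 // addrC subrK.
Qed.

Lemma poly_loop_ends : poly_loop 0 = c 0 /\ poly_loop 1 = c 0.
Proof.
rewrite /poly_loop clamp0 clamp1 mulr0 mulr1; split.
  by have := polygon_node node ord0; rewrite /node /= mul0r.
have := polygon_node node ord_max; rewrite /node /= => ->.
by rewrite mulfV ?c01 // pnatr_eq0 -lt0n.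
Qed.

(** Between the loop and the inscribed polygon. *)
Definition blend (t s : R) : 'rV[R]_(3 + k) := (1 - s) *: c t + s *: poly_loop t.

Lemma blend_spec t s : 0 <= s <= 1 ->
  [/\ blend t s != 0, dot (blend t s) (blend t s) <= 1 &
      dot (c t) q - 1 / 4 <= dot (blend t s) q].
Proof.
move=> s01; have [i [r [r01 d1 d2 e]]] := poly_loop_segment t.
have q1 : dot q q = 1 by apply: pole_unit.
have h1 := dot_close (c1 t) (c1 _) q1 d1; have h2 := dot_close (c1 t) (c1 _) q1 d2.
have /andP[r0 r1] := r01; have /andP[s0 s1] := s01.
have comb_ge (x y z m : R) : 0 <= z <= 1 -> m <= x -> m <= y -> m <= (1 - z) * x + z * y.
  move=> /andP[z0 z1] mx my; have := mulr_ge0 z0 (_ : 0 <= y - m).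
  rewrite subr_ge0 => /(_ my); have := mulr_ge0 (_ : 0 <= 1 - z) (_ : 0 <= x - m).
  by rewrite !subr_ge0 => /(_ z1 mx); lra.
split.
- apply/eqP => b0; have := dot0l (c t); rewrite -b0 /blend e.
  rewrite !(dotDl, dotZl) c1 !(dotC _ (c t)) => h.
  have := comb_ge 1 _ s (31 / 32) s01 _ (comb_ge _ _ _ _ r01 d1 d2).
  rewrite h => /(_ _)hh; have : 31 / 32 <= 0 :> R by apply: hh; lra.
  lra.
- apply: dot_comb_le1 => //; first by rewrite c1.
  by rewrite e; apply: dot_comb_le1 => //; rewrite c1.
- rewrite /blend e !(dotDl, dotZl); apply: (comb_ge _ _ s) => //; first by lra.
  exact: (comb_ge _ _ r _ r01 h1 h2).
Qed.

(** Zero exactly when the loop sits at the pole, and 1 at some distance from it. *)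
Definition freeze (t : R) : R := clamp (4 * (1 - dot (c t) q)).

(** Deforms the loop to the polygon, except near the pole, where it moves less and keeps
    the pole itself fixed. *)
Definition push (t s : R) : 'rV[R]_(3 + k) := unitize (blend t (clamp s * freeze t)).

Lemma push_param t s : 0 <= clamp s * freeze t <= 1.
Proof.
have /andP[s0 s1] := clamp_itv s; have /andP[f0 f1] := clamp_itv (4 * (1 - dot (c t) q)).
by rewrite mulr_ge0 //= mulr_ile1.
Qed.

Lemma push_unit t s : dot (push t s) (push t s) = 1.
Proof. by apply: unitize_unit; have [] := blend_spec t (push_param t s). Qed.

Lemma push0 t : push t 0 = c t.
Proof. by rewrite /push clamp0 mul0r /blend subr0 scale1r scale0r addr0 unitize_id. Qed.

Lemma push_fixed t s : c t = q -> push t s = q.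
Proof.
move=> ct; rewrite /push /freeze ct pole_unit subrr mulr0 clamp0 mulr0.
by rewrite /blend subr0 scale1r scale0r addr0 unitize_id ?ct // pole_unit.
Qed.

Lemma push_ends s : push 0 s = push 1 s.
Proof.
by have [e0 e1] := poly_loop_ends; rewrite /push /blend /freeze e0 e1 c01.
Qed.

Lemma contat_push t s : contat (uncurry push) (t, s).
Proof.
have cf : contat (fun p : R * R => c p.1) (t, s) by apply: (contat_comp (g := c)) => //; cont.
have cp : contat (fun p : R * R => poly_loop p.1) (t, s) by apply: contat_polygon; cont.
apply: contat_uncurry; apply: contat_unitize.
  by have [] := blend_spec t (push_param t s).
rewrite /blend; have ca : contat (fun p : R * R => clamp p.2 * freeze p.1) (t, s).
  by rewrite /freeze; cont.
apply: contat_mxD; apply: contat_mxZ => //.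
by apply: contatD; [cont|apply: contatN].
Qed.

(** The point is chosen on the moment curve, outside all planes spanned by consecutive
    nodes, so the polygon misses it; its last coordinate is at most 1/4, so the part of
    the loop near the pole, which is not pushed all the way, misses it too. *)
Lemma push_misses : exists p : 'rV[R]_(3 + k),
  [/\ dot p p = 1, dot q p < 1 & forall t, dot (push t 1) p < 1].
Proof.
have [x [x0 x2 xP]] := moment_avoids (fun i : 'I_N.+1 => lsubmx (node (widen_ord (leqnSn _) i)))
  (fun i => lsubmx (node (lift ord0 i))).
pose m : 'rV[R]_(3 + k) := row_mx (moment x) 0.
have m1 : 1 <= dot m m.
  rewrite /m dot_split row_mxKl row_mxKr dot0l addr0 /dot big_ord_recl !mxE /= expr0 mulr1.
  by rewrite lerDl sumr_ge0 // => i _; rewrite -expr2 sqr_ge0.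
have m0 : m != 0 by rewrite -dot_gt0; apply: lt_le_trans m1.
have mq : 0 <= dot m q <= 1 / 4.
  rewrite dot_pole /m; case: (@split_ordP 3 k (@ord_max k.+2)) => j ej; rewrite ej; last first.
    by rewrite (@row_mxEr _ 1 3 k) mxE lexx /=; lra.
  have j2 : j = 2%N :> nat.
    have := ltn_ord j; have := congr1 (@nat_of_ord _) ej; rewrite /= => <-.
    by rewrite !ltnS leqn0 => /eqP ->.
  by rewrite (@row_mxEl _ 1 3 k) mxE j2 expr2; nra.
pose p := unitize m; have p1 : dot p p = 1 by apply: unitize_unit.
have em1 : 1 <= enorm m.
  by rewrite -(ler_pXn2r (_ : 0 < 2)%N) ?nnegrE ?enorm_ge0 // expr1n sqr_enorm.
have pq : dot p q <= 1 / 4.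
  rewrite /p dotZl -[leRHS]mul1r; have /andP[mq0 mq1] := mq; apply: ler_pM => //.
    by rewrite invr_ge0 enorm_ge0.
  by rewrite invf_le1 // (lt_le_trans _ em1).
exists p; split => //; first by rewrite dotC; lra.
move=> t; have u1 := push_unit t 1; rewrite ltNge; apply/negP => ge1.
have {ge1} : push t 1 = p.
  by apply: dot_unit_eq1 => //; apply/eqP; rewrite eq_le ge1; have /andP[_ ->] := dot_unit_le1 u1 p1.
rewrite /push clamp1 mul1r => e.
have [far|near] := leP (dot (c t) q) (3 / 4).
  have f1 : freeze t = 1 by apply: clamp_ge1; lra.
  have [i [s [_ _ _ pe]]] := poly_loop_segment t; have [w [w1 w2 w3]] := xP i.
  move: e; rewrite f1 /blend subrr scale0r add0r scale1r pe => /(congr1 (fun v => dot w (lsubmx v))).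
  rewrite /p /unitize /m !(linearZ, linearD) /= row_mxKl !(dotZr, dotDr) w1 w2 !mulr0 addr0 mulr0.
  move/esym/eqP; rewrite mulf_eq0 invr_eq0 enorm_eq0 -/m (negbTE m0) /= => /eqP w0.
  by rewrite w0 eqxx in w3.
have [b0 b1 bq] := blend_spec t (clamp_itv (4 * (1 - dot (c t) q))).
have := dot_unitize_ge b0 b1 (_ : 0 <= dot _ q); rewrite e => /(_ _) h.
have : dot (blend t (freeze t)) q <= dot p q by apply: h; lra.
by move: bq; rewrite /freeze; lra.
Qed.

End Push.

(** In a sphere of dimension at least two, a loop is freely contracted to the pole, and
    its passages through the pole stay there: push it off a point, then contract the
    punctured sphere. *)
Lemma sphere_loop_contraction : exists G : R -> R -> 'rV[R]_(3 + k),
  [/\ forall t s, contat (uncurry G) (t, s), forall t s, dot (G t s) (G t s) = 1,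
      forall t, G t 0 = c t /\ G t 1 = q, forall s, G 0 s = G 1 s &
      forall t s, c t = q -> G t s = q].
Proof.
have [N N0 fine] := subdivision.
have [p [p1 qp miss]] := push_misses N0 fine.
have q1 : dot q q = 1 by apply: pole_unit.
pose S t s := slide p q (push N t 1) s.
exists (concat (push N) S); split.
- move=> t s; apply: contat_concat; last by rewrite /S slide0 // push_unit.
    by move=> r; apply: contat_push.
  have cP : contat (fun t => push N t 1) t.
    apply: (contat_uncurry_comp (f := push N) (a := id) (b := fun=> 1)); [|by cont|by cont].
    exact: contat_push.
  by move=> r; have := @contat_slide_family R (3 + k) p q (fun t => push N t 1) t r p1 qp (miss t) cP.
- move=> t s; apply: (@concat_in _ _ _ [set v | dot v v = 1]) => r /=.
    exact: push_unit.
  by apply: slide_unit => //; rewrite push_unit.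
- by move=> t; rewrite concat0 concat1 /S push0 slide1 // push_unit.
- move=> s; have e r : push N 0 r = push N 1 r by apply: push_ends.
  rewrite /concat /S; case: (s <= 1 / 2); first exact: e.
  exact: (congr1 (fun v => slide p q v _) (e 1)).
- move=> t s ct; rewrite /concat /S; case: (s <= 1 / 2); first exact: push_fixed.
  by rewrite push_fixed // slide_fixed.
Qed.

End LoopContraction.

(** * Simple connectivity of the double cover *)

Section BasedHomotopy.
Variables (R : realType) (X : topologicalType).

(** The height of the curve that climbs the left side of the square, follows its top
    edge and descends the right side. *)
Definition tent (t : R) : R := clamp (Num.min (3 * t) (3 - 3 * t)).

(** The bottom edge of the square is deformed, with fixed ends, to the three other edges;
    the top one is constant and the two sides cancel. *)
Lemma null_homotopic_of_free (x e : X) (f : path_space R X) (F : R -> R -> X) :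
  path_ends f = (x, x) -> (forall t s, contat (uncurry F) (t, s)) ->
  (forall t, F (set_val t) 0 = path_space_fun f t) -> (forall t, F t 1 = e) ->
  (forall s, F 0 s = F 1 s) -> null_homotopic_loop x f.
Proof.
move=> [f0 f1] cF F0 F1 Fs.
have Fx : F 0 0 = x by rewrite -f0 -F0.
pose K1 (t s : R) := F ((1 - s) * t + s * clamp (3 * t - 1)) (s * tent t).
pose K2 (t s : R) := F 0 ((1 - s) * tent t).
have m0 : tent 0 = 0 by rewrite /tent mulr0 subr0 min_l // clamp0.
have m1 : tent 1 = 0 by rewrite /tent mulr1 subrr min_r // clamp0.
have u0 : clamp (3 * 0 - 1 : R) = 0 by rewrite clamp_le0 //; lra.
have u1 : clamp (3 * 1 - 1 : R) = 1 by rewrite clamp_ge1 //; lra.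
have K12 t : K1 t 1 = K2 t 0.
  rewrite /K1 /K2 !subrr subr0 mul0r add0r !mul1r.
  have [t1|t1] := leP (3 * t - 1) 0; first by rewrite clamp_le0.
  have [t2|t2] := leP 1 (3 * t - 1); first by rewrite clamp_ge1 // Fs.
  by rewrite (_ : tent t = 1) ?F1 // /tent clamp_ge1 // le_min; apply/andP; split; lra.
have cK1 (t s : R) : contat (uncurry K1) (t, s).
  apply: contat_uncurry; apply: (contat_uncurry_comp (f := F)
    (a := fun p : R * R => (1 - p.2) * p.1 + p.2 * clamp (3 * p.1 - 1))
    (b := fun p : R * R => p.2 * tent p.1)); [exact: cF|by cont|].
  by rewrite /tent; cont.
have cK2 (t s : R) : contat (uncurry K2) (t, s).
  apply: contat_uncurry; apply: (contat_uncurry_comp (f := F) (a := fun=> 0)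
    (b := fun p : R * R => (1 - p.2) * tent p.1)); [exact: cF|by cont|].
  by rewrite /tent; cont.
exists (fun p => concat K1 K2 (set_val p.1) (set_val p.2)); split.
- apply: contP => p; apply: (contat_uncurry_comp (f := concat K1 K2)); [|by cont|by cont].
  by apply: contat_concat.
- by move=> t; rewrite /= concat0 /K1 subr0 mul1r !mul0r addr0.
- by move=> t; rewrite /= concat1 /K2 subrr mul0r.
- move=> s; rewrite /concat /K1 /K2 /= u0 u1 m0 m1 !mulr0 addr0 !mulr1 subrK -Fs Fx.
  by case: ifP.
Qed.

End BasedHomotopy.

Section SimplyConnected.
Variables (R : realType) (n : nat).
Local Notation V := ('rV[R]_3 * 'M[R]_(n, 4))%type.
Local Notation Xt := (set_type (@cover_set R n)).

(** The rows are contracted first, while the point of the 2-sphere rests: whenever that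
    point is not a pole of the 2-sphere, all rows are at their pole and stay there.
    The loop in the 2-sphere that remains is then contracted. *)
Lemma cover_space_loops (x : Xt) (f : path_space R Xt) :
  path_ends f = (x, x) -> null_homotopic_loop x f.
Proof.
move=> fx; have [f0 f1] := fx.
pose z t : V := set_val (path_space_fun f (clampI t)).
have cz t : contat z t.
  apply: contat_val; apply: (contat_comp (g := path_space_fun f)); first exact/contE/path_space_eval.
  by apply: contat_clampI; cont.
have zP t : cover_set (z t) by apply: set_valP.
have z_clamp t : z (clamp t) = z t.
  rewrite /z; congr (set_val (path_space_fun f _)).
  by apply: val_inj; rewrite /= clamp_id // clamp_itv.
have z01 : z 0 = z 1 by rewrite /z clampI0 clampI1 f0 f1.
have rowsP i : exists G : R -> R -> 'rV[R]_(3 + 1),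
  [/\ forall t s, contat (uncurry G) (t, s), forall t s, dot (G t s) (G t s) = 1,
      forall t, G t 0 = row i (z t).2 /\ G t 1 = pole R 3, forall s, G 0 s = G 1 s &
      forall t s, row i (z t).2 = pole R 3 -> G t s = pole R 3].
  apply: (@sphere_loop_contraction R 1 (fun t => row i (z t).2)) => [t|t|t|].
  - by have c := @cz t; cont.
  - by have [_ y1 _] := zP t; apply: y1.
  - by rewrite z_clamp.
  - by rewrite z01.
have [Gs [cGs Gs1 Gs01 Gse _]] : exists G : R -> R -> 'rV[R]_(3 + 0),
  [/\ forall t s, contat (uncurry G) (t, s), forall t s, dot (G t s) (G t s) = 1,
      forall t, G t 0 = (z t).1 /\ G t 1 = pole R 2, forall s, G 0 s = G 1 s &
      forall t s, (z t).1 = pole R 2 -> G t s = pole R 2].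
  apply: (@sphere_loop_contraction R 0 (fun t => (z t).1)) => [t|t|t|].
  - by have c := @cz t; cont.
  - by have [s1 _ _] := zP t.
  - by rewrite z_clamp.
  - by rewrite z01.
have [G GP] := choice rowsP.
pose A t s : V := ((z t).1, \matrix_(i < n) G i t s).
pose B t s : V := (Gs t s, poles R n 3).
have AB t : A t 1 = B t 0.
  have [e _] := Gs01 t; rewrite /A /B e; congr (_, _); apply/row_matrixP => i; rewrite rowK row_poles.
  by have [_ _ /(_ t)[_ ->]] := GP i.
have cA t s : contat (uncurry A) (t, s).
  apply: contat_uncurry; apply: contat_pair.
    by apply: contat_fst; apply: (contat_comp (g := z)); [exact: cz|cont].
  apply: contat_matrix_rows => i; have [cG _ _ _ _] := GP i.
  by apply: contat_uncurry_comp; [exact: cG|cont|cont].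
have cB t s : contat (uncurry B) (t, s).
  apply: contat_uncurry; apply: contat_pair; last by cont.
  by apply: contat_uncurry_comp; [exact: cGs|cont|cont].
have inF t s : cover_set (concat A B t s).
  have [s1 y1 sy] := zP t; apply: concat_in => r.
    split => //=; first by move=> i; rewrite rowK; have [_ ->] := GP i.
    case: sy => [yp|]; [left|by right].
    apply/row_matrixP => i; rewrite rowK row_poles; have [_ _ _ _ fix_pole] := GP i.
    by apply: fix_pole; rewrite yp row_poles.
  by split => /=; [exact: Gs1|exact: poles_unit|left].
apply: (@null_homotopic_of_free R Xt x (corestrict (cover_base R n) (north R, poles R n 3)) f
  (fun t s => corestrict (cover_base R n) (concat A B t s))) => //.
- move=> t s; apply/contat_uncurry/contat_corestrictT; last by move=> p; apply: inF.
  apply: contat_uncurry_comp; [|by cont|by cont].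
  exact: contat_concat.
- move=> t; rewrite concat0 -[RHS](corestrict_val (cover_base R n)); congr corestrict.
  have zt : z (set_val t) = set_val (path_space_fun f t) by rewrite /z clampI_val.
  rewrite -zt [RHS]surjective_pairing; congr (_, _).
  apply/row_matrixP => i; rewrite rowK.
  by have [_ _ /(_ (set_val t))[-> _]] := GP i.
- by move=> t; rewrite concat1 /B; have [_ ->] := Gs01 t.
- move=> s; congr corestrict; have eA r : A 0 r = A 1 r.
    rewrite /A z01; congr (_, _); apply/row_matrixP => i; rewrite !rowK.
    by have [_ _ _ ->] := GP i.
  have eB r : B 0 r = B 1 r by rewrite /B Gse.
  by rewrite /concat; case: (s <= 1 / 2).
Qed.

Lemma cover_space_path_connected : path_connected R Xt.
Proof.
split; first by exists (cover_base R n).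
move=> x y.
have path_to_base (w : Xt) : exists g : R -> Xt,
    [/\ forall t, contat g t, g 0 = w & g 1 = cover_base R n].
  have [j wj] := cover_piece_cover w.
  exists (cover_contraction j w); split.
  - move=> t; apply: (contat_uncurry_comp (f := cover_contraction j) (a := fun=> w) (b := id)).
      exact: cover_contraction_continuous.
    + by cont.
    + by cont.
  - by have [] := cover_contraction_ends wj.
  - by have [] := cover_contraction_ends wj.
have [g [cg g0 g1]] := path_to_base x; have [h [ch h0 h1]] := path_to_base y.
pose k (t : R) := concat (fun _ : R => g) (fun (_ : R) s => h (1 - s)) 0 t.
have ck : continuous (fun t : unit_interval R => k (set_val t)).
  apply: contP => t; apply: (contat_uncurry_comp
    (f := concat (fun _ : R => g) (fun (_ : R) s => h (1 - s)))
    (a := fun=> 0)); [|by cont|by cont].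
  apply: contat_concat; last by rewrite g1 subr0 h1.
    by move=> r; apply: contat_uncurry; apply: (contat_comp (g := g)); [exact: cg|cont].
  by move=> r; apply: contat_uncurry; apply: (contat_comp (g := h)); [exact: ch|cont].
exists (mk_path ck); rewrite /path_ends; congr (_, _).
  by rewrite -[LHS]/(k 0) /k concat0 g0.
by rewrite -[LHS]/(k 1) /k concat1 subrr h0.
Qed.

Theorem cover_space_simply_connected : simply_connected R Xt.
Proof. by split; [exact: cover_space_path_connected|exact: cover_space_loops]. Qed.

End SimplyConnected.

(** * Topological complexity of the wedge and of its double cover *)

Lemma is_TC_of_cover (R : realType) (X : topologicalType) k :
  motion_planning_cover R X k -> exists2 m, is_TC R X m & (m <= k)%N.
Proof.
move=> Xk; pose P j := `[< motion_planning_cover R X j >].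
have exP : exists j, P j by exists k; apply/asboolP.
have [m /asboolP Pm minm] := ex_minnP exP; exists m; last exact/minm/asboolP.
by split => // j Xj; apply/minm/asboolP.
Qed.

Theorem theorem3p8 (R : realType) :
  (exists (E B : topologicalType) (p : E -> B),
     [/\ is_ENR R E, is_ENR R B, is_covering_map p, two_to_one p
       & exists m n : nat, [/\ is_TC R E m, is_TC R B n & (m > n)%N]])
  /\
  (exists (X Xt : topologicalType) (p : Xt -> X),
     [/\ is_finite_complex R X, is_ENR R X, is_ENR R Xt,
         is_universal_covering R p
       & exists m n : nat, [/\ is_TC R X m, is_TC R Xt n & (m < n)%N]]).
Proof.
have [k Xtk] := cover_space_TC_finite R 5.
have [m tcXt _] := is_TC_of_cover Xtk.
have [l tcX l10] := is_TC_of_cover (base_space_TC_upper R 5).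
have lm : (l < m)%N by have [/cover_space_TC_lower h _] := tcXt; apply: leq_ltn_trans l10 h.
have [cov two] := cover_map_covering R 5.
split.
  exists (set_type (@cover_set R 5)), (set_type (@base_set R 5)), (@cover_map R 5).
  split => //; [exact: cover_space_ENR|exact: base_space_ENR|by exists m, l].
exists (set_type (@base_set R 5)), (set_type (@cover_set R 5)), (@cover_map R 5).
split; [exact: base_space_finite_complex|exact: base_space_ENR|exact: cover_space_ENR| |].
  by split; [|exact: cover_space_simply_connected].
by exists l, m.
Qed.
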